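(* For all Borel probability measures $P,Q$ on $\Xi$ with $g\in L_2(\Xi,P;H)$ and $g\in L_2(\Xi,Q;H)$, the unique minimizers $z(P)$ of $F_P$ over $Z_{\rm ad}$ and $z(Q)$ of $F_Q$ over $Z_{\rm ad}$ satisfy \[ \|z(Q)-z(P)\|_{H}\le\frac{8}{\alpha}\,d_{\mathfrak{F}_{di}}(P,Q), \] where \[ d_{\mathfrak{F}_{di}}(P,Q)=\sup_{\varphi\in\mathfrak{F}_{di}}\left|\int_\Xi \varphi(\xi)\,dP(\xi)-\int_\Xi \varphi(\xi)\,dQ(\xi)\right| \] and $\mathfrak{F}_{di}$ is the following class of real-valued functions on $\Xi$: \[ \mathfrak{F}_{di}=\left\{\langle A(\cdot)^{-1}(z+g(\cdot))-\widetilde{u},\,A(\cdot)^{-1}h\rangle_{H}+\alpha\langle z,h\rangle_{H}\;:\;z\in Z_{\rm ad},\ h\in H,\ \|h\|_{H}\le 1\right\}. \]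
   Context: Let $\Xi$ be a metric space with its Borel $\sigma$-algebra. Let $D\subset\mathbb{R}^m$ be an open bounded domain with Lipschitz boundary, $V=H_0^1(D)$ with inner product $(u,v)_V=\int_D\nabla u\cdot\nabla v\,dx$ and the induced norm $\|\cdot\|$, $V^\star=H^{-1}(D)$ its dual with dual pairing $\langle\cdot,\cdot\rangle$ and dual norm $\|\cdot\|_\star$, and $H=L^2(D)$ with its usual inner product $\langle\cdot,\cdot\rangle_H$ and norm $\|\cdot\|_H$; $H$ is regarded as a subspace of $V^\star$ via $\langle h,v\rangle=\int_D h v\,dx$. Let $\alpha>0$, $\widetilde{u}\in H$, and let $Z_{\rm ad}\subset H$ be nonempty, closed, convex and bounded. The functions $b_{ij}:D\times\Xi\to\mathbb{R}$ ($i,j=1,\dots,m$) are measurable and there are constants $L>\gamma>0$ with $\gamma\sum_{i=1}^m y_i^2\le\sum_{i,j=1}^m b_{ij}(x,\xi)y_iy_j\le L\sum_{i=1}^m y_i^2$ for all $y\in\mathbb{R}^m$, a.e. $x\in D$ and all $\xi\in\Xi$. Define $a(u,v;\xi)=\int_D\sum_{i,j=1}^m b_{ij}(x,\xi)\frac{\partial u}{\partial x_i}(x)\frac{\partial v}{\partial x_j}(x)\,dx$ for $u,v\in V$, and $A(\xi):V\to V^\star$ by $\langle A(\xi)u,v\rangle=a(u,v;\xi)$. The operators are uniformly bounded and positive definite: $\|A(\xi)u\|_\star\le L\|u\|$ and $\langle A(\xi)u,u\rangle\ge\gamma\|u\|^2$; hence $A(\xi)^{-1}:V^\star\to V$ exists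 and is bounded with norm at most $\gamma^{-1}$. The function $g:D\times\Xi\to\mathbb{R}$ is measurable with $g(\xi):=g(\cdot,\xi)\in H$ for each $\xi\in\Xi$. $L_2(\Xi,P;H)$ denotes the space of strongly measurable $y:\Xi\to H$ with $\int_\Xi\|y(\xi)\|_H^2\,dP(\xi)<\infty$. Define, for $z\in H$, $\xi\in\Xi$, \[ f(z,\xi)=\tfrac12\big\|A(\xi)^{-1}(z+g(\xi))-\widetilde{u}\big\|_H^2+\tfrac{\alpha}{2}\|z\|_H^2,\qquad F_P(z)=\int_\Xi f(z,\xi)\,dP(\xi). \] For each Borel probability measure $P$ on $\Xi$ with $g\in L_2(\Xi,P;H)$, $F_P$ is finite, continuous and strongly convex on $H$ and has a unique minimizer $z(P)$ over $Z_{\rm ad}$. *)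

(* Defs.v *)
From HB Require Import structures.
From mathcomp Require Import all_boot all_order all_algebra.
From mathcomp Require Import all_classical all_reals all_analysis.

Set Implicit Arguments.
Unset Strict Implicit.
Unset Printing Implicit Defensive.

Import Order.TTheory GRing.Theory Num.Theory.
Import numFieldNormedType.Exports.

Local Open Scope classical_set_scope.
Local Open Scope ring_scope.

(* Measurable types are pointed in the library, hence so are the metric spaces
   considered here; a space carrying a probability measure is nonempty anyway. *)
#[short(type="pmetricType")]
HB.structure Definition PointedMetric (K : numDomainType) :=
  {M of Metric K M & isPointed M}.

Notation borel X := (g_sigma_algebraType (@open X)).

(* The Borel sigma-algebra of R^n, as the product sigma-algebra B(R)^n: it is
   generated by the coordinates, just like that of n.-tuple R. *)
Definition rV_display : measure_display -> measure_display.
Proof. exact. Qed.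

Section measurable_rV.
Context {R : realType} (n : nat).

Let coors : 'I_n -> 'rV[R]_n -> measurableTypeR R := fun i x => x ord0 i.

Let rV_set0 : g_sigma_preimage coors set0.
Proof. exact: sigma_algebra0. Qed.

Let rV_setC A : g_sigma_preimage coors A -> g_sigma_preimage coors (~` A).
Proof. exact: sigma_algebraC. Qed.

Let rV_bigcup (F : _^nat) : (forall i, g_sigma_preimage coors (F i)) ->
  g_sigma_preimage coors (\bigcup_i (F i)).
Proof. exact: sigma_algebra_bigcup. Qed.

HB.instance Definition _ := @isMeasurable.Build (rV_display default_measure_display)
  'rV[R]_n (g_sigma_preimage coors) rV_set0 rV_setC rV_bigcup.

Lemma measurable_coord (i : 'I_n) :
  measurable_fun [set: 'rV[R]_n] (fun x : 'rV[R]_n => x ord0 i : measurableTypeR R).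
Proof.
move=> _ Y mY; rewrite setTI; apply: sub_sigma_algebra.
by rewrite (bigD1 i)//=; left; exists Y => //; rewrite setTI.
Qed.

Lemma measurable_fun_rV d (T : measurableType d) (f : T -> 'rV[R]_n) :
  (forall i, measurable_fun setT (fun t => f t ord0 i : measurableTypeR R)) ->
  measurable_fun setT f.
Proof.
move=> mf; apply: (@measurability _ _ _ _ setT f _ erefl).
move=> _ [A + <-].
elim/big_ind : _ => // [B C mB mC [/mB//|/mC//]|i _ [B mB <-]].
by rewrite !setTI -[X in measurable X]setTI; exact: (mf i).
Qed.

End measurable_rV.

Section lebesgue_rV.
Context {R : realType}.

Definition rV_cons n (p : 'rV[R]_n * measurableTypeR R) : 'rV[R]_n.+1 :=
  row_mx (\row_(_ < 1) p.2) p.1.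

Lemma measurable_rV_cons n : measurable_fun setT (@rV_cons n).
Proof.
apply: measurable_fun_rV => i.
rewrite -[n.+1]/(1 + n)%N in i *; case: (split_ordP i) => j ->.
  under eq_fun do rewrite row_mxEl mxE.
  exact: measurable_snd.
under eq_fun do rewrite row_mxEr.
exact: (measurableT_comp (measurable_coord j) measurable_fst).
Qed.

HB.instance Definition _ n :=
  isMeasurableFun.Build _ _ _ _ (@rV_cons n) (@measurable_rV_cons n).

(* Lebesgue measure on R^n, as the n-fold product of Lebesgue measure on R. *)
Definition rV_prod n (m : {measure set 'rV[R]_n -> \bar R}) :
    set 'rV[R]_n.+1 -> \bar R :=
  pushforward (m \x lebesgue_measure)%E (@rV_cons n).

HB.instance Definition _ n m :=
  Measure.copy (@rV_prod n m)
    (measure_function_pushforward__canonical__measure_function_Measure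
       (m \x lebesgue_measure)%E (@measurable_rV_cons n)).

Fixpoint lebesgue_rV n : {measure set 'rV[R]_n -> \bar R} :=
  match n return {measure set 'rV[R]_n -> \bar R} with
  | 0 => \d_(0 : 'rV[R]_0)
  | n'.+1 => rV_prod (lebesgue_rV n')
  end.

End lebesgue_rV.

Section domain.
Context {R : realType} {n : nat}.
Implicit Type D : set 'rV[R]_n.+1.

Definition boundary D : set 'rV[R]_n.+1 := closure D `\` interior D.

Definition bounded_domain D :=
  [/\ open D, connected D, D !=set0 & bounded_set D].

(* Near each boundary point, in suitable Cartesian coordinates y = x *m U,
   D is the strict epigraph of a Lipschitz function of all but the last
   coordinate. *)
Definition lipschitz_boundary D :=
  forall x0, boundary D x0 ->
  exists (U : 'M[R]_n.+1) (phi : 'rV[R]_n -> R) (r : R),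
    [/\ U *m U^T = 1%:M, lipschitz phi, 0 < r &
      forall x, ball x0 r x ->
        (D x <-> phi (col' ord_max (x *m U)) < (x *m U) ord0 ord_max)].

End domain.

(* Elements of L^2(D) and of its subspaces are represented by functions on R^n
   whose values outside D are irrelevant, instead of by classes modulo equality
   a.e. on D. A set that is L2_closed is a union of such classes. *)
Section sobolev.
Context {R : realType} {n : nat} (D : set 'rV[R]_n.+1).
Local Notation fct := ('rV[R]_n.+1 -> R).
Local Notation leb := (@lebesgue_rV R n.+1).
Implicit Types (u v w h : fct) (i : 'I_n.+1).

Definition L2 : set fct :=
  [set u : fct | measurable_fun D u /\ (\int[leb]_(x in D) (u x ^+ 2)%:E < +oo)%E].

Definition L2dot u v : R := \int[leb]_(x in D) (u x * v x).

Definition L2norm u : R := Num.sqrt (L2dot u u).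

Definition pderiv i (f : fct) : fct := fun x => 'D_(delta_mx ord0 i) f x.

Definition smooth (f : fct) := forall s : seq 'I_n.+1,
  let df := foldr pderiv f s in
  continuous df /\ forall i x, derivable df x (delta_mx ord0 i).

Definition test_fun (f : fct) :=
  let supp := closure [set x | f x != 0] in
  [/\ smooth f, compact supp & supp `<=` D].

Definition is_weak_pderiv i u w :=
  L2 w /\ forall f, test_fun f ->
    \int[leb]_(x in D) (u x * pderiv i f x) =
    - \int[leb]_(x in D) (w x * f x).

Definition H1 : set fct :=
  [set u : fct | L2 u /\ forall i, exists w, is_weak_pderiv i u w].

(* For u in H^1(D); unique up to a.e. equality on D. *)
Definition weak_pderiv i u : fct := xget (fun=> 0) [set w : fct | is_weak_pderiv i u w].

Definition H1norm u : R :=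
  Num.sqrt (L2norm u ^+ 2 + \sum_i L2norm (weak_pderiv i u) ^+ 2).

(* H^1_0(D): the closure in H^1(D) of the test functions. *)
Definition H10 : set fct :=
  [set u : fct | H1 u /\
    forall e : R, 0 < e -> exists f, test_fun f /\ H1norm (u - f) < e].

Definition H10dot u v : R :=
  \int[leb]_(x in D) \sum_i weak_pderiv i u x * weak_pderiv i v x.

Definition H10norm u : R := Num.sqrt (H10dot u u).

(* Elements of H^{-1}(D) are represented by functionals of which only the values
   on H^1_0(D) matter. *)
Definition dual_norm (l : fct -> R) : \bar R :=
  ereal_sup [set `|l v|%:E | v in [set v : fct | H10 v /\ H10norm v <= 1]].

Definition L2_to_dual h : fct -> R := fun v => \int[leb]_(x in D) (h x * v x).

Definition L2_closed (Z : set fct) := forall z, L2 z ->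
  (forall e : R, 0 < e -> exists w, Z w /\ L2norm (z - w) < e) -> Z z.

Definition L2_bounded (Z : set fct) := exists M : R, forall z, Z z -> L2norm z <= M.

Definition convex_subset (Z : set fct) := forall z w (t : R), Z z -> Z w ->
  0 <= t <= 1 -> Z (fun x => t * z x + (1 - t) * w x).

End sobolev.

Section bochner.
Context {R : realType} {n : nat} (D : set 'rV[R]_n.+1) {Xi : pmetricType R}.
Local Notation fct := ('rV[R]_n.+1 -> R).

Definition simple_L2 (s : Xi -> fct) :=
  exists (k : nat) (B : 'I_k -> set (borel Xi)) (h : 'I_k -> fct),
    (forall i, measurable (B i) /\ L2 D (h i)) /\
    forall xi, s xi = (fun x => \sum_(i < k) \1_(B i) xi * h i x).

Definition strongly_measurable (P : probability (borel Xi) R) (y : Xi -> fct) :=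
  exists s : nat -> Xi -> fct, (forall k, simple_L2 (s k)) /\
    {ae P, forall xi, L2norm D (s k xi - y xi) @[k --> \oo] --> (0 : R)}.

Definition L2_bochner (P : probability (borel Xi) R) : set (Xi -> fct) :=
  [set y | [/\ forall xi, L2 D (y xi), strongly_measurable P y &
    (\int[P]_xi (L2norm D (y xi) ^+ 2)%:E < +oo)%E]].

End bochner.

Section pde.
Context {R : realType} {n : nat} (D : set 'rV[R]_n.+1) {Xi : pmetricType R}.
Local Notation fct := ('rV[R]_n.+1 -> R).
Local Notation leb := (@lebesgue_rV R n.+1).
Context (b : 'I_n.+1 -> 'I_n.+1 -> 'rV[R]_n.+1 -> Xi -> R).

Definition bform_integrand (xi : Xi) (u v : fct) : fct := fun x =>
  \sum_i \sum_j b i j x xi * weak_pderiv D i u x * weak_pderiv D j v x.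

Definition bform (u v : fct) (xi : Xi) : R :=
  \int[leb]_(x in D) bform_integrand xi u v x.

Definition A_op (xi : Xi) (u : fct) : fct -> R := fun v => bform u v xi.

(* The solution u in V of A(xi) u = l in V^*; unique up to a.e. equality. *)
Definition A_inv (xi : Xi) (l : fct -> R) : fct :=
  xget (fun=> 0) [set u : fct | H10 D u /\ forall v, H10 D v -> A_op xi u v = l v].

Context (g : 'rV[R]_n.+1 -> Xi -> R) (utilde : fct) (alpha : R).

Definition solution (z : fct) (xi : Xi) : fct :=
  A_inv xi (L2_to_dual D (z + g^~ xi)).

Definition objective (z : fct) (xi : Xi) : R :=
  2^-1 * L2norm D (solution z xi - utilde) ^+ 2 + alpha / 2 * L2norm D z ^+ 2.

Definition expected_objective (P : probability (borel Xi) R) (z : fct) : \bar R :=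
  \int[P]_xi (objective z xi)%:E.

Definition Fdi (Zad : set fct) : set (Xi -> R) :=
  [set phi | exists z h, [/\ Zad z, L2 D h, L2norm D h <= 1 &
    phi = fun xi => L2dot D (solution z xi - utilde) (A_inv xi (L2_to_dual D h))
                    + alpha * L2dot D z h]].

End pde.

Definition is_minimizer {R : realType} {T : Type} (F : T -> \bar R) (Z : set T)
    (z : T) :=
  Z z /\ forall w, Z w -> (F z <= F w)%E.

Definition sup_dist {R : realType} {Xi : pmetricType R} (F : set (Xi -> R))
    (P Q : probability (borel Xi) R) : \bar R :=
  ereal_sup [set `|\int[P]_xi phi xi - \int[Q]_xi phi xi|%:E | phi in F].

(* Main.v *)
From HB Require Import structures.
Require Import Defs.
From mathcomp Require Import all_boot all_order all_algebra.
From mathcomp Require Import all_classical all_reals all_analysis measurable_realfun.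
From mathcomp Require Import ring lra.
Import Order.TTheory GRing.Theory Num.Theory.
Import numFieldNormedType.Exports.
Local Open Scope classical_set_scope.
Local Open Scope ring_scope.
Set Implicit Arguments.
Unset Strict Implicit.
Unset Printing Implicit Defensive.

(** Write [S z xi] for the state and [T xi h] for the solution of the equation
    with right-hand side [h].  Since [S z xi] is affine in [z], the objective is
    quadratic: its value at [z + t h] is its value at [z], plus [t] times
      [f'(z; h, xi) = <S z xi - utilde, T xi h> + alpha <z, h>],
    plus [t^2 / 2] times [|T xi h|^2 + alpha |h|^2] ([cost_expansion]).  The
    functions [f'(z; h, .)] with [z] admissible and [|h| <= 1] are exactly the
    class over which the distance of [P] and [Q] is a supremum.

    Put [h = zQ - zP].  As the admissible set is convex, the minimality of [zP]
    and of [zQ] gives ([variational_inequality])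
      [0 <= \int_P f'(zP; h, .)] and [\int_Q f'(zQ; h, .) <= 0],
    and the quadratic term gives [f'(zP; h, .) + alpha |h|^2 <= f'(zQ; h, .)].
    Hence [alpha |h|^2 <= \int_P f'(zQ; h, .) - \int_Q f'(zQ; h, .)], and dividing
    by [|h|] bounds [alpha |h|] by the distance of [P] and [Q]
    ([minimizers_dist]): the estimate holds with [1 / alpha], a fortiori with
    [8 / alpha].

    The rest of the proof shows that these expressions behave as they should:
    that the solution operator exists and is linear and bounded, and that
    [f'(z; h, .)] is integrable.

    Existence is the Lax-Milgram theorem ([lax_milgram]) in [H10 D].  Coercivity
    and boundedness of the bilinear form come from ellipticity and from the bound
    on the dual norm; that [L2] functions act continuously on [H10 D] is the
    Poincare inequality ([poincare]); completeness of [H10 D] ([H10_complete])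
    follows from that of [L2 D] ([sq_integrable_complete]) and the closedness of
    weak differentiation.  Functions are not identified when they agree almost
    everywhere, so the inner products are only semi-definite, and the weak
    derivative of a function is determined up to a null set: this last fact
    ([weak_pderiv_ae_unique]) rests on a supply of test functions approximating
    the indicator of any open set ([indic_open_test_fun]), and the coincidence of
    weak and classical derivatives of test functions on the translation
    invariance of Lebesgue measure ([integral_pderiv_eq0]).

    Integrability in [xi] reduces to measurability, by the uniform bound on the
    solution operator.  The solution is only known through the equation it solves,
    so measurability is obtained by approximation: [H10 D] has a countable dense
    sequence ([H10_separable]), and the set of [xi] for which a given member of it
    solves the equation up to a given error is measurable, because the error can be
    tested against the sequence alone ([measurable_solution_dot]). *)

(** * Lax-Milgram in spaces with a semi-definite inner product *)

(** Inner products of functions that are not identified when equal almost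
    everywhere: only semi-definite, and linear only on the subspace [V] of the
    functions of interest. *)
Record semi_inner {R : realType} {E : lmodType R} (V : set E)
    (dot : E -> E -> R) : Prop := SemiInner {
  si0 : V 0;
  siP : forall a u v, V u -> V v -> V (u + a *: v);
  siDl : forall a u v w, V u -> V v -> V w ->
    dot (u + a *: v) w = dot u w + a * dot v w;
  siC : forall u v, V u -> V v -> dot u v = dot v u;
  si_ge0 : forall u, V u -> 0 <= dot u u }.

Definition linear_on {R : realType} {E : lmodType R} (V : set E) (l : E -> R) :=
  forall a u v, V u -> V v -> l (u + a *: v) = l u + a * l v.

(** Completeness, tested on sequences with geometric increments, to which every Cauchy
    sequence reduces by extraction; the explicit rate replaces limits by
    inequalities. *)
Definition complete_on {R : realType} {E : lmodType R} (V : set E)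
    (dot : E -> E -> R) :=
  forall (u_ : nat -> E) (C : R), (forall k, V (u_ k)) ->
  (forall i j, (i <= j)%N -> dot (u_ j - u_ i) (u_ j - u_ i) <= C * (2^-1 ^+ i) ^+ 2) ->
  exists u (C' : R), V u /\
    forall k, dot (u_ k - u) (u_ k - u) <= C' * (2^-1 ^+ k) ^+ 2.

Lemma le0_of_le_geometric (R : realType) (x C : R) :
  (forall k, x <= C * 2^-1 ^+ k) -> x <= 0.
Proof.
move=> H; have : (fun k => C * 2^-1 ^+ k) @ \oo --> (0 : R).
  by apply: cvg_geometric; rewrite ger0_norm; lra.
move=> h; rewrite -(cvg_lim _ h)//; apply: limr_ge; first by apply/cvg_ex; exists 0.
by apply: nearW => k; exact: H.
Qed.

Lemma sqr_geometric_le (R : realType) (C : R) k :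
  C * (2^-1 ^+ k) ^+ 2 <= `|C| * 2^-1 ^+ k.
Proof.
have q0 : 0 <= (2^-1 : R) ^+ k by rewrite exprn_ge0.
have q1 : (2^-1 : R) ^+ k <= 1 by apply: exprn_ile1; lra.
apply: (@le_trans _ _ (`|C| * (2^-1 ^+ k) ^+ 2)).
  by rewrite ler_wpM2r ?sqr_ge0// ler_norm.
by rewrite ler_wpM2l// expr2 ler_piMr.
Qed.

Section semi_inner_theory.
Context (R : realType) (E : lmodType R) (V : set E) (dot : E -> E -> R).
Hypothesis si : semi_inner V dot.
Let nm u := Num.sqrt (dot u u).

Lemma siZ a u : V u -> V (a *: u).
Proof. by move=> Vu; rewrite -[_ *: _]add0r; apply: (siP si) => //; exact: si0 si. Qed.

Lemma siD u v : V u -> V v -> V (u + v).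
Proof. by move=> Vu Vv; rewrite -[v]scale1r; apply: (siP si). Qed.

Lemma siN u : V u -> V (- u).
Proof. by move=> Vu; rewrite -scaleN1r; apply: siZ. Qed.

Lemma siB u v : V u -> V v -> V (u - v).
Proof. by move=> Vu Vv; apply: siD => //; exact: siN. Qed.

Lemma siDr a u v w : V u -> V v -> V w ->
  dot w (u + a *: v) = dot w u + a * dot w v.
Proof.
move=> Vu Vv Vw; rewrite (siC si)//; last exact: (siP si).
by rewrite (siDl si)// (siC si Vu)// (siC si Vv).
Qed.

Lemma linear_on_dot w : V w -> linear_on V (dot w).
Proof. by move=> Vw a u v Vu Vv; rewrite siDr. Qed.

Lemma linear_onB l u v : linear_on V l -> V u -> V v -> l (u - v) = l u - l v.
Proof. by move=> ll Vu Vv; rewrite -scaleN1r ll// mulN1r. Qed.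

Lemma linear_onZ l a u : linear_on V l -> V u -> l (a *: u) = a * l u.
Proof.
move=> ll Vu; have V0 := si0 si.
have l0 : l 0 = 0 by have := ll 1 0 0 V0 V0; rewrite scale1r addr0; lra.
by have := ll a 0 u V0 Vu; rewrite add0r l0 add0r.
Qed.

Lemma siBl u v w : V u -> V v -> V w -> dot (u - v) w = dot u w - dot v w.
Proof. by move=> Vu Vv Vw; rewrite -scaleN1r (siDl si)// mulN1r. Qed.

Lemma siBr u v w : V u -> V v -> V w -> dot w (u - v) = dot w u - dot w v.
Proof. by move=> Vu Vv Vw; rewrite -scaleN1r siDr// mulN1r. Qed.

Lemma sqP a u v : V u -> V v ->
  dot (u + a *: v) (u + a *: v) = dot u u + 2 * a * dot u v + a ^+ 2 * dot v v.
Proof.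
move=> Vu Vv; have Vuv := siP si a Vu Vv.
by rewrite (siDl si)// !siDr// (siC si Vv Vu); ring.
Qed.

(** The discriminant of the nonnegative polynomial [sqP] in [a]. *)
Lemma siCS u v : V u -> V v -> dot u v ^+ 2 <= dot u u * dot v v.
Proof.
move=> Vu Vv.
have H t : 0 <= dot u u + 2 * t * dot u v + t ^+ 2 * dot v v.
  by rewrite -sqP//; apply: (si_ge0 si); exact: (siP si).
have dv := si_ge0 si Vv; have du := si_ge0 si Vu.
move: dv; rewrite le_eqVlt => /predU1P[dv|dv].
  have [->|d0] := eqVneq (dot u v) 0; first by rewrite -dv mulr0 expr0n.
  (* When [dot v v = 0] the polynomial is affine, hence constant. *)
  have := H (- (dot u u + 1) / dot u v); rewrite -dv !mulr0 addr0.
  have -> : 2 * (- (dot u u + 1) / dot u v) * dot u v = - 2 * (dot u u + 1) by field.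
  lra.
have := H (- dot u v / dot v v).
have -> : dot u u + 2 * (- dot u v / dot v v) * dot u v + (- dot u v / dot v v) ^+ 2 * dot v v
  = (dot u u * dot v v - dot u v ^+ 2) / dot v v by field; rewrite gt_eqF.
by rewrite pmulr_lge0 ?invr_gt0// subr_ge0.
Qed.

Lemma nm_sqr u : V u -> nm u ^+ 2 = dot u u.
Proof. by move=> Vu; rewrite sqr_sqrtr// (si_ge0 si). Qed.

Lemma siCSn u v : V u -> V v -> `|dot u v| <= nm u * nm v.
Proof.
move=> Vu Vv; rewrite -ler_sqr ?nnegrE ?mulr_ge0 ?sqrtr_ge0//.
by rewrite real_normK ?num_real// exprMn !nm_sqr// siCS.
Qed.

Lemma nmD u v : V u -> V v -> nm (u + v) <= nm u + nm v.
Proof.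
move=> Vu Vv; have Vuv := siD Vu Vv.
rewrite -ler_sqr ?nnegrE ?addr_ge0 ?sqrtr_ge0//.
rewrite sqrrD !nm_sqr//; have := sqP 1 Vu Vv.
rewrite scale1r expr1n mul1r mulr1 => ->.
rewrite lerD2r lerD2l -[leRHS]mulr_natl ler_pM2l//.
by apply: le_trans (siCSn Vu Vv); exact: ler_norm.
Qed.

Lemma siZl a u w : V u -> V w -> dot (a *: u) w = a * dot u w.
Proof.
move=> Vu Vw; rewrite (siC si)//; last exact: siZ.
by rewrite (linear_onZ _ (linear_on_dot Vw))// (siC si Vu).
Qed.

Lemma siZr a u w : V u -> V w -> dot w (a *: u) = a * dot w u.
Proof. by move=> Vu Vw; rewrite (linear_onZ _ (linear_on_dot Vw)). Qed.

Lemma nmZ a u : V u -> nm (a *: u) = `|a| * nm u.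
Proof.
move=> Vu; rewrite /nm siZl ?siZr//; last exact: siZ.
by rewrite mulrA -expr2 sqrtrM ?sqr_ge0// sqrtr_sqr.
Qed.

Lemma nmB u v : V u -> V v -> nm (u - v) = nm (v - u).
Proof.
move=> Vu Vv; rewrite -opprB -(scaleN1r (v - u)) nmZ; last exact: siB.
by rewrite normrN normr1 mul1r.
Qed.

Lemma nm_ge_sub u v : V u -> V v -> nm u - nm v <= nm (u - v).
Proof.
by move=> Vu Vv; rewrite lerBlDr; apply: le_trans (nmD _ _); rewrite ?subrK//; exact: siB.
Qed.

End semi_inner_theory.

(** Minimizing [v |-> dot v v - 2 * l v]: the parallelogram law makes every
    minimizing sequence a Cauchy sequence, and the first-order condition at its
    limit is the representation of [l]. *)
Lemma riesz_representation (R : realType) (E : lmodType R) (V : set E)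
    (dot : E -> E -> R) (l : E -> R) (C : R) :
  semi_inner V dot -> complete_on V dot -> linear_on V l ->
  (forall v, V v -> l v ^+ 2 <= C * dot v v) ->
  exists u, V u /\ forall v, V v -> dot u v = l v.
Proof.
move=> si cplt ll lC.
wlog C0 : C lC / 0 <= C.
  move=> /(_ (Num.max C 0)); apply; last by rewrite le_max lexx orbT.
  move=> v Vv; apply: le_trans (lC v Vv) _.
  by rewrite ler_wpM2r ?(si_ge0 si)// le_max lexx.
pose J v := dot v v - 2 * l v.
have JC v : V v -> - C <= J v.
  move=> Vv; have d0 := si_ge0 si Vv; have := lC v Vv; rewrite /J => h.
  rewrite leNgt; apply/negP => h2.
  have : (dot v v + C) ^+ 2 < (2 * l v) ^+ 2.
    by rewrite ltr_sqr ?nnegrE; lra.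
  by have := sqr_ge0 (dot v v - C); lra.
pose m := inf (J @` V).
have V0 := si0 si.
have JVinf : has_inf (J @` V).
  split; first by exists (J 0); exists 0.
  by exists (- C) => _ [v Vv <-]; exact: JC.
have Jm v : V v -> m <= J v by move=> Vv; apply: ge_inf; [case: JVinf|exists v].
have /choice[u_ u_P] : forall k, exists u, V u /\ J u <= m + (2^-1 ^+ k) ^+ 2.
  move=> k; have e0 : 0 < ((2^-1 : R) ^+ k) ^+ 2 by rewrite !exprn_gt0.
  have [_ [u Vu <-] /ltW Ju] := inf_adherent e0 JVinf.
  by exists u.
have Vu_ k : V (u_ k) by case: (u_P k).
have Ju_ k : J (u_ k) <= m + (2^-1 ^+ k) ^+ 2 by case: (u_P k).
have [|u [C' [Vu uC']]] := cplt u_ 4 Vu_.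
  move=> i j ij; have Vi := Vu_ i; have Vj := Vu_ j.
  have Vd := siB si Vj Vi.
  have := Jm _ (siP si 2^-1 Vi Vd).
  rewrite {1}/J (sqP si)// ll// (linear_onB ll Vj Vi).
  have -> : dot (u_ i) (u_ j - u_ i) = dot (u_ i) (u_ j) - dot (u_ i) (u_ i).
    by rewrite (siBr si).
  have -> : dot (u_ j - u_ i) (u_ j - u_ i) =
      dot (u_ j) (u_ j) - 2 * dot (u_ i) (u_ j) + dot (u_ i) (u_ i).
    by rewrite (siBr si)// !(siBl si)// (siC si Vj Vi); ring.
  have := Ju_ i; have := Ju_ j; rewrite /J.
  have : (2^-1 ^+ j) ^+ 2 <= ((2^-1 : R) ^+ i) ^+ 2.
    by rewrite ler_sqr ?nnegrE ?exprn_ge0//; apply: ler_wiXn2l => //; lra.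
  lra.
exists u; split => // v Vv; apply/eqP; rewrite -subr_eq0 -sqrf_eq0.
have d0 := si_ge0 si Vv.
set x := dot u v - l v.
rewrite eq_le sqr_ge0 andbT.
apply: (@le0_of_le_geometric _ _ (2 * C' * dot v v + (dot v v + 1) ^+ 2)) => k.
set q : R := 2^-1 ^+ k.
have q0 : 0 < q by rewrite exprn_gt0.
have q1 : q <= 1 by apply: exprn_ile1; lra.
apply: (@le_trans _ _ ((2 * C' * dot v v + (dot v v + 1) ^+ 2) * q ^+ 2)); last first.
  have C'0 : 0 <= C'.
    by have := uC' 0%N; have := si_ge0 si (siB si (Vu_ 0%N) Vu); rewrite expr0; lra.
  have : 0 <= C' * dot v v by rewrite mulr_ge0.
  move=> K0; apply: ler_wpM2l; last by rewrite expr2 ler_piMr// ltW.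
  by have := sqr_ge0 (dot v v + 1); lra.
set y := dot (u_ k) v - l v.
have xy : (y - x) ^+ 2 <= C' * q ^+ 2 * dot v v.
  have -> : y - x = dot (u_ k - u) v by rewrite (siBl si)// /x /y; ring.
  apply: le_trans (siCS si (siB si (Vu_ k) Vu) Vv) _.
  by rewrite ler_wpM2r//.
have y1 t : 0 <= 2 * t * y + t ^+ 2 * dot v v + q ^+ 2.
  have := Jm _ (siP si t (Vu_ k) Vv); have := Ju_ k; rewrite /J (sqP si)// ll// /y -/q.
  lra.
have yq : y ^+ 2 <= (q * (dot v v + 1)) ^+ 2 / 4.
  have := y1 q; have := y1 (- q) => h1 h2.
  have : - (q * (dot v v + 1)) <= 2 * y <= q * (dot v v + 1).
    by apply/andP; split; rewrite -(ler_pM2l q0); nra.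
  move: (q * _) => B /andP[h3 h4].
  have : 0 <= (B - 2 * y) * (B + 2 * y) by apply: mulr_ge0; lra.
  by lra.
have : x ^+ 2 <= 2 * (y - x) ^+ 2 + 2 * y ^+ 2.
  have := sqr_ge0 (2 * y - x); lra.
by have := sqr_ge0 (q * (dot v v + 1)); lra.
Qed.

(** With [F u] the Riesz representative of [a u] and [f] that of [l], the form
    [s u v = dot (F u) (F v)] is symmetric and equivalent to [dot].  Applying the
    Riesz theorem to [s] gives a [u] whose residual [F u - f] is orthogonal to the
    range of [F]; coercivity forces this residual to be null. *)
Lemma lax_milgram (R : realType) (E : lmodType R) (V : set E)
    (dot a : E -> E -> R) (l : E -> R) (gamma M C : R) :
  semi_inner V dot -> complete_on V dot ->
  (forall v, V v -> linear_on V (a^~ v)) -> (forall u, V u -> linear_on V (a u)) ->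
  (forall u v, V u -> V v -> a u v ^+ 2 <= M * dot u u * dot v v) ->
  0 < gamma -> (forall u, V u -> gamma * dot u u <= a u u) ->
  linear_on V l -> (forall v, V v -> l v ^+ 2 <= C * dot v v) ->
  exists u, V u /\ forall v, V v -> a u v = l v.
Proof.
move=> si cplt al ar aM g0 ag ll lC.
have /choice[F FP] : forall u, exists w, V u -> V w /\ forall v, V v -> dot w v = a u v.
  move=> u; have [Vu|nVu] := pselect (V u); last by exists 0.
  have [w wP] := @riesz_representation _ _ _ _ (a u) (M * dot u u) si cplt (ar u Vu)
    (fun v Vv => aM u v Vu Vv).
  by exists w.
have VF u : V u -> V (F u) by move=> /FP[].
have aF u v : V u -> V v -> dot (F u) v = a u v by move=> /FP[_]; exact.
have [f [Vf fl]] := riesz_representation si cplt ll lC.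
pose s u v := dot (F u) (F v).
have s_si : semi_inner V s.
  split; [exact: si0 si|exact: siP si| | |].
  - move=> c u v w Vu Vv Vw; have VFw := VF _ Vw; have Vuv := siP si c Vu Vv.
    by rewrite /s !aF// al.
  - by move=> u v Vu Vv; rewrite /s (siC si)//; exact: VF.
  - by move=> u Vu; rewrite /s; apply: (si_ge0 si); exact: VF.
have d_s u : V u -> gamma ^+ 2 * dot u u <= s u u.
  move=> Vu; have d0 := si_ge0 si Vu; have s0 := si_ge0 s_si Vu.
  move: d0; rewrite le_eqVlt => /predU1P[<-|d0]; first by rewrite mulr0.
  have := siCS si (VF _ Vu) Vu; rewrite aF// => h.
  rewrite -(ler_pM2r d0); apply: le_trans h.
  have -> : gamma ^+ 2 * dot u u * dot u u = (gamma * dot u u) ^+ 2 by ring.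
  have p0 : 0 <= gamma * dot u u by rewrite mulr_ge0// ltW.
  by rewrite ler_sqr ?ag// nnegrE//; exact: le_trans p0 (ag _ Vu).
have s_d u : V u -> s u u <= M * dot u u.
  move=> Vu; have s0 := si_ge0 s_si Vu.
  move: s0; rewrite le_eqVlt => /predU1P[s0|s0].
    rewrite -s0; have d0 := si_ge0 si Vu; move: d0; rewrite le_eqVlt => /predU1P[<-|d0].
      by rewrite mulr0.
    have := aM _ _ Vu Vu => h.
    by rewrite -(pmulr_lge0 _ d0); exact: le_trans (sqr_ge0 _) h.
  have := aM _ _ Vu (VF _ Vu).
  by rewrite -aF//; [rewrite expr2 -/(s u u) ler_pM2r|exact: VF].
have s_cplt : complete_on V s.
  move=> u_ K Vu_ uK.
  have g2 : 0 < gamma ^+ 2 by rewrite exprn_gt0.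
  have [|u [K' [Vu uK']]] := cplt u_ (K / gamma ^+ 2) Vu_.
    move=> i j ij; rewrite mulrAC ler_pdivlMr// mulrC.
    by apply: le_trans (uK _ _ ij); exact/d_s/(siB si).
  exists u, (Num.max M 0 * K'); split => // k.
  have Vd := siB si (Vu_ k) Vu.
  apply: le_trans (s_d _ Vd) _; rewrite -mulrA.
  apply: (@le_trans _ _ (Num.max M 0 * dot (u_ k - u) (u_ k - u))).
    by rewrite ler_wpM2r ?(si_ge0 si)// le_max lexx.
  by rewrite ler_wpM2l// le_max lexx orbT.
have lF : linear_on V (fun v => dot f (F v)).
  move=> c v w Vv Vw; have Vvw := siP si c Vv Vw.
  have VFv := VF _ Vv; have VFw := VF _ Vw; have VFvw := VF _ Vvw.
  by rewrite /= !(siC si Vf)// !aF// al.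
have [u [Vu uE]] := riesz_representation s_si s_cplt lF
  (fun v Vv => siCS si Vf (VF _ Vv)).
exists u; split => // v Vv.
have VFu := VF _ Vu; have Vw := siB si VFu Vf.
have wR z : V z -> dot (F z) (F u - f) = 0.
  move=> Vz; have VFz := VF _ Vz.
  by rewrite (siBr si)// (siC si VFz VFu) -/(s u z) uE// (siC si VFz Vf) subrr.
have w0 : dot (F u - f) (F u - f) = 0.
  have := ag _ Vw; rewrite -(aF _ _ Vw Vw) wR// pmulr_rle0// => h.
  by apply/eqP; rewrite eq_le h (si_ge0 si).
have := siCS si Vw Vv; rewrite w0 mul0r => h.
have /eqP : dot (F u - f) v ^+ 2 = 0 by apply/eqP; rewrite eq_le h sqr_ge0.
rewrite sqrf_eq0 (siBl si)// subr_eq0 => /eqP.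
by rewrite aF// fl.
Qed.

(** * The space L^2 of a set of finite measure *)

Section L2_space.
Context d (T : measurableType d) (R : realType).
Variables (mu : {measure set T -> \bar R}) (D : set T).
Hypothesis mD : measurable D.
Implicit Types f g u v w : T -> R.
Local Notation intg f := (mu.-integrable D (EFin \o f)).

Definition sq_integrable : set (T -> R^o) :=
  [set u | measurable_fun D (u : T -> R) /\ (\int[mu]_(x in D) (u x ^+ 2)%:E < +oo)%E].

Definition dot_on u v : R := \int[mu]_(x in D) (u x * v x).

Lemma dominated_integrable f g : measurable_fun D f -> intg g ->
  (forall x, D x -> `|f x| <= g x) -> intg f.
Proof.
move=> mf ig fg; apply: le_integrable ig => //; first exact/measurable_EFinP.
move=> x Dx; rewrite /= lee_fin (le_trans (fg x Dx))//; exact: ler_norm.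
Qed.

Lemma ae_eq_Rintegral f g : measurable_fun D f -> measurable_fun D g ->
  {ae mu, forall x, D x -> f x = g x} ->
  \int[mu]_(x in D) f x = \int[mu]_(x in D) g x.
Proof.
move=> mf mg fg; congr (fine _).
apply: ae_eq_integral => //; [exact/measurable_EFinP|exact/measurable_EFinP|].
by apply: filterS fg => x + Dx => /(_ Dx) ->.
Qed.

Lemma intgD f g : intg f -> intg g -> intg (fun x => f x + g x).
Proof. by move=> i1 i2; have := integrableD mD i1 i2; apply: eq_integrable. Qed.

Lemma intgZ (c : R) f : intg f -> intg (fun x => c * f x).
Proof. by move=> i1; have := integrableZl mD c i1; apply: eq_integrable. Qed.

Lemma intg_sum n (f : 'I_n -> T -> R) : (forall i, intg (f i)) ->
  intg (fun x => \sum_i f i x).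
Proof.
move=> fi; have := integrable_sum mD (index_enum 'I_n) (fun i _ => fi i) (P := xpredT).
by apply: eq_integrable => // x _; rewrite /= sumEFin.
Qed.

Lemma intg_measurable f : intg f -> measurable_fun D f.
Proof. by move=> /measurable_int/measurable_EFinP. Qed.

Lemma sq_integrable_sqr u : sq_integrable u -> intg (fun x => u x ^+ 2).
Proof.
move=> [mu_ iu]; apply/integrableP; split.
  by apply/measurable_EFinP; exact: measurable_funX.
apply: le_lt_trans iu; rewrite le_eqVlt; apply/orP; left; apply/eqP; apply: eq_integral => x _.
by rewrite /= ger0_norm// sqr_ge0.
Qed.

Lemma sq_integrableP u : measurable_fun D u -> intg (fun x => u x ^+ 2) ->
  sq_integrable u.
Proof.
move=> mu_ iu; split => //; exact: integrable_lty iu.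
Qed.

Lemma sq_integrableM u v : sq_integrable u -> sq_integrable v ->
  intg (fun x => u x * v x).
Proof.
move=> Lu Lv.
apply: (@dominated_integrable _ (fun x => u x ^+ 2 + v x ^+ 2)).
- by apply: measurable_funM; [case: Lu|case: Lv].
- by apply: intgD; exact: sq_integrable_sqr.
- move=> x _; rewrite ler_norml; have := sqr_ge0 (u x - v x); have := sqr_ge0 (u x + v x).
  have := sqr_ge0 (u x); have := sqr_ge0 (v x).
  by move=> *; apply/andP; split; lra.
Qed.

Lemma dot_on_si : semi_inner sq_integrable dot_on.
Proof.
split.
- split; first exact: measurable_cst.
  by under eq_integral do rewrite expr0n; rewrite integral0.
- move=> a u v Lu Lv; apply: sq_integrableP.
    by apply: measurable_funD; [case: Lu|apply: measurable_funM => //; case: Lv].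
  have := intgD (intgD (sq_integrable_sqr Lu) (intgZ (2 * a) (sq_integrableM Lu Lv)))
    (intgZ (a ^+ 2) (sq_integrable_sqr Lv)).
  apply: eq_integrable => // x _; congr EFin.
  by rewrite /= -[(u + _) x]/(u x + a * v x); ring.
- move=> a u v w Lu Lv Lw; rewrite /dot_on -RintegralZl//; last exact: sq_integrableM.
  rewrite -RintegralD//; [|exact: sq_integrableM|exact/intgZ/sq_integrableM].
  by apply: eq_Rintegral => x _; rewrite -[(u + _) x]/(u x + a * v x); ring.
- by move=> u v _ _; apply: eq_Rintegral => x _; rewrite mulrC.
- by move=> u _; apply: Rintegral_ge0 => x _; rewrite -expr2 sqr_ge0.
Qed.

Lemma dot_onE u : sq_integrable u ->
  (\int[mu]_(x in D) (u x ^+ 2)%:E)%E = (dot_on u u)%:E.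
Proof.
move=> Lu; rewrite /dot_on /Rintegral fineK//.
  by apply: integrable_fin_num => //; exact: sq_integrableM.
Qed.

Lemma ae_eq_dot_on u u' v : measurable_fun D u -> measurable_fun D u' ->
  measurable_fun D v -> {ae mu, forall x, D x -> u x = u' x} ->
  dot_on u v = dot_on u' v.
Proof.
move=> m1 m2 m3 uu'; apply: ae_eq_Rintegral; [exact: measurable_funM..|].
by apply: filterS uu' => x + Dx => /(_ Dx) ->.
Qed.

Hypothesis finD : (mu D < +oo)%E.

Lemma sq_integrable_bounded u M : measurable_fun D u ->
  (forall x, D x -> `|u x| <= M) -> sq_integrable u.
Proof.
move=> mu_ uM; apply: sq_integrableP => //.
apply: (@dominated_integrable _ (cst (M ^+ 2))); first exact: measurable_funX.
  apply: measurable_bounded_integrable => //.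
  exists `|M ^+ 2|; split; first exact: num_real.
  by move=> y /ltW My x Dx.
move=> x Dx; rewrite normrX ler_sqr ?nnegrE ?uM//.
exact: le_trans (uM _ Dx).
Qed.

Lemma sq_integrable1 : sq_integrable (cst 1).
Proof. by apply: (@sq_integrable_bounded _ 1) => // x _; rewrite normr1. Qed.

Lemma sq_integrable_intg u : sq_integrable u -> intg u.
Proof.
move=> Lu; have := sq_integrableM Lu sq_integrable1.
by apply: eq_integrable => // x _; rewrite /= mulr1.
Qed.

(** Cauchy-Schwarz against the constant function 1, on a set of finite measure. *)
Lemma dot_on_norm1 u C : sq_integrable u -> dot_on u u <= C ^+ 2 -> 0 <= C ->
  (\int[mu]_(x in D) `|u x|%:E <= (C * Num.sqrt (dot_on (cst 1) (cst 1)))%:E)%E.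
Proof.
move=> Lu uC C0; have L1 := sq_integrable1.
have La : sq_integrable (fun x => `|u x|).
  apply: sq_integrableP; first by apply: measurableT_comp => //; case: Lu.
  by apply: eq_integrable (sq_integrable_sqr Lu) => // x _; rewrite /= real_normK ?num_real.
have -> : (\int[mu]_(x in D) `|u x|%:E = (dot_on (fun x => `|u x|) (cst 1))%:E)%E.
  rewrite /dot_on /Rintegral fineK; last first.
    by apply: integrable_fin_num => //; exact: sq_integrableM.
  by apply: eq_integral => x _; rewrite mulr1.
rewrite lee_fin; apply: le_trans (ler_norm _) _.
apply: le_trans (siCSn dot_on_si La L1) _.
rewrite ler_wpM2r ?sqrtr_ge0// -[leRHS](ger0_norm C0) -sqrtr_sqr ler_wsqrtr//.
apply: le_trans uC; rewrite le_eqVlt; apply/orP; left; apply/eqP.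
by apply: eq_Rintegral => x _; rewrite -expr2 real_normK ?num_real// expr2.
Qed.

(** The increments of a fast Cauchy sequence are summable in L^1, hence almost
    everywhere; Fatou's lemma bounds the distance to the pointwise limit. *)
Lemma sq_integrable_complete : complete_on sq_integrable dot_on.
Proof.
move=> u_ C Lu uC; have L1 := sq_integrable1; have si := dot_on_si.
wlog C0 : C uC / 0 <= C.
  move=> /(_ (Num.max C 0)); apply; last by rewrite le_max lexx orbT.
  move=> i j ij; apply: le_trans (uC i j ij) _.
  by rewrite ler_wpM2r ?sqr_ge0// le_max lexx.
pose K := Num.sqrt C * Num.sqrt (dot_on (cst 1) (cst 1)).
have K0 : 0 <= K by rewrite mulr_ge0 ?sqrtr_ge0.
pose d_ k : T -> R := fun x => u_ k.+1 x - u_ k x.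
have Ld k : sq_integrable (d_ k) by exact: (siB si).
have md k : measurable_fun D (d_ k) by case: (Ld k).
have dK k : (\int[mu]_(x in D) `|d_ k x|%:E <= (K * 2^-1 ^+ k)%:E)%E.
  rewrite mulrAC; apply: (dot_on_norm1 (Ld k)).
    by rewrite exprMn sqr_sqrtr//; exact: (uC k k.+1).
  by rewrite mulr_ge0 ?sqrtr_ge0// exprn_ge0.
have mnd k : measurable_fun D (fun x => `|d_ k x|%:E).
  by apply/measurable_EFinP; exact: measurableT_comp.
have isum : mu.-integrable D (fun x => \sum_(k <oo) `|d_ k x|%:E)%E.
  apply/integrableP; split; first exact: ge0_emeasurable_sum.
  under eq_integral do rewrite gee0_abs ?nneseries_ge0//.
  rewrite integral_nneseries//.
  apply: (@le_lt_trans _ _ (2 * K)%:E); last exact: ltry.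
  apply: lime_le.
    by apply: is_cvg_nneseries => k _ _; apply: integral_ge0.
  apply: nearW => n.
  apply: (@le_trans _ _ (\sum_(0 <= k < n) (K * 2^-1 ^+ k)%:E)%E).
    by apply: lee_sum => k _; exact: dK.
  rewrite sumEFin lee_fin.
  suff -> : \sum_(0 <= k < n) K * 2^-1 ^+ k = 2 * K - 2 * K * 2^-1 ^+ n.
    by rewrite gerBl// !mulr_ge0// exprn_ge0.
  elim: n => [|n IH]; first by rewrite big_geq// expr0; ring.
  by rewrite big_nat_recr//= IH exprS; field.
have ucvg : {ae mu, forall x, D x -> cvgn (u_ ^~ x : nat -> R^o)}.
  apply: filterS (integrable_ae mD isum) => x + Dx => /(_ Dx) fx.
  have -> : u_ ^~ x = (fun n => u_ 0%N x + series (telescope (u_ ^~ x)) n).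
    by apply/funext => n; rewrite [LHS](eq_sum_telescope (u_ ^~ x)).
  apply: is_cvgD; first exact: is_cvg_cst.
  apply: normed_cvg; apply: nondecreasing_is_cvgn.
    by apply: nondecreasing_series => k _ _; exact: normr_ge0.
  exists (fine (\sum_(k <oo) `|d_ k x|%:E)%E) => _ [n _ <-].
  rewrite -lee_fin fineK// -sumEFin.
  by apply: (@nneseries_lim_ge _ (fun k => `|d_ k x|%:E) xpredT 0%N n) => k _ _; rewrite lee_fin.
pose u x := fine (limn_esup (fun k => (u_ k x)%:E)).
have mu_ : measurable_fun D u.
  apply: measurableT_comp => //; apply: measurable_fun_limn_esup => k.
  by apply/measurable_EFinP; case: (Lu k).
have ulim x : cvgn (u_ ^~ x : nat -> R^o) -> u_ k x @[k --> \oo] --> (u x : R^o).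
  move=> c; have /cvg_ex[l ul] := c.
  have h : (u_ k x)%:E @[k --> \oo] --> l%:E by apply: cvg_EFin => //; exact: nearW.
  by rewrite /u (cvg_limn_einf_sup h).2.
have fat i : (\int[mu]_(x in D) ((u_ i x - u x) ^+ 2)%:E <= (C * (2^-1 ^+ i) ^+ 2)%:E)%E.
  pose f n x := ((u_ (n + i)%N x - u_ i x) ^+ 2)%:E.
  have mf n : measurable_fun D (f n).
    by apply/measurable_EFinP; apply: measurable_funX; apply: measurable_funB; case: (Lu i); case: (Lu (n + i)%N).
  have f0 n x : D x -> (0 <= f n x)%E by rewrite lee_fin sqr_ge0.
  apply: (@le_trans _ _ (\int[mu]_(x in D) limn_einf (f^~ x))%E).
    apply: ae_ge0_le_integral => //.
    - by move=> x _; rewrite lee_fin sqr_ge0.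
    - apply/measurable_EFinP; apply: measurable_funX; apply: measurable_funB => //.
      by case: (Lu i).
    - move=> x Dx; rewrite limn_einf_lim; apply: lime_ge; first exact: is_cvg_einfs.
      by apply: nearW => n; apply: le_ereal_inf_tmp => _ [k _ <-]; exact: f0.
    - rewrite (_ : (fun x => _) = (fun x => - limn_esup (fun n => - f n x))%E).
        apply: measurableT_comp => //; apply: measurable_fun_limn_esup => n.
        exact: measurableT_comp.
      apply/funext => x; rewrite -limn_einfN; congr limn_einf.
      by apply/funext => n; rewrite -[LHS]oppeK.
    - apply: filterS ucvg => x + Dx => /(_ Dx)/ulim ux.
      have h : f n x @[n --> \oo] --> ((u_ i x - u x) ^+ 2)%:E.
        apply: cvg_EFin; first exact: nearW.
        rewrite -sqrrN opprB /=.
        have : (u_ (n + i)%N x - u_ i x) @[n --> \oo] --> (u x - u_ i x : R^o).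
          by apply: cvgB; [rewrite (cvg_shiftn i (u_ ^~ x))|exact: cvg_cst].
        by move=> h; apply: (cvgM h h).
      by rewrite (cvg_limn_einf_sup h).1.
  apply: le_trans (fatou mu mD mf f0) _.
  rewrite limn_einf_lim; apply: lime_le; first exact: is_cvg_einfs.
  apply: nearW => n; apply: le_trans (ereal_inf_lbound _) _; first by exists n => /=.
  rewrite /f (dot_onE (u := u_ (n + i)%N - u_ i)); last exact: (siB si).
  by rewrite lee_fin uC// leq_addl.
have Ldi i : sq_integrable (u_ i - u).
  split; first by apply: measurable_funB => //; case: (Lu i).
  exact: le_lt_trans (fat i) (ltry _).
have Lu' : sq_integrable u.
  have -> : u = u_ 0%N - (u_ 0%N - u) by apply/funext => x; rewrite /= !fctE; ring.
  exact: (siB si).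
exists u, C; split => // k.
by have := fat k; rewrite (dot_onE (u := u_ k - u))// lee_fin.
Qed.

End L2_space.

(** * Lebesgue measure on R^n *)

Section rational_boxes.
Context {R : realType}.

(** The boxes with rational centre and radius [1 / k.+1] are indexed by a countable
    type, so that they reduce open sets to countable unions. *)
Definition box_index n := ('rV[rat]_n * nat)%type.
Definition box_center n (i : box_index n) : 'rV[R]_n := map_mx ratr i.1.
Definition box_radius n (i : box_index n) : R := i.2.+1%:R^-1.
Definition rat_box n (i : box_index n) : set 'rV[R]_n :=
  [set x | forall j, `|x ord0 j - box_center i ord0 j| < box_radius i].
Definition closed_rat_box n (i : box_index n) : set 'rV[R]_n :=
  [set x | forall j, `|x ord0 j - box_center i ord0 j| <= box_radius i].

Lemma box_radius_gt0 n (i : box_index n) : 0 < box_radius i.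
Proof. by rewrite invr_gt0. Qed.

Lemma sub_rat_box n (i : box_index n) : rat_box i `<=` closed_rat_box i.
Proof. by move=> x xi j; exact/ltW. Qed.

Lemma open_rat_box n (O : set 'rV[R]_n) x : open O -> O x ->
  exists i : box_index n, rat_box i x /\ closed_rat_box i `<=` O.
Proof.
move=> oO Ox; have /nbhs_ballP[e /= e0 eO] := open_nbhs_nbhs (conj oO Ox).
have [k ke] : exists k : nat, k.+1%:R^-1 < e / 2.
  exists (Num.truncn (e / 2)^-1); rewrite invf_plt ?posrE ?divr_gt0//.
  exact: truncnS_gt.
have k0 : 0 < k.+1%:R^-1 :> R by rewrite invr_gt0.
have /choice[q qP] : forall j, exists q : rat, `|x ord0 j - ratr q| < k.+1%:R^-1.
  move=> j; have : x ord0 j - k.+1%:R^-1 < x ord0 j + k.+1%:R^-1 by rewrite ltrBlDr -addrA ltrDl addr_gt0.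
  move=> /rat_in_itvoo[q]; rewrite in_itv/= => /andP[q1 q2].
  by exists q; rewrite ltr_distlC; apply/andP.
exists (\row_j q j, k); split; first by move=> j; rewrite /box_center !mxE.
move=> y yi; apply: eO; split => // i j; rewrite (ord1 i).
have := yi j; rewrite /box_center !mxE /box_radius /= => h.
have := qP j; rewrite distrC => h2.
suff : `|y ord0 j - x ord0 j| < e by rewrite distrC.
have -> : y ord0 j - x ord0 j = (y ord0 j - ratr (q j)) + (ratr (q j) - x ord0 j) by ring.
apply: le_lt_trans (ler_normD _ _) _.
by rewrite (splitr e) ler_ltD//; [exact/(le_trans h)/ltW|exact: lt_trans ke].
Qed.

Lemma open_bigcup_box n (O : set 'rV[R]_n) : open O ->
  O = \bigcup_(i : box_index n) (if `[< closed_rat_box i `<=` O >] then rat_box i else set0).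
Proof.
move=> oO; apply/seteqP; split => x.
  by move=> /(open_rat_box oO)[i [ix iO]]; exists i => //; rewrite asboolT.
by move=> [i _]; case: asboolP => // iO xi; exact/iO/sub_rat_box.
Qed.

Lemma measurable_rat_box n (i : box_index n) : measurable (rat_box i).
Proof.
rewrite (_ : rat_box i = \bigcap_(j in [set: 'I_n])
    [set x : 'rV[R]_n | `|x ord0 j - box_center i ord0 j| < box_radius i]); last first.
  by apply/seteqP; split => x xi j; [move=> _; exact: (xi j)|exact: (xi j I)].
apply: fin_bigcap_measurable => [|j _]; first exact: finite_finset.
rewrite -[X in measurable X]setTI.
have : measurable_fun setT (fun x : 'rV[R]_n => `|x ord0 j - box_center i ord0 j|).
  apply: measurableT_comp => //; apply: measurable_funB => //; exact: measurable_coord.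
move=> /(_ measurableT `]-oo, box_radius i[%classic); apply.
exact: measurable_itv.
Qed.

Lemma open_measurable_rV n (O : set 'rV[R]_n) : open O -> measurable O.
Proof.
move=> /open_bigcup_box ->; apply: countable_bigcupT_measurable => [|i]; first exact: countableP.
by case: ifP => // _; exact: measurable_rat_box.
Qed.

Lemma closed_measurable_rV n (F : set 'rV[R]_n) : closed F -> measurable F.
Proof.
move=> cF; rewrite -[F]setCK; apply: measurableC.
by apply: open_measurable_rV; rewrite openC.
Qed.

Lemma continuous_measurable_rV n (f : 'rV[R]_n -> R) :
  continuous f -> measurable_fun setT f.
Proof.
move=> cf; apply: (@measurability _ _ _ (measurableTypeR R) setT f _ (RGenOpens.measurableE R)) => _ [_ [x [y ->]] <-].
rewrite setTI; apply: open_measurable_rV.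
by apply: open_comp => [z _|]; [exact: cf|exact: itv_open].
Qed.

End rational_boxes.

Section lebesgue_rV_theory.
Context {R : realType}.
Local Notation leb := (@lebesgue_rV R).

Lemma coord_le_norm n (x : 'rV[R]_n) j : `|x ord0 j| <= `|x|.
Proof.
rewrite [`|x|]mx_normrE.
exact: (le_bigmax _ (fun i : 'I_1 * 'I_n => `|x i.1 i.2|) (ord0, j)).
Qed.

Definition cube n (M : R) : set 'rV[R]_n := [set x | forall j, `|x ord0 j| <= M].

Lemma closed_cube n M : closed (@cube n M).
Proof.
rewrite (_ : cube M = \bigcap_(j in [set: 'I_n])
    [set x : 'rV[R]_n | `|x ord0 j| <= M]); last first.
  by apply/seteqP; split => x xi j; [move=> _; exact: (xi j)|exact: (xi j I)].
apply: closed_bigI => j _.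
apply: (@preimage_closed _ _ (fun x : 'rV[R]_n => `|x ord0 j|) [set y | y <= M]); last exact: closed_le.
move=> x _; apply: continuous_comp; last exact: norm_continuous.
exact: coord_continuous.
Qed.

Lemma rV_consE0 n (p : 'rV[R]_n * measurableTypeR R) : rV_cons p ord0 ord0 = p.2.
Proof.
have <- : row_mx (\row_(_ < 1) p.2) p.1 ord0 (lshift n (ord0 : 'I_1)) = p.2.
  by rewrite row_mxEl mxE.
by congr (fun_of_matrix _ _ _); apply/val_inj.
Qed.

Lemma rV_consES n (p : 'rV[R]_n * measurableTypeR R) j :
  rV_cons p ord0 (lift ord0 j) = p.1 ord0 j.
Proof.
have <- : row_mx (\row_(_ < 1) p.2) p.1 ord0 (rshift 1 j) = p.1 ord0 j.
  by rewrite row_mxEr.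
by congr (fun_of_matrix _ _ _); apply/val_inj.
Qed.

Lemma lebesgue_rVS n (A : set 'rV[R]_n.+1) :
  leb n.+1 A = (leb n \x lebesgue_measure)%E ((@rV_cons R n) @^-1` A).
Proof. by []. Qed.

Lemma lebesgue_cube_lty n M : (leb n (cube M) < +oo)%E.
Proof.
elim: n => [|n IH].
  rewrite /= /dirac /=; exact: ltry.
rewrite lebesgue_rVS.
have mc k : measurable (@cube k M) by apply: closed_measurable_rV; exact: closed_cube.
rewrite (_ : _ @^-1` _ = cube M `*` `[- M, M]%classic); last first.
  apply/seteqP; split => -[x y] /=.
    move=> xy; split => [j|].
      by have := xy (lift ord0 j); rewrite rV_consES.
    by have := xy ord0; rewrite rV_consE0 /= in_itv/= ler_norml.
  move=> [xM]; rewrite in_itv/= -ler_norml => yM j.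
  by case: (unliftP ord0 j) => [k ->|->]; rewrite ?rV_consES ?rV_consE0//; exact: xM.
have h : (lebesgue_measure (`[(- M)%R, M]%classic : set R) < +oo)%E.
  by rewrite lebesgue_measure_itv/=; case: ifP => // _; rewrite -EFinB ltry.
have e := product_measure1E (leb n) lebesgue_measure (mc n)
  (measurable_itv `[(- M)%R, M]).
apply: (@le_lt_trans _ _ (leb n (cube M) * lebesgue_measure `[(- M)%R, M]%classic)%E).
  by rewrite -e.
by apply: lte_mul_pinfty => //; rewrite ge0_fin_numE.
Qed.

Lemma bigcup_cube n : \bigcup_k cube k%:R = [set: 'rV[R]_n].
Proof.
apply/seteqP; split => // x _.
exists (Num.truncn `|x|).+1 => // j.
by apply: le_trans (coord_le_norm x j) _; exact/ltW/truncnS_gt.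
Qed.

Lemma lebesgue_rV_sigma_finite n : sigma_finite setT (leb n).
Proof.
exists (fun k => cube k%:R); first by rewrite bigcup_cube.
move=> k; split; last exact: lebesgue_cube_lty.
by apply: closed_measurable_rV; exact: closed_cube.
Qed.

(** A copy of Lebesgue measure carrying the proof that it is sigma-finite, as
    needed to apply the theorem of Fubini and Tonelli. *)
Definition lebesgue_sf n : set 'rV[R]_n -> \bar R := leb n.
HB.instance Definition _ n := Measure.copy (@lebesgue_sf n) (leb n).
HB.instance Definition _ n :=
  Measure_isSigmaFinite.Build _ _ _ (@lebesgue_sf n) (lebesgue_rV_sigma_finite n).

Lemma bounded_lebesgue_lty n (D : set 'rV[R]_n) :
  measurable D -> bounded_set D -> (leb n D < +oo)%E.
Proof.
move=> mD [M [_ /(_ (M + 1))]]; rewrite ltrDl ltr01 => /(_ isT) DM.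
apply: le_lt_trans (lebesgue_cube_lty n (M + 1)).
apply: le_measure; rewrite ?inE//.
  by apply: closed_measurable_rV; exact: closed_cube.
by move=> x /DM /= xM j; exact: le_trans (coord_le_norm x j) xM.
Qed.

Lemma lebesgue_translation (a : R) (f : R -> \bar R) :
  measurable_fun setT f -> (forall x, 0 <= f x)%E ->
  (\int[lebesgue_measure]_x f (x + a)%R = \int[lebesgue_measure]_x f x)%E.
Proof.
move=> mf f0.
have mta : measurable_fun setT ((fun x => x + a) : measurableTypeR R -> measurableTypeR R).
  exact: measurable_funD.
have := ge0_integral_pushforward mta lebesgue_measure measurableT mf (fun x _ => f0 x).
rewrite preimage_setT => <-.
apply: eq_measure_integral => A mA _; apply/esym/lebesgue_measure_unique => //.
move=> _ [[b c] _ <-] /=.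
rewrite /pushforward (_ : _ @^-1` _ = `](b - a)%R, (c - a)%R]%classic).
  by rewrite !lebesgue_measure_itv/= !lte_fin ltrD2r; case: ifP => // _; rewrite -!EFinB; congr EFin; ring.
by apply/seteqP; split => x /=; rewrite !in_itv/= ltrBlDr lerBrDr.
Qed.

Lemma rV_prodE n (f : 'rV[R]_n.+1 -> \bar R) :
  measurable_fun setT f -> (forall x, 0 <= f x)%E ->
  (\int[leb n.+1]_x f x = \int[leb n]_x \int[lebesgue_measure]_y f (rV_cons (x, y)))%E.
Proof.
move=> mf f0.
have := ge0_integral_pushforward (@measurable_rV_cons R n) (leb n \x lebesgue_measure)%E
  measurableT mf (fun x _ => f0 x).
rewrite preimage_setT => ->.
have mfc : measurable_fun setT (fun p => f (@rV_cons R n p)).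
  by apply: measurableT_comp => //; exact: measurable_rV_cons.
exact: (@fubini_tonelli1 _ _ _ _ R (@lebesgue_sf n) lebesgue_measure
  (fun p => f (rV_cons p)) mfc (fun _ => f0 _)).
Qed.

Lemma measurable_translation n (a : 'rV[R]_n) :
  measurable_fun setT (fun x : 'rV[R]_n => x + a).
Proof.
apply: measurable_fun_rV => i; under eq_fun do rewrite mxE.
by apply: measurable_funD => //; exact: measurable_coord.
Qed.

(** By induction on the dimension: Tonelli's theorem splits off one coordinate,
    along which the one-dimensional result applies. *)
Lemma lebesgue_rV_translation n (a : 'rV[R]_n) (f : 'rV[R]_n -> \bar R) :
  measurable_fun setT f -> (forall x, 0 <= f x)%E ->
  (\int[leb n]_x f (x + a)%R = \int[leb n]_x f x)%E.
Proof.
elim: n a f => [|n IH] a f mf f0.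
  by apply: eq_integral => x _; congr f; apply/rowP => -[].
have mfa : measurable_fun setT (fun x : 'rV[R]_n.+1 => f (x + a)).
  by apply: measurableT_comp => //; exact: measurable_translation.
rewrite (rV_prodE mf f0) (rV_prodE mfa (fun _ => f0 _)).
have consD (x : 'rV[R]_n) (y : R) : rV_cons (x, y) + a = rV_cons (x + \row_j a ord0 (lift ord0 j), y + a ord0 ord0).
  apply/rowP => j; rewrite mxE.
  case: (unliftP ord0 j) => [k ->|->]; rewrite ?rV_consES ?rV_consE0 //=.
  by rewrite !mxE.
under eq_integral do under eq_integral do rewrite consD.
have mc x : measurable_fun setT (fun y : measurableTypeR R => f (rV_cons (x, y))).
  exact: (measurableT_comp mf (measurableT_comp (@measurable_rV_cons R n)
    (pair1_measurable x))).
under eq_integral do rewrite (lebesgue_translation _ (mc _))//.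
have mfc : measurable_fun setT (fun p => f (@rV_cons R n p)).
  by apply: measurableT_comp => //; exact: measurable_rV_cons.
have mF : measurable_fun setT (fun x : 'rV[R]_n => \int[lebesgue_measure]_y f (rV_cons (x, y)))%E.
  exact: (@measurable_fun_fubini_tonelli_F _ _ _ _ R lebesgue_measure _ mfc (fun _ => f0 _)).
by rewrite (IH _ _ mF)// => x; apply: integral_ge0.
Qed.

End lebesgue_rV_theory.

(** * Test functions *)

Section flat_function.
Context {R : realType}.

(** The derivatives of [t |-> exp (- 1 / t)], extended by 0 to [t <= 0], are linear
    combinations of the functions [flat k]: differentiation never leaves this
    family, which makes smoothness a plain induction. *)
Definition flat k (t : R) : R := if 0 < t then t^-1 ^+ k * expR (- t^-1) else 0.

Lemma flat_ge0 k t : 0 <= flat k t.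
Proof.
by rewrite /flat; case: ifPn => // t0; rewrite mulr_ge0 ?expR_ge0// exprn_ge0// invr_ge0 ltW.
Qed.

(** The exponential series dominates each of its terms; the quadratic bound at the
    origin is what makes [flat k] differentiable there, with derivative 0. *)
Lemma flat_le_sqr k t : flat k t <= (k.+2)`!%:R * t ^+ 2.
Proof.
rewrite /flat; case: ifPn => [t0|_]; last by rewrite mulr_ge0// sqr_ge0.
have y0 : 0 < t^-1 by rewrite invr_gt0.
have := expR_ge1Dxn k.+1 (ltW y0); set f : R := _`!%:R => h.
have f0 : 0 < f by rewrite ltr0n fact_gt0.
have -> : t^-1 ^+ k = t ^+ 2 * t^-1 ^+ k.+2.
  rewrite (exprS _ k.+1) (exprS _ k); move: (t^-1 ^+ k) => z.
  by field; rewrite gt_eqF.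
rewrite -mulrA mulrC ler_wpM2r ?sqr_ge0//.
rewrite expRN ler_pdivrMr ?expR_gt0// -ler_pdivrMl//.
by apply: le_trans h; rewrite mulrC lerDr.
Qed.

Lemma is_derive_flat k (t : R) : is_derive t (1 : R) (flat k) (flat k.+2 t - k%:R * flat k.+1 t).
Proof.
have [t0|t0|->] := ltgtP t 0.
- rewrite /flat [0 < t]lt_gtF// mulr0 subr0.
  have h : is_derive t (1 : R) (cst (0 : R)) (0 : R) by exact: is_derive_cst.
  apply: near_eq_is_derive h.
  near=> y; rewrite lt_gtF//; near: y.
  by apply: open_nbhs_nbhs; split; [exact: open_lt|].
- rewrite /flat t0.
  have tn0 : t != 0 by rewrite gt_eqF.
  have d1 : is_derive t 1 (fun y : R => y^-1) (- t ^- 2).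
    have := @is_deriveV R id t 1 1 tn0 (is_derive_id _ _).
    by move=> /is_derive_eq; apply; rewrite /= scaler1.
  have d2 : is_derive t 1 (fun y : R => expR (- y^-1)) (t ^- 2 * expR (- t^-1)).
    have := @is_derive1_comp R expR (fun y => - y^-1) t _ _ (is_derive_expR _) (is_deriveN d1).
    by move=> /is_derive_eq; apply; rewrite opprK mulrC.
  have h : is_derive t (1 : R) (fun y : R => y^-1 ^+ k * expR (- y^-1))
     (t^-1 ^+ k.+2 * expR (- t^-1) - k%:R * (t^-1 ^+ k.+1 * expR (- t^-1))).
    have -> : (fun y : R => y^-1 ^+ k * expR (- y^-1)) =
        (fun y : R => y^-1) ^+ k * (fun y : R => expR (- y^-1)).
      by apply/funext => y; rewrite !fctE.
    apply: (is_derive_eq (is_deriveM (is_deriveX k d1) d2)).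
    rewrite ?exprfctE.
    rewrite /GRing.scale /= -exprVn.
    move: (t^-1) (expR _) => x y.
    by case: k => [|k]; rewrite ?succnK !exprS ?expr0; ring.
  apply: near_eq_is_derive h.
  near=> y; rewrite ifT//; near: y.
  by apply: open_nbhs_nbhs; split; [exact: open_gt|].
- rewrite /flat ltxx mulr0 subr0 -/(flat k).
  have c : h^-1 *: ((flat k \o shift (0 : R)) (h *: (1 : R)) - flat k 0) @[h --> (0 : R)^'] --> (0 : R).
    have f0 : flat k 0 = 0 by rewrite /flat ltxx.
    have n0 : (k.+2)`!%:R * `|h| @[h --> (0 : R)^'] --> (0 : R).
      have id0 : h @[h --> (0 : R)^'] --> (0 : R) by exact: cvg_within.
      have := cvgMl_tmp (a := (k.+2)`!%:R) (cvg_norm id0).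
      by rewrite normr0 mulr0; apply.
    have n1 : - ((k.+2)`!%:R * `|h|) @[h --> (0 : R)^'] --> (0 : R).
      by have := cvgN n0; rewrite oppr0; apply.
    apply: (squeeze_cvgr _ n1 n0).
    near=> h; rewrite f0 subr0 /= addr0 -ler_norml normrM normfV.
      have h0 : h != 0 by near: h; exact: nbhs_dnbhs_neq.
      rewrite ler_pdivrMl ?normr_gt0// (ger0_norm (flat_ge0 _ _)).
      apply: le_trans (flat_le_sqr _ _) _.
      rewrite [leRHS]mulrCA -[`|h| * _]expr2 real_normK ?num_real//.
      by rewrite /GRing.scale/= mulr1.
  by apply: DeriveDef; [exact: cvgP c|apply/cvg_lim].
Unshelve. all: by end_near.
Qed.

Lemma continuous_flat k : continuous (flat k).
Proof.
move=> t; apply/differentiable_continuous/derivable1_diffP.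
by have [] := is_derive_flat k t.
Qed.

Lemma flat0_le1 t : flat 0 t <= 1.
Proof.
rewrite /flat expr0 mul1r; case: ifPn => // t0.
by rewrite -expR0 ler_expR oppr_le0 invr_ge0 ltW.
Qed.

Lemma flat0_gt0 t : (0 < flat 0 t) = (0 < t).
Proof.
rewrite /flat expr0 mul1r; case: ifPn => t0; first by rewrite expR_gt0.
by rewrite ltxx.
Qed.

End flat_function.

Section bump_functions.
Context {R : realType} {n : nat}.
Local Notation fct := ('rV[R]_n.+1 -> R).

(** Being closed under partial derivatives ([flat_algebra_derive]) and made of
    continuous functions, this algebra consists of smooth functions. *)
Inductive flat_algebra : fct -> Prop :=
| fa_cst c : flat_algebra (fun=> c)
| fa_flat k i s a : flat_algebra (fun x => flat k (s * x ord0 i + a))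
| fa_add f g : flat_algebra f -> flat_algebra g -> flat_algebra (fun x => f x + g x)
| fa_mul f g : flat_algebra f -> flat_algebra g -> flat_algebra (fun x => f x * g x).

Lemma flat_algebra_continuous f : flat_algebra f -> continuous f.
Proof.
elim=> [c|k i s a|{}f g _ cf _ cg|{}f g _ cf _ cg] x.
- exact: cst_continuous.
- apply: (@continuous_comp _ _ _ (fun x : 'rV[R]_n.+1 => s * x ord0 i + a) (flat k)).
    have c : {for x, continuous (fun y : 'rV[R]_n.+1 => y ord0 i)}.
      exact: coord_continuous.
    exact: (cvgD (cvgM (cvg_cst s) c) (cvg_cst a)).
  exact: continuous_flat.
- exact: (cvgD (cf x) (cg x)).
- exact: (cvgM (cf x) (cg x)).
Qed.

Lemma is_derive_affine (phi : R -> R) (i : 'I_n.+1) (s a d : R) (x v : 'rV[R]_n.+1) :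
  is_derive (s * x ord0 i + a) (1 : R) phi d ->
  is_derive x v (fun x : 'rV[R]_n.+1 => phi (s * x ord0 i + a)) (s * v ord0 i * d).
Proof.
move=> [dphi phid].
have /derivable1_diffP df := dphi.
have e : (fun h : R => h^-1 *: (((fun x : 'rV[R]_n.+1 => phi (s * x ord0 i + a)) \o shift x) (h *: v) - phi (s * x ord0 i + a)))
  = (fun h : R => h^-1 *: ((phi \o shift (s * x ord0 i + a)) (h *: (s * v ord0 i)) - phi (s * x ord0 i + a))).
  apply/funext => h; congr (_ *: (phi _ - _)); rewrite /= !mxE /GRing.scale/=; ring.
apply: DeriveDef.
  by rewrite /derivable e; exact: (@diff_derivable _ _ _ _ _ (s * v ord0 i) df).
rewrite /derive e -/(derive _ _ _) deriveE//.
have -> : s * v ord0 i = (s * v ord0 i) *: (1 : R) by rewrite /GRing.scale/= mulr1.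
by rewrite linearZ/= -deriveE// phid /GRing.scale/= mulr1.
Qed.

Lemma flat_algebra_derive f (j : 'I_n.+1) : flat_algebra f ->
  exists g, flat_algebra g /\ forall x, is_derive x (delta_mx ord0 j) f (g x).
Proof.
elim=> [c|k i s a|{}f g ff [f' [ff' df]] fg [g' [fg' dg]]|{}f g ff [f' [ff' df]] fg [g' [fg' dg]]].
- by exists (fun=> 0); split=> [|x]; [exact: fa_cst|exact: is_derive_cst].
- exists (fun x => s * (delta_mx ord0 j : 'rV[R]_n.+1) ord0 i *
      (flat k.+2 (s * x ord0 i + a) + (- k%:R) * flat k.+1 (s * x ord0 i + a))).
  split=> [|x]; last first.
    by rewrite mulNr; apply: is_derive_affine; exact: is_derive_flat.
  apply: fa_mul; first exact: fa_cst.
  by apply: fa_add; [exact: fa_flat|apply: fa_mul; [exact: fa_cst|exact: fa_flat]].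
- exists (fun x => f' x + g' x); split=> [|x]; first exact: fa_add.
  exact: is_deriveD.
- exists (fun x => f x * g' x + g x * f' x); split=> [|x].
    by apply: fa_add; exact: fa_mul.
  exact: is_deriveM.
Qed.

Lemma flat_algebra_pderiv f j : flat_algebra f -> flat_algebra (pderiv j f).
Proof.
move=> /(flat_algebra_derive j)[g [fg dg]].
by have -> : pderiv j f = g by apply/funext => x; have [] := dg x.
Qed.

Lemma flat_algebra_smooth f : flat_algebra f -> smooth f.
Proof.
move=> ff s /=.
have {ff} fs : flat_algebra (foldr pderiv f s).
  by elim: s => //= j s; exact: flat_algebra_pderiv.
split; first exact: flat_algebra_continuous.
by move=> i x; have [g [_ /(_ x)[]]] := flat_algebra_derive i fs.
Qed.

Lemma flat_algebra_prod (I : Type) (r : seq I) (F : I -> fct) :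
  (forall i, flat_algebra (F i)) -> flat_algebra (fun x => \prod_(i <- r) F i x).
Proof.
move=> FI; elim: r => [|i r IH].
  by under eq_fun do rewrite big_nil; exact: fa_cst.
by under eq_fun do rewrite big_cons; exact: fa_mul.
Qed.

Lemma flat_algebraX f m : flat_algebra f -> flat_algebra (fun x => f x ^+ m).
Proof.
move=> ff; elim: m => [|m IH].
  by under eq_fun do rewrite expr0; exact: fa_cst.
by under eq_fun do rewrite exprS; exact: fa_mul.
Qed.

(** The factor at [j] is positive exactly when the coordinate [x ord0 j] lies
    within [box_radius i] of that of the centre. *)
Definition bump (i : box_index n.+1) : fct := fun x => \prod_(j < n.+1)
  (flat 0 (1 * x ord0 j + (box_radius i - box_center i ord0 j)) *
   flat 0 (-1 * x ord0 j + (box_radius i + box_center i ord0 j))).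

Lemma flat_algebra_bump i : flat_algebra (bump i).
Proof. by apply: flat_algebra_prod => j; apply: fa_mul; exact: fa_flat. Qed.

Lemma bump_ge0_le1 i x : 0 <= bump i x <= 1.
Proof.
apply/andP; split.
  by apply: prodr_ge0 => j _; rewrite mulr_ge0// flat_ge0.
by apply: Num.Theory.prodr_ile1 => j _; rewrite mulr_ge0 ?flat_ge0//= mulr_ile1 ?flat_ge0// flat0_le1.
Qed.

Lemma bump_neq0 i x : (bump i x != 0) <-> rat_box i x.
Proof.
split=> [|xi].
  move=> /prodf_neq0 H j; have := H j isT; rewrite mulf_eq0 negb_or.
  have p t : flat 0 t != 0 -> 0 < t by rewrite -flat0_gt0 lt_neqAle eq_sym flat_ge0 andbT.
  by move=> /andP[/p h1 /p h2]; rewrite ltr_norml; apply/andP; split; lra.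
apply/prodf_neq0 => j _; have := xi j; rewrite ltr_norml => /andP[h1 h2].
by rewrite mulf_neq0// gt_eqF// flat0_gt0; lra.
Qed.

Lemma compact_closed_rat_box (i : box_index n.+1) : compact (@closed_rat_box R n.+1 i).
Proof.
rewrite (_ : closed_rat_box i = [set v | forall j,
  `[box_center i ord0 j - box_radius i, box_center i ord0 j + box_radius i]%classic (v ord0 j)]).
  apply: (@rV_compact R n.+1 (fun j => `[box_center i ord0 j - box_radius i,
    box_center i ord0 j + box_radius i]%classic)) => j; exact: segment_compact.
by apply/seteqP; split => x xi j; have := xi j; rewrite /= in_itv/= ler_distl.
Qed.

(** A countable family of bumps that is positive exactly on [O], combined into
    [1 - (prod (1 - bump))^m], approximates the indicator of [O]. *)
Lemma indic_open_test_fun (D O : set 'rV[R]_n.+1) : open O -> O `<=` D ->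
  exists psi : nat -> fct, [/\ forall m, test_fun D (psi m),
    forall m x, 0 <= psi m x <= 1 &
    forall x, psi m x @[m --> \oo] --> (\1_O x : R)].
Proof.
move=> oO OD.
(* The bumps supported in [O], enumerated with 0 in place of the other ones. *)
pose phi (m : nat) : fct := if @unpickle (box_index n.+1) m is Some i then
  (if `[< closed_rat_box (R := R) i `<=` O >] then bump i else fun=> 0) else fun=> 0.
have fphi m : flat_algebra (phi m).
  rewrite /phi; case: unpickle => [i|]; last exact: fa_cst.
  by case: ifP => _; [exact: flat_algebra_bump|exact: fa_cst].
have phi01 m x : 0 <= 1 - phi m x <= 1.
  have c0 : 0 <= 1 - (0 : R) <= 1 by apply/andP; split; lra.
  rewrite /phi; case: unpickle => [i|]//; case: ifP => _//.
  by have /andP[? ?] := bump_ge0_le1 i x; apply/andP; split; lra.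
have phiO m x : phi m x != 0 -> exists i : box_index n.+1,
    [/\ unpickle m = Some i, closed_rat_box (R := R) i `<=` O & rat_box i x].
  rewrite /phi; case E : (unpickle m) => [i|]; last by rewrite eqxx.
  by case: asboolP => [iO /bump_neq0 xi|]; [exists i|rewrite eqxx].
pose P m x := \prod_(k < m) (1 - phi k x).
pose psi m : fct := fun x => 1 - P m x ^+ m.
have fpsi m : flat_algebra (psi m).
  have -> : psi m = (fun x => 1 + (-1) * P m x ^+ m) by apply/funext => x; rewrite mulN1r.
  apply: fa_add; first exact: fa_cst.
  apply: fa_mul; first exact: fa_cst.
  apply: flat_algebraX; apply: flat_algebra_prod => k.
  have -> : (fun x => 1 - phi k x) = (fun x => 1 + (-1) * phi k x) by apply/funext => x; rewrite mulN1r.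
  by apply: fa_add; [exact: fa_cst|apply: fa_mul; [exact: fa_cst|exact: fphi]].
have P01 m x : 0 <= P m x <= 1.
  apply/andP; split; first by apply: prodr_ge0 => k _; case/andP: (phi01 k x).
  by apply: Num.Theory.prodr_ile1 => k _; exact: phi01.
exists psi; split.
- move=> m.
    pose K := \big[setU/set0]_(k < m | `[< exists i, unpickle k = Some i /\ closed_rat_box (R := R) i `<=` O >])
      oapp (@closed_rat_box R n.+1) set0 (@unpickle (box_index n.+1) k).
    have K_cpt : compact K.
      apply: bigsetU_compact => k _.
      by case: unpickle => [i|]/=; [exact: compact_closed_rat_box|exact: compact0].
    have sK : closure [set x | psi m x != 0] `<=` K.
      have /closure_id -> := compact_closed (@norm_hausdorff _ _) K_cpt.
      apply: closure_subset => x /=; apply: contraNP => Kx.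
      rewrite /psi /P big1 ?expr1n ?subrr// => k _.
      suff -> : phi k x = 0 by rewrite subr0.
      apply/eqP; apply: contraT => /phiO[i [ki iO xi]].
      exfalso; apply: Kx; rewrite /K (bigD1 k)/=; last by apply/asboolP; exists i.
      by left; rewrite ki /=; exact: sub_rat_box.
    have KO : K `<=` O.
      rewrite /K; elim/big_ind : _ => //; first by move=> A B AO BO x [/AO|/BO].
      by move=> k /asboolP[i [-> iO]].
    split; [exact: flat_algebra_smooth| |exact: (subset_trans sK (subset_trans KO OD))].
    exact: subclosed_compact (@closed_closure _ _) K_cpt sK.
- move=> m x; have /andP[p0 p1] := P01 m x.
  have q1 : P m x ^+ m <= 1 by apply: exprn_ile1.
  have q0 : 0 <= P m x ^+ m by apply: exprn_ge0.
  by rewrite /psi; apply/andP; split; lra.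
- move=> x; have [Ox|nOx] := pselect (O x); last first.
    rewrite indicE memNset//; apply: cvg_near_cst; apply: nearW => m.
    rewrite /psi /P big1 ?expr1n ?subrr// => k _.
    suff -> : phi k x = 0 by rewrite subr0.
    apply/eqP; apply: contraT => /phiO[i [_ iO xi]].
    by exfalso; apply/nOx/iO/sub_rat_box.
  rewrite indicE mem_set//.
  have [i [xi iO]] := open_rat_box oO Ox.
  pose k0 := pickle i.
  have pk : 0 < phi k0 x.
    rewrite /phi /k0 pickleK asboolT// lt_neqAle eq_sym.
    by have /andP[-> _] := bump_ge0_le1 i x; rewrite andbT; apply/bump_neq0.
  have /andP[r0 r1] := phi01 k0 x.
  have c : (1 - phi k0 x) ^+ m @[m --> \oo] --> (0 : R).
    by apply: cvg_expr; rewrite ger0_norm//; lra.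
  have cP : P m x ^+ m @[m --> \oo] --> (0 : R).
    have c0 : (fun _ : nat => 0 : R) @ \oo --> (0 : R) by exact: cvg_cst.
    apply: (squeeze_cvgr _ c0 c).
    near=> m; have /andP[p0 _] := P01 m x.
    rewrite exprn_ge0//= lerXn2r ?nnegrE//.
    have k0m : (k0 < m)%N by near: m; exact: nbhs_infty_gt.
    rewrite /P (bigD1 (Ordinal k0m))//= ler_piMr//.
    by apply: Num.Theory.prodr_ile1 => k _; exact: phi01.
  have := cvgB (cvg_cst (1 : R)) cP; rewrite subr0; apply.
Unshelve. all: by end_near.
Qed.

End bump_functions.

(** * Integration by parts *)

Lemma Rdominated_cvg d (T : measurableType d) (R : realType)
    (mu : {measure set T -> \bar R}) (D : set T) (f_ : nat -> T -> R) (f g : T -> R) :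
  measurable D -> (forall n, measurable_fun D (f_ n)) ->
  (forall x, D x -> f_ n x @[n --> \oo] --> f x) ->
  mu.-integrable D (EFin \o g) -> (forall n x, D x -> `|f_ n x| <= g x) ->
  \int[mu]_(x in D) f_ n x @[n --> \oo] --> \int[mu]_(x in D) f x.
Proof.
move=> mD mf cf ig fg.
have mf' : measurable_fun D f := measurable_fun_cvg mf cf.
have if_ n : mu.-integrable D (EFin \o f_ n) := dominated_integrable mD (mf n) ig (fg n).
have fg' x : D x -> `|f x| <= g x.
  move=> Dx; have c : `|f_ n x| @[n --> \oo] --> `|f x| by apply: cvg_norm; exact: cf.
  rewrite -(cvg_lim (@Rhausdorff R) c); apply: limr_le; first by apply/cvg_ex; exists `|f x|.
  by apply: nearW => n; exact: fg.
have if' : mu.-integrable D (EFin \o f) := dominated_integrable mD mf' ig fg'.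
apply: fine_cvg.
rewrite fineK; last exact: integrable_fin_num.
apply: (@dominated_cvg _ _ _ mu D mD (fun n => EFin \o f_ n) (EFin \o f) (EFin \o g)) => //.
- by move=> n; exact/measurable_EFinP.
- by move=> x Dx; apply: cvg_EFin; [exact: nearW|exact: cf].
Qed.

Section integral_pderiv.
Context {R : realType} {n : nat}.
Local Notation fct := ('rV[R]_n.+1 -> R).
Local Notation leb := (@lebesgue_rV R n.+1).

Lemma Rintegral_supp (D : set 'rV[R]_n.+1) (f : fct) :
  (forall x, ~ D x -> f x = 0) -> \int[leb]_(x in D) f x = \int[leb]_x f x.
Proof.
move=> f0; rewrite Rintegral_mkcond; apply: eq_Rintegral => x _.
by rewrite patchE; case: ifPn => //; rewrite notin_setE => /f0 ->.
Qed.

Lemma Rintegral_translation (a : 'rV[R]_n.+1) (f : fct) : measurable_fun setT f ->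
  \int[leb]_x f (x + a) = \int[leb]_x f x.
Proof.
move=> mf; rewrite /Rintegral; congr (fine _).
rewrite integralE [RHS]integralE.
have mEf : measurable_fun setT (EFin \o f) by exact/measurable_EFinP.
congr (_ - _)%E.
  rewrite -(lebesgue_rV_translation a (measurable_funepos mEf) (funepos_ge0 _)).
  by apply: eq_integral => x _; rewrite ?funeposE ?funenegE.
rewrite -(lebesgue_rV_translation a (measurable_funeneg mEf) (funeneg_ge0 _)).
  by apply: eq_integral => x _; rewrite ?funeposE ?funenegE.
Qed.

Lemma continuous_supp_bounded (S : set 'rV[R]_n.+1) (f : fct) :
  continuous f -> compact S -> (forall x, ~ S x -> f x = 0) ->
  exists B, 0 <= B /\ forall x, `|f x| <= B.
Proof.
move=> cf cS f0.
have /compact_bounded [M [_ HM]] : compact (f @` S).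
  by apply: continuous_compact => //; exact: continuous_subspaceT.
exists (`|M| + 1); split; first by rewrite addr_ge0.
move=> x; have [Sx|/f0 ->] := pselect (S x); last by rewrite normr0 addr_ge0.
by apply: (HM (`|M| + 1)); [rewrite ltr_pwDr// ler_norm|exists x].
Qed.

Lemma compact_cube (S : set 'rV[R]_n.+1) : compact S -> exists M, 0 <= M /\ S `<=` cube M.
Proof.
move=> /compact_bounded [M [_ HM]]; exists (`|M| + 1); split; first by rewrite addr_ge0.
move=> x Sx j; apply: le_trans (coord_le_norm x j) _.
by apply: (HM (`|M| + 1)) => //; rewrite ltr_pwDr// ler_norm.
Qed.

Lemma pderiv_supp (f : fct) i x : ~ closure [set x | f x != 0] x -> pderiv i f x = 0.
Proof.
move=> nx; rewrite /pderiv.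
have -> : 'D_(delta_mx ord0 i) f x = 'D_(delta_mx ord0 i) (cst 0 : 'rV[R]_n.+1 -> R) x.
  apply: near_eq_derive.
  have : nbhs x (~` closure [set x | f x != 0]).
    by apply: open_nbhs_nbhs; split=> //; exact/closed_openC/closed_closure.
  apply: filterS => y ny /=; apply/eqP; apply: contrapT => fy.
  by apply: ny; apply: subset_closure; exact/negP.
exact: derive_cst.
Qed.

Lemma is_derive_line (f : fct) (v x : 'rV[R]_n.+1) (t : R) :
  derivable f (x + t *: v) v ->
  is_derive t (1 : R) (fun s : R => f (x + s *: v)) ('D_v f (x + t *: v)).
Proof.
move=> df.
have e : (fun h : R => h^-1 *: (((fun s : R => f (x + s *: v)) \o shift t) (h *: (1 : R)) - f (x + t *: v)))
  = (fun h : R => h^-1 *: ((f \o shift (x + t *: v)) (h *: v) - f (x + t *: v))).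
  apply/funext => h; congr (_ *: (f _ - _)); rewrite /= [h *: 1]mulr1.
  by rewrite scalerDl addrCA.
by apply: DeriveDef; [rewrite /derivable e|rewrite /derive e].
Qed.

(** Translation invariance makes the integral of every difference quotient
    vanish; the difference quotients are bounded by the mean value theorem. *)
Lemma integral_pderiv_eq0 (D : set 'rV[R]_n.+1) (F : fct) i :
  continuous F -> compact (closure [set x | F x != 0]) ->
  closure [set x | F x != 0] `<=` D ->
  (forall x, derivable F x (delta_mx ord0 i)) -> continuous (pderiv i F) ->
  \int[leb]_(x in D) pderiv i F x = 0.
Proof.
move=> cF; set S := closure _ => cS SD dF cG.
pose e : 'rV[R]_n.+1 := delta_mx ord0 i.
have F0 x : ~ S x -> F x = 0.
  by move=> nS; apply/eqP; apply: contrapT => fy; apply/nS/subset_closure/negP.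
have G0 x : ~ S x -> pderiv i F x = 0 by exact: pderiv_supp.
have [B [B0 GB]] := continuous_supp_bounded cG cS G0.
have [M [M0 SM]] := compact_cube cS.
have [A [A0 FA]] := continuous_supp_bounded cF cS F0.
(* The translates of the support by at most 1 along [e] stay in this cube. *)
pose C : set 'rV[R]_n.+1 := cube (M + 1).
have mC : measurable C by apply: closed_measurable_rV; exact: closed_cube.
have finC : (leb C < +oo)%E by exact: lebesgue_cube_lty.
pose h k : R := k.+1%:R^-1.
have h0 k : 0 < h k by rewrite invr_gt0.
have h1 k : h k <= 1 by rewrite invf_le1// ler1n.
pose q k x := (h k)^-1 * (F (x + h k *: e) - F x).
have ie j : `|e ord0 j| <= 1.
  by rewrite /e mxE; case: (_ && _); rewrite ?normr1 ?normr0.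
have S_C x k : S (x + h k *: e) \/ S x -> C x.
  move=> + j; case=> [/SM /(_ j)|/SM /(_ j)]; last by lra.
  rewrite !mxE => H.
  have -> : x ord0 j = x ord0 j + h k * e ord0 j - h k * e ord0 j by ring.
  apply: le_trans (ler_normB _ _) _; apply: lerD; first by rewrite /e mxE.
  by rewrite normrM (gtr0_norm (h0 k)) mulr_ile1// ltW.
have FkC x k : ~ C x -> F (x + h k *: e) = 0.
  by move=> nC; apply: F0 => Sx; apply: nC; apply: (S_C x k); left.
have FC x : ~ C x -> F x = 0.
  by move=> nC; apply: F0 => Sx; apply: nC; apply: (S_C x 0%N); right.
have mF : measurable_fun setT F by exact: continuous_measurable_rV.
have mFC : measurable_fun C F by exact: measurable_funS mF.
have mFk k : measurable_fun C (fun x => F (x + h k *: e)).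
  apply: (@measurable_funS _ _ _ _ setT) => //.
  by apply: measurableT_comp => //; exact: measurable_translation.
have bint (f : fct) b : measurable_fun C f -> (forall x, `|f x| <= b) ->
    leb.-integrable C (EFin \o f).
  move=> mf fb; apply: sq_integrable_intg => //.
  by apply: (@sq_integrable_bounded _ _ _ _ _ mC finC _ b) => // x _.
have Iq k : \int[leb]_(x in C) q k x = 0.
  have i1 : leb.-integrable C (EFin \o (fun x => F (x + h k *: e))) by exact: bint.
  have i2 : leb.-integrable C (EFin \o F) by exact: bint.
  rewrite RintegralZl//; last first.
    by have := integrableB mC i1 i2; apply: eq_integrable.
  rewrite RintegralB// (Rintegral_supp FC) (Rintegral_supp (f := fun x => F (x + h k *: e))).
    by rewrite Rintegral_translation// subrr mulr0.
  by move=> x /FkC.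
have -> : \int[leb]_(x in D) pderiv i F x = \int[leb]_(x in C) pderiv i F x.
  rewrite [RHS]Rintegral_supp ?Rintegral_supp//.
    by move=> x nD; apply: G0 => Sx; exact/nD/SD.
  by move=> x nC; apply: G0 => Sx; apply: nC; apply: (S_C x 0%N); right.
have qG : \int[leb]_(x in C) q k x @[k --> \oo] --> \int[leb]_(x in C) pderiv i F x.
  apply: (@Rdominated_cvg _ _ _ leb C q (pderiv i F) (cst B)) => //.
  - by move=> k; apply: measurable_funM => //; exact: measurable_funB.
  - move=> x _.
    have := dF x; rewrite /derivable => dc.
    have hk0 : h k @[k --> \oo] --> (0 : R)^'.
      move=> U HU; have : \forall k \near \oo, (h k != 0 -> U (h k)) := @cvg_harmonic R _ HU.
      by apply: filterS => k H; apply: H; rewrite gt_eqF.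
    have c : h^-1 *: ((F \o shift x) (h *: e) - F x) @[h --> (0 : R)^'] --> pderiv i F x by exact: dc.
    have c2 := cvg_comp _ _ hk0 c.
    have -> : (fun k => q k x) = (fun h : R => h^-1 *: ((F \o shift x) (h *: e) - F x)) \o h.
      by apply/funext => k; rewrite /q /= [h k *: e + x]addrC.
    exact: c2.
  - by apply: (bint _ `|B|) => // x.
  - move=> k x _.
    have dline t : is_derive t (1 : R) (fun t => F (x + t *: e)) (pderiv i F (x + t *: e)).
      exact: is_derive_line.
    have [|c _] := @MVT R (fun t => F (x + t *: e)) (fun t => pderiv i F (x + t *: e)) 0 (h k) (h0 k)
      (fun t _ => dline t).
      apply: continuous_subspaceT => t.
      by apply/differentiable_continuous/derivable1_diffP; have [] := dline t.
    rewrite scale0r addr0 subr0 /q => ->.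
    by rewrite mulrC mulfK ?gt_eqF.
have : (fun k => \int[leb]_(x in C) q k x) = cst 0 by apply/funext => k; exact: Iq.
move=> Iq0; move: qG; rewrite Iq0 => qG.
by rewrite -(cvg_lim (@Rhausdorff R) qG); apply: lim_cst.
Qed.

End integral_pderiv.

Section weak_derivative.
Context {R : realType} {n : nat}.
Local Notation fct := ('rV[R]_n.+1 -> R).
Local Notation leb := (@lebesgue_rV R n.+1).
Variable D : set 'rV[R]_n.+1.
Hypothesis oD : open D.
Hypothesis bD : bounded_set D.
Implicit Types (u v w f : fct) (i : 'I_n.+1).
Local Notation intg f := (leb.-integrable D (EFin \o f)).

Lemma measurable_domain : measurable D.
Proof. exact: open_measurable_rV. Qed.
Let mD := measurable_domain.

Lemma finite_domain : (leb D < +oo)%E.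
Proof. exact: bounded_lebesgue_lty. Qed.
Let finD := finite_domain.

Lemma domain_cube : exists M, 0 <= M /\ D `<=` cube M.
Proof.
have [M [_ HM]] := bD; exists (`|M| + 1); split; first by rewrite addr_ge0.
move=> x Sx j; apply: le_trans (coord_le_norm x j) _.
by apply: (HM (`|M| + 1)) => //; rewrite ltr_pwDr// ler_norm.
Qed.

Lemma L2_si : semi_inner (L2 D : set ('rV[R]_n.+1 -> R^o)) (L2dot D).
Proof. exact: (dot_on_si leb mD). Qed.

Lemma L2_complete : complete_on (L2 D : set ('rV[R]_n.+1 -> R^o)) (L2dot D).
Proof. exact: (sq_integrable_complete (mu := leb) mD finD). Qed.

Lemma L2_intgM u v : L2 D u -> L2 D v -> intg (fun x => u x * v x).
Proof. exact: sq_integrableM. Qed.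

Lemma L2_intg u : L2 D u -> intg u.
Proof. exact: sq_integrable_intg. Qed.

Lemma test_fun_continuous f : test_fun D f -> continuous f.
Proof. by move=> [sf _ _]; have [] := sf [::]. Qed.

Lemma test_fun_derivable f i x : test_fun D f -> derivable f x (delta_mx ord0 i).
Proof. by move=> [sf _ _]; have [_] := sf [::]; apply. Qed.

Lemma test_fun_pderiv_continuous f i : test_fun D f -> continuous (pderiv i f).
Proof. by move=> [sf _ _]; have [] := sf [:: i]. Qed.

Lemma continuous_L2 f : continuous f ->
  (exists2 S, compact S & forall x, ~ S x -> f x = 0) -> L2 D f.
Proof.
move=> cf [S cS f0]; have [B [_ fB]] := continuous_supp_bounded cf cS f0.
apply: (@sq_integrable_bounded _ _ _ _ _ mD finD _ B) => [|x _]; last exact: fB.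
by apply: (@measurable_funS _ _ _ _ setT) => //; exact: continuous_measurable_rV.
Qed.

Lemma test_fun_supp f : test_fun D f ->
  exists2 S, compact S & forall x, ~ S x -> f x = 0.
Proof.
move=> [_ cS _]; eexists; first exact: cS.
by move=> x nS; apply/eqP; apply: contrapT => fy; apply/nS/subset_closure/negP.
Qed.

Lemma test_fun_L2 f : test_fun D f -> L2 D f.
Proof.
by move=> tf; apply: continuous_L2; [exact: test_fun_continuous|exact: test_fun_supp].
Qed.

Lemma test_fun_pderiv_L2 f i : test_fun D f -> L2 D (pderiv i f).
Proof.
move=> tf; apply: continuous_L2; first exact: test_fun_pderiv_continuous.
by case: tf => _ cS _; eexists; [exact: cS|move=> x; exact: pderiv_supp].
Qed.

Lemma integral_by_parts f (g : fct) i : test_fun D f ->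
  continuous g -> (forall x, derivable g x (delta_mx ord0 i)) ->
  continuous (pderiv i g) ->
  \int[leb]_(x in D) (f x * pderiv i g x + g x * pderiv i f x) = 0.
Proof.
move=> tf cg dg cdg; have df x := @test_fun_derivable f i x tf.
have cf := test_fun_continuous tf; have cdf := @test_fun_pderiv_continuous f i tf.
have dE : pderiv i (f * g) = (fun x => f x * pderiv i g x + g x * pderiv i f x).
  by apply/funext => x; rewrite /pderiv deriveM.
have sfg : closure [set x | (f * g) x != 0] `<=` closure [set x | f x != 0].
  by apply: closure_subset => x /=; rewrite mulf_eq0 negb_or => /andP[].
case: (tf) => _ cS SD; rewrite -dE; apply: integral_pderiv_eq0.
- by move=> x; apply: (cvgM (cf x) (cg x)).
- exact: subclosed_compact (@closed_closure _ _) cS sfg.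
- exact: subset_trans sfg SD.
- by move=> x; apply: derivableM.
- rewrite dE => x.
  exact: (cvgD (cvgM (cf x) (cdg x)) (cvgM (cg x) (cdf x))).
Qed.

Lemma test_fun_weak_pderiv f i : test_fun D f -> is_weak_pderiv D i f (pderiv i f).
Proof.
move=> tf; split; first exact: test_fun_pderiv_L2.
move=> phi tphi.
have := integral_by_parts tf (test_fun_continuous tphi)
  (fun x => @test_fun_derivable phi i x tphi) (@test_fun_pderiv_continuous phi i tphi).
rewrite RintegralD//.
- move=> /eqP; rewrite addr_eq0 => /eqP ->; congr (- _).
  by apply: eq_Rintegral => x _; rewrite mulrC.
- by apply: L2_intgM; [exact: test_fun_L2|exact: test_fun_pderiv_L2].
- by apply: L2_intgM; [exact: test_fun_L2|exact: test_fun_pderiv_L2].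
Qed.

(** Integrating by parts [x_0 f] against [f] gives the integral of [f^2] as that
    of [- 2 x_0 f (d_0 f)], and [x_0] is bounded on [D]. *)
Lemma poincare_test_fun : exists C, forall f, test_fun D f ->
  L2dot D f f <= C * L2dot D (pderiv ord0 f) (pderiv ord0 f).
Proof.
have [M [M0 DM]] := domain_cube; exists (4 * M ^+ 2) => f tf.
pose e : 'rV[R]_n.+1 := delta_mx ord0 ord0.
pose x0 : fct := fun x => x ord0 ord0.
have cx0 : continuous x0 by exact: coord_continuous.
have dx0 x : is_derive x e x0 (1 : R).
  have := @is_derive_affine R n id ord0 1 0 1 x e (is_derive_id _ _).
  rewrite mul1r mulr1 /e mxE !eqxx /=.
  by have -> : (fun x : 'rV[R]_n.+1 => id (1 * x ord0 ord0 + 0)) = x0 by apply/funext => y; rewrite mul1r addr0.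
have df x : derivable f x e := @test_fun_derivable f ord0 x tf.
have cf := test_fun_continuous tf; have cdf := @test_fun_pderiv_continuous f ord0 tf.
have dE : pderiv ord0 (x0 * f) = (fun x => x0 x * pderiv ord0 f x + f x).
  apply/funext => x; rewrite /pderiv deriveM//.
  by have [_ ->] := dx0 x; rewrite [_ *: 1]mulr1.
have := @integral_by_parts f (x0 * f) ord0 tf.
rewrite dE => /(_ _ _ _)/wrap[].
- by move=> x; apply: (cvgM (cx0 x) (cf x)).
- by move=> x; apply: derivableM.
- move=> x; exact: (cvgD (cvgM (cx0 x) (cdf x)) (cf x)).
move=> H; have Lf := test_fun_L2 tf; have Lg := @test_fun_pderiv_L2 f ord0 tf.
have iff := L2_intgM Lf Lf; have igg := L2_intgM Lg Lg.
have : 2^-1 * L2dot D f f + (- (2 * M ^+ 2)) * L2dot D (pderiv ord0 f) (pderiv ord0 f) <= 0.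
  rewrite -H /L2dot -!RintegralZl// -RintegralD//; [|exact: intgZ..].
  apply: le_Rintegral => //.
  - by apply: intgD => //; exact: intgZ.
  - apply: sq_integrable_intg => //.
    apply: continuous_L2.
      move=> x; apply: (cvgD (cvgM (cf x) (cvgD (cvgM (cx0 x) (cdf x)) (cf x))) (cvgM (cvgM (cx0 x) (cf x)) (cdf x))).
    have [S cS f0] := test_fun_supp tf; exists S => // x /f0 fx.
    by rewrite /= fctE fx mul0r mulr0 mul0r addr0.
  - move=> x Dx; rewrite !fctE -/(x0 x).
    have : x0 x ^+ 2 <= M ^+ 2.
      by have := DM _ Dx ord0; rewrite -ler_sqr ?nnegrE// real_normK ?num_real.
    move: (f x) (pderiv _ _ _) (x0 x) => a g y yM.
    have : y ^+ 2 * g ^+ 2 <= M ^+ 2 * g ^+ 2 by rewrite ler_wpM2r ?sqr_ge0.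
    by have := sqr_ge0 (a + 2 * y * g); lra.
by lra.
Qed.

(** The Borel sets of the product structure are those of the topology, as the
    induction on measurable sets in [test_fun_separate] requires. *)
Lemma measurable_rV_open : (@measurable _ 'rV[R]_n.+1) = <<s open >>.
Proof.
apply/seteqP; split => A mA; last first.
  move: mA; apply; split; last by move=> B; exact: open_measurable_rV.
  split; [exact: measurable0|by move=> B mB; rewrite setTD; exact: measurableC|].
  by move=> F mF; exact: bigcupT_measurable.
have : measurable_fun setT (idfun : g_sigma_algebraType (@open 'rV[R]_n.+1) -> 'rV[R]_n.+1).
  apply: measurable_fun_rV => i.
  apply: (@measurability _ _ _ (measurableTypeR R) setT _ _ (RGenOpens.measurableE R)).
  move=> _ [_ [x [y ->]] <-]; rewrite setTI; apply: sub_sigma_algebra.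
  apply: open_comp => [z _|]; [exact: coord_continuous|exact: itv_open].
by move=> /(_ measurableT A mA); rewrite setTI.
Qed.

(** Bounded approximation of indicators of open sets by test functions shows that
    the positive and negative parts of [w] define the same measure. *)
Lemma test_fun_separate w : intg w ->
  (forall f, test_fun D f -> \int[leb]_(x in D) (w x * f x) = 0) ->
  {ae leb, forall x, D x -> w x = 0}.
Proof.
move=> iw w0.
have mw : measurable_fun D w := intg_measurable iw.
(* [w] is null as soon as its integral over [D `&` A] vanishes for all measurable
   [A]; this holds for open [A], and extends by a Dynkin-system argument. *)
pose P (A : set 'rV[R]_n.+1) := (\int[leb]_(x in D `&` A) (w x)%:E = 0)%E.
have openP : open `<=` P.
  move=> O oO; have oOD : open (O `&` D) by exact: openI.
  have [|psi [tpsi psi01 psiO]] := @indic_open_test_fun R n D _ oOD; first by move=> x [].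
  have mO : measurable_fun D (fun x => w x * \1_O x).
    by apply: measurable_funM => //; apply: measurable_indic; exact: open_measurable_rV.
  have iO : intg (fun x => w x * \1_O x).
    apply: (dominated_integrable mD mO (integrable_norm iw)) => x _.
    by rewrite normrM ler_piMr// indicE; case: (_ \in _); rewrite ?normr1 ?normr0.
  have : \int[leb]_(x in D) (w x * \1_O x) = 0.
    have : \int[leb]_(x in D) (w x * psi m x) @[m --> \oo] -->
        \int[leb]_(x in D) (w x * \1_O x).
      apply: (Rdominated_cvg (g := fun x => `|w x|)) => //.
      - move=> m; apply: measurable_funM => //.
        apply: (@measurable_funS _ _ _ _ setT) => //; apply: continuous_measurable_rV.
        exact: test_fun_continuous (tpsi m).
      - move=> x Dx.
        have -> : (\1_O x : R) = \1_(O `&` D) x.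
          by rewrite !indicE in_setI (mem_set Dx) andbT.
        have cw : (fun _ : nat => w x) @ \oo --> w x by exact: cvg_cst.
        exact: (cvgM cw (psiO x)).
      - exact: integrable_norm.
      - by move=> m x Dx; have /andP[p0 p1] := psi01 m x; rewrite normrM ler_piMr// ger0_norm.
    have -> : (fun m => \int[leb]_(x in D) (w x * psi m x)) = cst 0.
      by apply/funext => m; exact: w0.
    by move=> /(cvg_lim (@Rhausdorff R)) <-; exact: lim_cst.
  rewrite /Rintegral => h.
  have e : (\int[leb]_(x in D `&` O) (w x)%:E = \int[leb]_(x in D) (w x * \1_O x)%:E)%E.
    rewrite integral_mkcondr; apply: eq_integral => x _.
    by rewrite patchE indicE; case: (_ \in _); rewrite ?mulr1 ?mulr0.
  by rewrite /P e -[LHS]fineK ?h//; exact: integrable_fin_num.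
have iwS S : measurable S -> leb.-integrable (D `&` S) (EFin \o w).
  by move=> mS; apply: integrableS iw => //; exact: measurableI.
have mP A : measurable A -> P A.
  rewrite measurable_rV_open; apply: (dynkin_induction measurable_rV_open).
  - by move=> B C; exact: openI.
  - exact/openP/openT.
  - exact: openP.
  - move=> S mS; rewrite /P => PS.
    have : P setT by exact/openP/openT.
    have DU : D = (D `&` S) `|` (D `&` ~` S) by rewrite -setIUr setUv setIT.
    rewrite /P setIT {1}DU.
    have mDS : measurable (D `&` S) by exact: measurableI.
    have mDCS : measurable (D `&` ~` S) by apply: measurableI => //; exact: measurableC.
    rewrite integral_setU//; first by rewrite PS add0e.
    + by rewrite -DU; exact/measurable_EFinP.
    + by rewrite disj_set2E setIACA setICr setI0.
  - move=> F mF tF PF; rewrite /P setI_bigcupr integral_bigcup.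
    + by apply: eseries0 => k _ _; exact: PF.
    + by move=> i j _ _ [x [[_ Fi] [_ Fj]]]; apply: tF => //; exists x.
    + by move=> k; exact: measurableI.
    + by rewrite -setI_bigcupr; apply: iwS; exact: bigcupT_measurable.
have ae := @integral_ae_eq _ _ _ leb D mD (cst 0%E) (EFin \o w) iw (measurable_cst _) _.
have {}ae : ae_eq leb D (EFin \o w) (cst 0%E).
  apply: ae => E ED mE; rewrite integral0; have := mP E mE.
  by rewrite /P setIidr.
by apply: filterS ae => x + Dx => /(_ Dx) [].
Qed.

Lemma weak_pderiv_ae_unique i u w w' :
  is_weak_pderiv D i u w -> is_weak_pderiv D i u w' ->
  {ae leb, forall x, D x -> w x = w' x}.
Proof.
move=> [Lw Hw] [Lw' Hw'].
have Ld : L2 D (w - w') by exact: (siB L2_si).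
have := @test_fun_separate (w - w') (L2_intg Ld) _.
move=> /(_ _)/wrap[]; last first.
  by apply: filterS => x + Dx => /(_ Dx) /eqP; rewrite subr_eq0 => /eqP.
move=> f tf; have Lf := test_fun_L2 tf.
have -> : \int[leb]_(x in D) ((w - w') x * f x) = L2dot D (w - w') f by [].
rewrite (siBl L2_si)//.
have := Hw f tf; rewrite (Hw' f tf) => /oppr_inj h.
by rewrite /L2dot h subrr.
Qed.

End weak_derivative.

(** * The Hilbert space H^1_0 *)

Section H1_space.
Context {R : realType} {n : nat}.
Local Notation fct := ('rV[R]_n.+1 -> R^o).
Local Notation leb := (@lebesgue_rV R n.+1).
Variable D : set 'rV[R]_n.+1.
Hypothesis oD : open D.
Hypothesis bD : bounded_set D.
Implicit Types (u v w f : fct) (i : 'I_n.+1).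
Local Notation intg f := (leb.-integrable D (EFin \o f)).
Local Notation wp := (weak_pderiv D).
Let mD : measurable D := measurable_domain oD.
Let L2si := L2_si oD.

Lemma L2_measurable u : L2 D u -> measurable_fun D (u : _ -> R).
Proof. by case. Qed.

Lemma is_weak_pderivP i u v w w' a : L2 D u -> L2 D v ->
  is_weak_pderiv D i u w -> is_weak_pderiv D i v w' ->
  is_weak_pderiv D i (u + a *: v) (w + a *: (w' : fct)).
Proof.
move=> Lu Lv [Lw Hw] [Lw' Hw']; split; first exact: (siP L2si).
move=> f tf; have Lf := test_fun_L2 oD bD tf.
have Lg := test_fun_pderiv_L2 oD bD i tf.
rewrite -[LHS]/(L2dot D (u + a *: v) (pderiv i f)) -[X in - X]/(L2dot D (w + a *: (w' : fct)) f).
rewrite !(siDl L2si)//.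
by rewrite /L2dot Hw// Hw'//; ring.
Qed.

Lemma weak_pderivP i u : H1 D u -> is_weak_pderiv D i u (wp i u).
Proof.
move=> [_ /(_ i)] h; rewrite /weak_pderiv.
exact: (@xgetPex _ (fun=> 0) [set w | is_weak_pderiv D i u w] h).
Qed.

Lemma weak_pderiv_L2 i u : H1 D u -> L2 D (wp i u).
Proof. by move=> /(weak_pderivP i)[]. Qed.

Lemma H1_L2 u : H1 D u -> L2 D u. Proof. by case. Qed.

(** The weak derivative is an arbitrary choice among the functions satisfying its
    definition, so it can be computed almost everywhere only. *)
Lemma weak_pderiv_ae i u w : is_weak_pderiv D i u w ->
  {ae leb, forall x, D x -> wp i u x = w x}.
Proof.
move=> Hw; apply: (weak_pderiv_ae_unique oD bD _ Hw).
rewrite /weak_pderiv; apply: xgetPex; by exists w.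
Qed.

Lemma H1P a u v : H1 D u -> H1 D v -> H1 D (u + a *: v).
Proof.
move=> Hu Hv; split; first by apply: (siP L2si); exact: H1_L2.
move=> i; exists (wp i u + a *: (wp i v : fct)).
by apply: is_weak_pderivP; [exact: H1_L2|exact: H1_L2|exact: weak_pderivP|exact: weak_pderivP].
Qed.

Lemma weak_pderivD_ae i a u v : H1 D u -> H1 D v ->
  {ae leb, forall x, D x -> wp i (u + a *: v) x = wp i u x + a * wp i v x}.
Proof.
move=> Hu Hv; apply: weak_pderiv_ae.
by apply: is_weak_pderivP; [exact: H1_L2|exact: H1_L2|exact: weak_pderivP|exact: weak_pderivP].
Qed.

Lemma H1_0 : H1 D (0 : fct).
Proof.
split; first exact: (si0 L2si).
move=> i; exists (fun=> 0); split; first exact: (si0 L2si).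
move=> f tf; rewrite (_ : (fun x => _ * pderiv i f x) = cst 0); last first.
  by apply/funext => x; rewrite mul0r.
rewrite (_ : (fun x => 0 * f x) = cst 0); last by apply/funext => x; rewrite mul0r.
by rewrite Rintegral_cst// mul0r oppr0.
Qed.

Lemma H10dotE u v : H1 D u -> H1 D v ->
  H10dot D u v = \sum_i L2dot D (wp i u) (wp i v).
Proof.
move=> Hu Hv; have iuv i : intg (fun x => wp i u x * wp i v x).
  by apply: (L2_intgM oD); exact: weak_pderiv_L2.
rewrite /H10dot /L2dot /Rintegral.
under eq_integral do rewrite -sumEFin.
rewrite integral_sum//.
by rewrite sum_fine// => i _; apply: integrable_fin_num => //; exact: iuv.
Qed.

Lemma L2dot_weak_pderivDl i a u v w : H1 D u -> H1 D v -> L2 D w ->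
  L2dot D (wp i (u + a *: v)) w = L2dot D (wp i u) w + a * L2dot D (wp i v) w.
Proof.
move=> Hu Hv Lw; have Lu := weak_pderiv_L2 i Hu; have Lv := weak_pderiv_L2 i Hv.
have Luv := weak_pderiv_L2 i (H1P a Hu Hv).
rewrite -(siDl L2si)//.
apply: (ae_eq_dot_on (mu := leb) mD) (weak_pderivD_ae i a Hu Hv); try exact: L2_measurable.
by apply: L2_measurable; exact: (siP L2si).
Qed.

Lemma H10dot_si : semi_inner (H1 D : set fct) (H10dot D).
Proof.
split; [exact: H1_0|exact: H1P| | |].
- move=> a u v w Hu Hv Hw; rewrite !H10dotE//; last exact: H1P.
  have Lw i := weak_pderiv_L2 i Hw.
  transitivity (\sum_i (L2dot D (wp i u) (wp i w) + a * L2dot D (wp i v) (wp i w))).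
    apply: eq_bigr => i _; exact: L2dot_weak_pderivDl.
  by rewrite big_split/= mulr_sumr.
- by move=> u v _ _; apply: eq_Rintegral => x _; apply: eq_bigr => i _; rewrite mulrC.
- by move=> u _; apply: Rintegral_ge0 => x _; apply: sumr_ge0 => i _; rewrite -expr2 sqr_ge0.
Qed.

(** The inner product whose norm is [H1norm], see [H1normE]. *)
Definition H1dot u v : R := L2dot D u v + H10dot D u v.

Lemma H1dot_si : semi_inner (H1 D : set fct) H1dot.
Proof.
split; [exact: H1_0|exact: H1P| | |].
- move=> a u v w Hu Hv Hw; rewrite /H1dot (siDl H10dot_si)// (siDl L2si); try exact: H1_L2.
  by rewrite mulrDr addrACA.
- by move=> u v Hu Hv; rewrite /H1dot (siC H10dot_si)// (siC L2si)//; exact: H1_L2.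
- by move=> u Hu; rewrite addr_ge0 ?(si_ge0 H10dot_si)// (si_ge0 L2si)//; exact: H1_L2.
Qed.

Lemma H1normE u : H1 D u -> H1norm D u = Num.sqrt (H1dot u u).
Proof.
move=> Hu; rewrite /H1norm /H1dot H10dotE//; congr (Num.sqrt (_ + _)).
  by apply: (nm_sqr L2si); exact: H1_L2.
by apply: eq_bigr => i _; apply: (nm_sqr L2si); exact: weak_pderiv_L2.
Qed.

Lemma L2dot_weak_pderiv_le i u : H1 D u ->
  L2dot D (wp i u) (wp i u) <= H10dot D u u.
Proof.
move=> Hu; rewrite H10dotE// (bigD1 i)//= lerDl sumr_ge0// => j _.
by apply: (si_ge0 L2si); exact: weak_pderiv_L2.
Qed.

Lemma foldr_pderivP f (g : fct) a s : smooth f -> smooth g ->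
  foldr pderiv (f + a *: g) s = foldr pderiv f s + a *: (foldr pderiv g s : fct).
Proof.
move=> sf sg; elim: s => //= i s ->.
have [_ df] := sf s; have [_ dg] := sg s.
apply/funext => x; rewrite /pderiv deriveD//; last exact: derivableZ.
by rewrite deriveZ.
Qed.

Lemma test_funP f (g : fct) a : test_fun D f -> test_fun D g -> test_fun D (f + a *: g).
Proof.
move=> [sf cf fD] [sg cg gD].
have sub : closure [set x | (f + a *: g) x != 0] `<=`
    closure [set x | f x != 0] `|` closure [set x | g x != 0].
  have cl : closed (closure [set x | f x != 0] `|` closure [set x | g x != 0]).
    by apply: closedU; exact: closed_closure.
  rewrite [X in _ `<=` X](iffLR (closure_id _) cl); apply: closure_subset => x /=.
  have [fx|fx _] := eqVneq (f x) 0; last by left; apply: subset_closure.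
  move=> h; right; apply: subset_closure => /=; apply: contra_neq h => gx.
  by rewrite !fctE fx gx scaler0 addr0.
split.
- move=> s; have e := foldr_pderivP a s sf sg; rewrite /= e {e}.
  have [cf' df] := sf s; have [cg' dg] := sg s.
  split=> [x|i x]; last first.
    by apply: derivableD; [exact: df|apply: derivableZ; exact: dg].
  exact: (cvgD (cf' x) (cvgM (cvg_cst a) (cg' x))).
- exact: subclosed_compact (@closed_closure _ _) (compactU cf cg) sub.
- by move=> x /sub[/fD|/gD].
Qed.

Lemma test_fun_H1 f : test_fun D f -> H1 D f.
Proof.
move=> tf; split; first exact: test_fun_L2.
by move=> i; exists (pderiv i f); exact: test_fun_weak_pderiv.
Qed.

Lemma H10_H1 u : H10 D u -> H1 D u. Proof. by case. Qed.

Lemma test_fun_H10 f : test_fun D f -> H10 D f.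
Proof.
move=> tf; split; first exact: test_fun_H1.
move=> e e0; exists f; split => //.
rewrite subrr H1normE; last exact: H1_0.
have H0 : H1 D (0 : fct) := H1_0.
have := siZl H1dot_si 0 H0 H0; rewrite scale0r mul0r => ->.
by rewrite sqrtr0.
Qed.

Lemma H1normD u v : H1 D u -> H1 D v -> H1norm D (u + v) <= H1norm D u + H1norm D v.
Proof.
move=> Hu Hv; rewrite !H1normE//; last exact: (siD H1dot_si).
exact: (nmD H1dot_si).
Qed.

Lemma H1normZ a u : H1 D u -> H1norm D (a *: u) = `|a| * H1norm D u.
Proof.
move=> Hu; rewrite !H1normE//; last exact: (siZ H1dot_si).
exact: (nmZ H1dot_si).
Qed.

Lemma H1norm_ge0 u : 0 <= H1norm D u. Proof. exact: sqrtr_ge0. Qed.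

Lemma H10P a u v : H10 D u -> H10 D v -> H10 D (u + a *: v).
Proof.
move=> [Hu du] [Hv dv]; split; first exact: H1P.
move=> e e0.
have e20 : 0 < e / 2 by rewrite divr_gt0.
have [f [tf fe]] := du _ e20.
have ae : 0 < e / 2 / (`|a| + 1) by rewrite !divr_gt0// ltr_wpDl.
have [g [tg ge]] := dv _ ae.
exists (f + a *: (g : fct)); split; first exact: test_funP.
have Hf := test_fun_H1 tf; have Hg := test_fun_H1 tg.
have Huf : H1 D (u - f) by exact: (siB H1dot_si).
have Hvg : H1 D (v - g) by exact: (siB H1dot_si).
have -> : u + a *: v - (f + a *: (g : fct)) = (u - f) + a *: (v - (g : fct)).
  by rewrite scalerBr opprD addrACA.
apply: le_lt_trans (H1normD Huf (siZ H1dot_si a Hvg)) _.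
rewrite H1normZ// (splitr e) ltr_leD//.
apply: (@le_trans _ _ ((`|a| + 1) * (e / 2 / (`|a| + 1)))).
  by apply: ler_pM => //; [exact: H1norm_ge0|rewrite lerDl|exact: ltW].
by rewrite mulrC divfK// gt_eqF// ltr_wpDl.
Qed.

Lemma H10_si : semi_inner (H10 D : set fct) (H10dot D).
Proof.
split; [| exact: H10P | | |].
- split; first exact: H1_0.
  move=> e e0; exists (0 : fct); split; last first.
    rewrite subrr H1normE; last exact: H1_0.
    have H0 : H1 D (0 : fct) := H1_0.
    by have := siZl H1dot_si 0 H0 H0; rewrite scale0r mul0r => ->; rewrite sqrtr0.
  have nz : [set x : 'rV[R]_n.+1 | (0 : fct) x != 0] = set0.
    by apply/seteqP; split => x //=; rewrite eqxx.
  split; rewrite ?nz ?closure0//; last exact: compact0.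
  exact: (flat_algebra_smooth (fa_cst 0)).
- by move=> a u v w [Hu _] [Hv _] [Hw _]; exact: (siDl H10dot_si).
- by move=> u v [Hu _] [Hv _]; exact: (siC H10dot_si).
- by move=> u [Hu _]; exact: (si_ge0 H10dot_si).
Qed.

Lemma H10_L2 u : H10 D u -> L2 D u. Proof. by move=> /H10_H1/H1_L2. Qed.

Lemma H10norm_le_H1norm u : H1 D u -> H10norm D u <= H1norm D u.
Proof.
move=> Hu; rewrite H1normE// ler_wsqrtr// lerDr; apply: (si_ge0 L2si).
exact: H1_L2.
Qed.

Lemma L2norm_le_H1norm u : H1 D u -> L2norm D u <= H1norm D u.
Proof.
by move=> Hu; rewrite H1normE// ler_wsqrtr// lerDl; apply: (si_ge0 H10dot_si).
Qed.

(** The inequality for test functions passes to their closure, since both norms are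
    dominated by [H1norm]. *)
Lemma poincare : exists2 C, 0 <= C &
  forall u, H10 D u -> L2norm D u <= C * H10norm D u.
Proof.
have [C0 HC] := poincare_test_fun oD bD.
pose C := Num.sqrt (Num.max C0 0).
have C_ge0 : 0 <= C by exact: sqrtr_ge0.
have HCf f : test_fun D f -> L2norm D f <= C * H10norm D f.
  move=> tf; have Hf := test_fun_H1 tf.
  rewrite /L2norm /H10norm -sqrtrM; last by rewrite le_max lexx orbT.
  apply: ler_wsqrtr; apply: le_trans (HC f tf) _.
  have Lg := test_fun_pderiv_L2 oD bD ord0 tf.
  have Lw := weak_pderiv_L2 ord0 Hf.
  have -> : L2dot D (pderiv ord0 f) (pderiv ord0 f) = L2dot D (wp ord0 f) (wp ord0 f).
    apply: (ae_eq_Rintegral mD); [exact: measurable_funM Lg.1 Lg.1|exact: measurable_funM Lw.1 Lw.1|].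
    apply: filterS (weak_pderiv_ae (test_fun_weak_pderiv oD bD ord0 tf)) => x + Dx.
    by move=> /(_ Dx) ->.
  apply: (@le_trans _ _ (Num.max C0 0 * L2dot D (wp ord0 f) (wp ord0 f))).
    by apply: ler_wpM2r; [exact: (si_ge0 L2si)|rewrite le_max lexx].
  by apply: ler_wpM2l; [rewrite le_max lexx orbT|exact: L2dot_weak_pderiv_le].
exists C => // u Vu; have Hu := H10_H1 Vu; apply/ler_addgt0Pr => e e0.
have d0 : 0 < e / (C + 1) by rewrite divr_gt0// ltr_wpDl.
have [f [tf fd]] := Vu.2 _ d0.
have Hf := test_fun_H1 tf; have Huf : H1 D (u - f) by exact: (siB H1dot_si).
have h1 : L2norm D u <= L2norm D f + e / (C + 1).
  rewrite -lerBlDl; apply: le_trans (nm_ge_sub L2si (H1_L2 Hu) (H1_L2 Hf)) _.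
  by apply: le_trans (L2norm_le_H1norm Huf) _; exact: ltW.
have h2 : H10norm D f <= H10norm D u + e / (C + 1).
  rewrite -lerBlDl; apply: le_trans (nm_ge_sub H10dot_si Hf Hu) _.
  have e1 : H10norm D (f - u) = H10norm D (u - f) := nmB H10dot_si Hf Hu.
  change (H10norm D (f - u) <= e / (C + 1)); rewrite e1.
  by apply: le_trans (H10norm_le_H1norm Huf) _; exact: ltW.
apply: le_trans h1 _; apply: le_trans (lerD (HCf _ tf) (lexx _)) _.
apply: le_trans (lerD (ler_wpM2l C_ge0 h2) (lexx _)) _.
have C1 : C + 1 != 0 by rewrite gt_eqF// ltr_wpDl.
by rewrite mulrDr -addrA lerD2l le_eqVlt; apply/orP; left; apply/eqP; field.
Qed.

Lemma L2dot_weak_pderivB i u v w w' : L2 D u -> L2 D v ->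
  is_weak_pderiv D i u w -> is_weak_pderiv D i v w' ->
  L2dot D (wp i (u - v)) (wp i (u - v)) = L2dot D (w - w') (w - w').
Proof.
move=> Lu Lv wu wv.
have h : is_weak_pderiv D i (u - v) (w - w').
  by have := is_weak_pderivP (-1) Lu Lv wu wv; rewrite !scaleN1r.
have [[mwp _] _] : is_weak_pderiv D i (u - v) (wp i (u - v)).
  exact: (@xgetPex _ (fun=> 0) [set z | is_weak_pderiv D i (u - v) z] (ex_intro _ _ h)).
have mw : measurable_fun D (w - w' : _ -> R) by case: h => -[].
apply: (ae_eq_Rintegral mD); [exact: measurable_funM|exact: measurable_funM|].
by apply: filterS (weak_pderiv_ae h) => x + Dx => /(_ Dx) ->.
Qed.

Lemma H1norm_geometric u (u_ : nat -> fct) C : H1 D u -> (forall k, H1 D (u_ k)) ->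
  (forall k, H1dot (u_ k - u) (u_ k - u) <= C * (2^-1 ^+ k) ^+ 2) ->
  forall e, 0 < e -> exists k, H1norm D (u - u_ k) < e.
Proof.
move=> Hu Hu_ uC e e0; apply: contrapT => /forallNP H.
have : e ^+ 2 <= 0; last by rewrite leNgt exprn_gt0.
apply: (@le0_of_le_geometric _ _ `|C|) => k.
have Hd1 : H1 D (u - u_ k) := siB H1dot_si Hu (Hu_ k).
have Hd2 : H1 D (u_ k - u) := siB H1dot_si (Hu_ k) Hu.
have sym : H1dot (u - u_ k) (u - u_ k) = H1dot (u_ k - u) (u_ k - u).
  by rewrite -(nm_sqr H1dot_si Hd1) (nmB H1dot_si Hu (Hu_ k)) (nm_sqr H1dot_si Hd2).
have : e <= H1norm D (u - u_ k) by have := H k => /negP; rewrite -leNgt.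
move=> h1; have h : e ^+ 2 <= H1norm D (u - u_ k) ^+ 2.
  by apply: lerXn2r h1; [exact: ltW|exact: H1norm_ge0].
move: h; rewrite (H1normE Hd1) (nm_sqr H1dot_si Hd1) sym => h.
apply: le_trans h _; apply: le_trans (uC k) _.
exact: sqr_geometric_le.
Qed.

(** A fast Cauchy sequence converges in [L2] by the Poincare inequality, and so do
    its weak derivatives; the limits of the latter are weak derivatives of the limit
    because the defining identity is continuous in [L2]. *)
Lemma H10_complete : complete_on (H10 D : set fct) (H10dot D).
Proof.
move=> u_ C Vu_ uC; have [Cp Cp0 HP] := poincare.
have Hu_ k := H10_H1 (Vu_ k); have Lu_ k := H1_L2 (Hu_ k).
have [|u [C1 [Lu uC1]]] := L2_complete oD bD (u_ := u_) (C := Cp ^+ 2 * C) Lu_.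
  move=> i j ij; have Vd := siB H10_si (Vu_ j) (Vu_ i).
  have h0 : L2norm D (u_ j - u_ i) ^+ 2 <= (Cp * H10norm D (u_ j - u_ i)) ^+ 2.
    by apply: lerXn2r (HP _ Vd); [exact: sqrtr_ge0|apply: mulr_ge0 => //; exact: sqrtr_ge0].
  have := ler_wpM2l (sqr_ge0 Cp) (uC _ _ ij); rewrite mulrA; apply: le_trans.
  by rewrite -(nm_sqr L2si (H10_L2 Vd)) -(nm_sqr H10_si Vd) -exprMn.
have /choice[w wP] : forall i, exists w : fct, L2 D w /\ exists C' : R, forall k,
    L2dot D ((wp i (u_ k) : fct) - w) ((wp i (u_ k) : fct) - w) <= C' * (2^-1 ^+ k) ^+ 2.
  move=> i.
  have [||w [C' [Lw wC]]] := L2_complete oD bD (u_ := fun k => wp i (u_ k)) (C := C).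
  - by move=> k; exact: weak_pderiv_L2.
  - move=> k l kl; have Hd := siB H10dot_si (Hu_ l) (Hu_ k).
    apply: le_trans (uC _ _ kl); apply: le_trans (L2dot_weak_pderiv_le i Hd).
    by rewrite (L2dot_weak_pderivB (Lu_ l) (Lu_ k) (weak_pderivP i (Hu_ l)) (weak_pderivP i (Hu_ k))).
  by exists w; split => //; exists C'.
have Lw i : L2 D (w i) by case: (wP i).
have /choice[K uK] : forall i, exists C' : R, forall k,
    L2dot D ((wp i (u_ k) : fct) - w i) ((wp i (u_ k) : fct) - w i) <= C' * (2^-1 ^+ k) ^+ 2.
  by move=> i; case: (wP i).
have uw i : is_weak_pderiv D i u (w i).
  split => // f tf; have Lf := test_fun_L2 oD bD tf.
  have Lg := test_fun_pderiv_L2 oD bD i tf.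
  rewrite -[LHS]/(L2dot D u (pderiv i f)) -[X in - X]/(L2dot D (w i) f).
  apply/eqP; rewrite -addr_eq0 -sqrf_eq0 eq_le sqr_ge0 andbT.
  set x := _ + _.
  pose B := 2 * C1 * L2dot D (pderiv i f) (pderiv i f) + 2 * K i * L2dot D f f.
  apply: (@le0_of_le_geometric _ _ `|B|) => k.
  have Lwk := weak_pderiv_L2 i (Hu_ k).
  have Lud : L2 D (u_ k - u) by exact: (siB L2si).
  have Lwd : L2 D ((wp i (u_ k) : fct) - w i) by exact: (siB L2si).
  have xE : x = - (L2dot D (u_ k - u) (pderiv i f) + L2dot D ((wp i (u_ k) : fct) - w i) f).
    rewrite !(siBl L2si)//.
    have : L2dot D (u_ k) (pderiv i f) = - L2dot D (wp i (u_ k)) f.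
      by have [_ h] := weak_pderivP i (Hu_ k); exact: h.
    by rewrite /x => ->; move: (L2dot _ _ _) (L2dot _ _ _) (L2dot _ _ _) => p q r; ring.
  have h1 := siCS L2si Lud Lg; have h2 := siCS L2si Lwd Lf.
  have h3 := ler_wpM2r (si_ge0 L2si Lg) (uC1 k).
  have h4 := ler_wpM2r (si_ge0 L2si Lf) (uK i k).
  apply: (@le_trans _ _ (B * (2^-1 ^+ k) ^+ 2)).
    rewrite xE /B; move: h1 h2 h3 h4.
    move: (L2dot D (u_ k - u) (pderiv i f)) (L2dot D _ f) => y z.
    move: (L2dot D (u_ k - u) _) (L2dot D ((wp i (u_ k) : fct) - w i) _) => y' z'.
    move: (L2dot D (pderiv i f) _) (L2dot D f f) (2^-1 ^+ k) => p r q h1 h2 h3 h4.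
    by have := sqr_ge0 (y - z); lra.
  exact: sqr_geometric_le.
have Hu : H1 D u by split => // i; exists (w i).
have dK k : H10dot D (u_ k - u) (u_ k - u) <= (\sum_i K i) * (2^-1 ^+ k) ^+ 2.
  have Hd := siB H10dot_si (Hu_ k) Hu.
  rewrite H10dotE// mulr_suml; apply: ler_sum => i _.
  by rewrite (L2dot_weak_pderivB (Lu_ k) Lu (weak_pderivP i (Hu_ k)) (uw i)).
exists u, (\sum_i K i); split => //.
have dH k : H1dot (u_ k - u) (u_ k - u) <= (C1 + \sum_i K i) * (2^-1 ^+ k) ^+ 2.
  by rewrite mulrDl lerD.
split => // e e0; have e20 : 0 < e / 2 by rewrite divr_gt0.
have [k ke] := H1norm_geometric Hu Hu_ dH e20.
have [f [tf fe]] := (Vu_ k).2 _ e20.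
exists f; split => //.
have -> : u - f = (u - u_ k) + (u_ k - f) by rewrite addrA subrK.
have Hf := test_fun_H1 tf.
apply: le_lt_trans (H1normD (siB H10dot_si Hu (Hu_ k)) (siB H10dot_si (Hu_ k) Hf)) _.
rewrite (splitr e); exact: ltrD ke fe.
Qed.

End H1_space.

Section separability.
Context {R : realType} {n : nat}.
Local Notation fct := ('rV[R]_n.+1 -> R^o).
Local Notation leb := (@lebesgue_rV R n.+1).

(** The near-covering form of compactness, unlike uniform continuity on [K], lets the
    second point leave [K]. *)
Lemma uniform_modulus (I : finType) (K : set 'rV[R]_n.+1) (G : I -> 'rV[R]_n.+1 -> R) (e : R) :
  compact K -> (forall i, continuous (G i)) -> 0 < e ->
  exists m : nat, forall x, K x -> forall i y, ball x m.+1%:R^-1 y -> `|G i x - G i y| < e.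
Proof.
move=> /compact_near_coveringP cK cG e0.
pose P (m : nat) (x : 'rV[R]_n.+1) := forall i y, ball x m.+1%:R^-1 y -> `|G i x - G i y| < e.
suff [m _ mP] : \forall m \near \oo, K `<=` P m.
  by exists m => x Kx; exact: (mP m (leqnn m)).
apply: cK => x _.
have H i : \forall x' \near x & m \near \oo, forall y, ball x' m.+1%:R^-1 y -> `|G i x' - G i y| < e.
  have e20 : 0 < e / 2 by rewrite divr_gt0.
  have := cG i x => /cvgrPdist_lt /(_ _ e20) /nbhs_ballP[r /= r0 xr].
  exists (ball x (r / 2), [set m : nat | m.+1%:R^-1 < r / 2]).
    split; first by apply: nbhsx_ballx; rewrite divr_gt0.
    have r20 : 0 < r / 2 by rewrite divr_gt0.
    have := @cvg_harmonic R => /cvgrPdist_lt /(_ _ r20).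
    by apply: filterS => m /=; rewrite sub0r normrN ger0_norm// invr_ge0.
  move=> [x' m] /= [xx' mr] y x'y.
  have h1 : `|G i x - G i x'| < e / 2.
    by apply: xr; apply: le_ball xx'; lra.
  have h2 : `|G i x - G i y| < e / 2.
    apply: xr; rewrite (splitr r); apply: ball_triangle xx' _.
    by apply: le_ball x'y; exact: ltW.
  rewrite (splitr e) -[G i x' - G i y](subrKA (G i x)) addrC.
  by apply: le_lt_trans (ler_normD _ _) _; rewrite ltrD// distrC.
exact: (filter_forall _ H).
Qed.

Lemma finite_net (K : set 'rV[R]_n.+1) (r : R) : compact K -> 0 < r ->
  exists s : seq 'rV[R]_n.+1, forall x, K x -> exists2 p, p \in s & ball x r p.
Proof.
rewrite compact_cover => cK r0.
have [|x Kx|s _ sK] := @cK _ setT (fun p => ball p r).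
- by move=> p _; exact: ball_open.
- by exists x => //; exact: ballxx.
exists (finmap.enum_fset s) => x /sK[p ps xp]; exists p => //; exact: ball_sym.
Qed.

Lemma floor_eq_dist (x y : R) : Num.floor x = Num.floor y -> `|x - y| < 1.
Proof.
move=> xy; have := floor_itv x; have := floor_itv y.
rewrite xy intrD => /andP[h1 h2] /andP[h3 h4].
by rewrite ltr_norml; apply/andP; split; lra.
Qed.

Variable D : set 'rV[R]_n.+1.
Hypothesis oD : open D.
Hypothesis bD : bounded_set D.
Let mD : measurable D := measurable_domain oD.

Lemma L2dot_le_bound (w : fct) (B : R) : L2 D w -> (forall x, D x -> `|w x| <= B) ->
  L2dot D w w <= B ^+ 2 * L2dot D (cst 1) (cst 1).
Proof.
move=> Lw wB; have L1 := sq_integrable1 mD (finite_domain oD bD).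
have i1 := L2_intgM oD L1 L1.
rewrite /L2dot -RintegralZl//; apply: le_Rintegral => //.
- exact: (L2_intgM oD Lw Lw).
- exact: (intgZ mD (B ^+ 2) i1).
move=> x Dx; rewrite /= !mulr1 -expr2 -[w x ^+ 2]real_normK ?num_real//.
by apply: lerXn2r; rewrite ?nnegrE// ?wB// (le_trans _ (wB _ Dx)).
Qed.

(** A test function is determined, up to a small error in [H10norm], by finitely
    many integers: the integer parts of its gradient, suitably scaled, on a fine
    enough finite net. *)
Lemma H10_separable : exists v : nat -> fct, (forall k, H10 D (v k)) /\
  forall u, H10 D u -> forall e, 0 < e -> exists k, H10norm D (u - v k) < e.
Proof.
have [M [M0 DM]] := domain_cube bD.
pose K : set 'rV[R]_n.+1 := cube M.
have cK : compact K.
  apply: bounded_closed_compact; last exact: closed_cube.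
  exists M; split; first exact: num_real.
  move=> y My x Kx; suff : `|x| <= y by [].
  rewrite [`|x|]mx_normrE.
  by apply: bigmax_le => [|[i j] _]; [exact/(le_trans M0)/ltW|rewrite (ord1 i)/= (le_trans (Kx j))// ltW].
have /choice[net netP] : forall m : nat, exists s : seq 'rV[R]_n.+1,
    forall x, K x -> exists2 p, p \in s & ball x m.+1%:R^-1 p.
  by move=> m; apply: finite_net.
pose eps (q : nat) : R := q.+1%:R^-1.
have eps0 q : 0 < eps q by rewrite invr_gt0.
pose osc q m (f : fct) := forall x, K x -> forall i y, ball x m.+1%:R^-1 y ->
  `|pderiv i f x - pderiv i f y| < eps q.
pose code q m (f : fct) : seq (seq int) :=
  [seq [seq Num.floor (pderiv i f p / eps q) | i <- enum 'I_n.+1] | p <- net m].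
have code_eq q m f g : osc q m f -> osc q m g -> code q m f = code q m g ->
    forall x, D x -> forall i, `|pderiv i f x - pderiv i g x| <= 3 * eps q.
  move=> of_ og fg x Dx i; have Kx := DM _ Dx.
  have [p pm xp] := netP m x Kx.
  have /eq_in_map/(_ p pm) : code q m f = code q m g by [].
  move=> /eq_in_map/(_ i (mem_enum _ _)) /floor_eq_dist.
  have h1 := of_ _ Kx i _ xp; have h2 := og _ Kx i _ xp.
  rewrite -mulrBl normrM (gtr0_norm (_ : 0 < (eps q)^-1)) ?invr_gt0//.
  rewrite ltr_pdivrMr// mul1r => h3.
  move: h1 h2 h3; rewrite !ltr_norml ler_norml => /andP[? ?] /andP[? ?] /andP[? ?].
  by apply/andP; split; lra.
(* One test function is chosen for each code that is realized; the codes form a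
   countable type. *)
pose cand (t : nat * nat * seq (seq int)) : set fct :=
  [set f | [/\ test_fun D f, osc t.1.1 t.1.2 f & code t.1.1 t.1.2 f = t.2]].
pose v k : fct := if unpickle k is Some t then xget (0 : fct) (cand t) else (0 : fct).
have V0 := si0 (H10_si oD bD).
exists v; split.
  move=> k; rewrite /v; case: unpickle => [t|//].
  by case: xgetP => [f _ [tf _ _]|//]; exact: test_fun_H10.
move=> u Vu e e0; have e20 : 0 < e / 2 by rewrite divr_gt0.
have [f [tf fe]] := Vu.2 _ e20.
pose lam := L2dot D (cst 1) (cst 1).
have lam0 : 0 <= lam by apply: (si_ge0 (L2_si oD)); exact: sq_integrable1 mD (finite_domain oD bD).
pose c := Num.sqrt (n.+1%:R * lam).
have [q qP] : exists q, c * (3 * eps q) < e / 2.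
  have c0 : 0 <= c by exact: sqrtr_ge0.
  have d0 : 0 < e / 2 / (3 * (c + 1)) by rewrite divr_gt0// mulr_gt0// ltr_wpDl.
  exists (Num.truncn (e / 2 / (3 * (c + 1)))^-1).
  have : eps (Num.truncn (e / 2 / (3 * (c + 1)))^-1) < e / 2 / (3 * (c + 1)).
    by rewrite invf_plt ?posrE//; exact: truncnS_gt.
  rewrite ltr_pdivlMr ?mulr_gt0 ?ltr_wpDl//; have := eps0 (Num.truncn (e / 2 / (3 * (c + 1)))^-1).
  move: (eps _) => E E0 h; have := mulr_ge0 c0 (ltW E0); lra.
have [m mP] := uniform_modulus cK (fun i => test_fun_pderiv_continuous (i := i) tf) (eps0 q).
pose t := (q, m, code q m f).
exists (pickle t).
have [g [tg og gE] vg] : exists2 g, cand t g & v (pickle t) = g.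
  exists (xget (0 : fct) (cand t)); last by rewrite /v pickleK.
  by apply: xgetPex; exists f.
rewrite vg; have Hf := test_fun_H1 oD bD tf; have Hg := test_fun_H1 oD bD tg.
have Hu := H10_H1 Vu.
have Huf := siB (H10dot_si oD bD) Hu Hf; have Hfg := siB (H10dot_si oD bD) Hf Hg.
have h1 : H10norm D (u - f) < e / 2 by apply: le_lt_trans fe; exact: H10norm_le_H1norm.
have h2 : H10norm D (f - g) <= c * (3 * eps q).
  have p0 : 0 <= 3 * eps q by rewrite mulr_ge0// ltW.
  rewrite -(ger0_norm p0) -sqrtr_sqr /c -sqrtrM ?mulr_ge0//; apply: ler_wsqrtr.
  rewrite (H10dotE oD Hfg Hfg).
  apply: (@le_trans _ _ (\sum_(i < n.+1) ((3 * eps q) ^+ 2 * lam))); last first.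
    by rewrite sumr_const card_ord -[leLHS]mulr_natl [leRHS]mulrAC -[leRHS]mulrA.
  apply: ler_sum => i _.
  have wf := test_fun_weak_pderiv oD bD i tf; have wg := test_fun_weak_pderiv oD bD i tg.
  rewrite (L2dot_weak_pderivB oD bD (H1_L2 Hf) (H1_L2 Hg) wf wg).
  apply: L2dot_le_bound; first by apply: (siB (L2_si oD)); [exact: wf.1|exact: wg.1].
  by move=> x Dx; apply: (code_eq q m) => //; rewrite gE.
have -> : u - g = (u - f) + (f - g) by rewrite addrA subrK.
apply: le_lt_trans (nmD (H10dot_si oD bD) Huf Hfg) _.
rewrite (splitr e); apply: ltr_leD h1 _; exact: le_trans h2 (ltW qP).
Qed.

End separability.

(** * Integrals depending on a parameter *)

Lemma ae_le_Rintegral d (T : measurableType d) (R : realType)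
    (mu : {measure set T -> \bar R}) (D : set T) (f g : T -> R) : measurable D ->
  mu.-integrable D (EFin \o f) -> mu.-integrable D (EFin \o g) ->
  {ae mu, forall x, D x -> f x <= g x} ->
  \int[mu]_(x in D) f x <= \int[mu]_(x in D) g x.
Proof.
move=> mD if_ ig fg; rewrite -subr_ge0 -RintegralB//.
have mf := intg_measurable if_; have mg := intg_measurable ig.
rewrite (@ae_eq_Rintegral _ _ _ mu D mD _ (fun x => Num.max (g x - f x) 0)).
- by apply: Rintegral_ge0 => x _; rewrite le_max lexx orbT.
- exact: measurable_funB.
- by apply: measurable_maxr => //; exact: measurable_funB.
by apply: filterS fg => x + Dx => /(_ Dx) h; rewrite max_l// subr_ge0.
Qed.

(** The set where [a < f] is the union of the countably many [E i] for which
    [a < c i - e i]. *)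
Lemma measurable_of_approx d (T : measurableType d) (R : realType) (I : countType)
    (f : T -> R) (E : I -> set T) (c e : I -> R) :
  (forall i, measurable (E i)) ->
  (forall i t, E i t -> `|f t - c i| <= e i) ->
  (forall t (eps : R), 0 < eps -> exists i, E i t /\ e i < eps) ->
  measurable_fun setT f.
Proof.
move=> mE fE fa; apply: (@measurability _ _ _ (measurableTypeR R) setT f _ (RGenOInfty.measurableE R)) => _ [_ [a ->] <-].
rewrite setTI (_ : _ @^-1` _ = \bigcup_i (if a < c i - e i then E i else set0)).
  apply: countable_bigcupT_measurable => [|i]; first exact: countableP.
  by case: ifP.
apply/seteqP; split => t /=.
  rewrite in_itv/= andbT => at_; have e0 : 0 < (f t - a) / 2 by rewrite divr_gt0// subr_gt0.
  have [i [Eit ei]] := fa t _ e0; exists i => //.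
  have := fE i t Eit; rewrite ler_norml => /andP[h1 h2].
  by rewrite ifT//; lra.
move=> [i _]; case: ifP => // ai Eit; rewrite in_itv/= andbT.
have := fE i t Eit; rewrite ler_norml => /andP[h1 h2]; lra.
Qed.

Section parameter.
Context {R : realType} {n : nat} d {T : measurableType d}.
Local Notation leb := (@lebesgue_rV R n).
Variable D : set 'rV[R]_n.
Hypothesis mD : measurable D.

Lemma measurable_integral_param (F : 'rV[R]_n * T -> \bar R) :
  measurable_fun (D `*` setT) F -> (forall p, 0 <= F p)%E ->
  measurable_fun setT (fun t => \int[leb]_(x in D) F (x, t))%E.
Proof.
move=> mF F0; have mDT : measurable (D `*` [set: T]) by exact: measurableX.
have mG : measurable_fun setT (F \_ (D `*` setT)) by apply/(measurable_restrictT _ mDT).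
have G0 p : (0 <= (F \_ (D `*` setT)) p)%E by rewrite patchE; case: ifP.
have := @measurable_fun_fubini_tonelli_G _ _ _ _ R (@lebesgue_sf R n) _ mG G0.
apply: eq_measurable_fun => t _; rewrite /fubini_G [RHS]integral_mkcond.
apply: eq_integral => x _; rewrite !patchE.
by rewrite in_setX [t \in _]mem_set ?andbT.
Qed.

(** Tonelli's theorem for the positive and negative parts, so that [F] need not be
    integrable. *)
Lemma measurable_Rintegral_param (F : 'rV[R]_n * T -> R) :
  measurable_fun (D `*` setT) F ->
  measurable_fun setT (fun t => \int[leb]_(x in D) F (x, t)).
Proof.
move=> mF; have mEF : measurable_fun (D `*` setT) (EFin \o F) by exact/measurable_EFinP.
rewrite /Rintegral; apply: measurableT_comp => //.
under eq_fun do rewrite integralE.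
apply: emeasurable_funB.
  have H := measurable_integral_param (measurable_funepos mEF) (funepos_ge0 _).
  apply: eq_measurable_fun H => t _; apply: eq_integral => x _.
  by rewrite !funeposE.
have H := measurable_integral_param (measurable_funeneg mEF) (funeneg_ge0 _).
  apply: eq_measurable_fun H => t _; apply: eq_integral => x _.
  by rewrite !funenegE.
Qed.

Lemma measurable_fun_fst (f : 'rV[R]_n -> R) : measurable_fun D f ->
  measurable_fun (D `*` [set: T]) (fun p : 'rV[R]_n * T => f p.1).
Proof.
move=> mf; apply: (@eq_measurable_fun _ _ _ _ _ (fun p : 'rV[R]_n * T => (f \_ D) p.1)).
  by move=> p; rewrite inE => -[Dp _]; rewrite patchE mem_set.
apply: (@measurable_funS _ _ _ _ setT) => //.
by apply: measurableT_comp => //; exact/(measurable_restrictT _ mD).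
Qed.

End parameter.

(** * The solution operator *)

Lemma continuous_sum (R : realType) (T : topologicalType) (I : Type) (r : seq I)
    (F : I -> T -> R) :
  (forall i, continuous (F i)) -> continuous (fun y => \sum_(i <- r) F i y).
Proof.
move=> cF; elim: r => [|i r IH] x.
  by under eq_fun do rewrite big_nil; exact: cst_continuous.
under eq_fun do rewrite big_cons.
exact: (cvgD (cF i x) (IH x)).
Qed.

Lemma rational_dense_closed (R : realType) n (C : set 'rV[R]_n) : closed C ->
  (forall q : 'rV[rat]_n, C (map_mx ratr q)) -> C = setT.
Proof.
move=> cC Cq; apply/seteqP; split => // y _; apply: contrapT => nCy.
have [i [_ iC]] := open_rat_box (closed_openC cC) nCy.
apply: (iC (box_center i)); last exact: Cq.
by move=> j; rewrite subrr normr0 ltW// box_radius_gt0.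
Qed.

(** Passing from the dual norm, a supremum over the unit ball, to a bound
    proportional to the norm: the case [r = 0] is that of vectors of norm zero, all
    of whose multiples lie in the unit ball. *)
Lemma le_of_scaled (R : realType) (c a r : R) : 0 <= c -> 0 <= a -> 0 <= r ->
  (forall t, 0 < t -> t * r <= 1 -> t * a <= c) -> a <= c * r.
Proof.
move=> c0 a0 r0 H; move: r0; rewrite le_eqVlt => /predU1P[r0|r0].
  rewrite -r0 mulr0; move: a0; rewrite le_eqVlt => /predU1P[<-//|a0].
  have t0 : 0 < (c + 1) / a by rewrite divr_gt0// ltr_wpDl.
  have := H _ t0; rewrite -r0 mulr0 ler01 divfK ?gt_eqF// => /(_ isT).
  by rewrite gerDl ler10.
have := H r^-1; rewrite invr_gt0 mulVf ?gt_eqF// => /(_ r0 (lexx _)).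
by rewrite ler_pdivrMl// mulrC.
Qed.

Section solution_operator.
Context {R : realType} {n : nat} {Xi : pmetricType R}.
Local Notation fct := ('rV[R]_n.+1 -> R^o).
Local Notation leb := (@lebesgue_rV R n.+1).
Variables (D : set 'rV[R]_n.+1).
Hypothesis oD : open D.
Hypothesis bD : bounded_set D.
Variables (b : 'I_n.+1 -> 'I_n.+1 -> 'rV[R]_n.+1 -> Xi -> R) (gamma L : R).
Hypothesis gamma_gt0 : 0 < gamma.
Hypothesis L_gt0 : 0 < L.
Hypothesis b_elliptic : forall y : 'rV[R]_n.+1,
  {ae leb, forall x, D x -> forall xi,
    gamma * (\sum_i y ord0 i ^+ 2)
      <= \sum_i \sum_j b i j x xi * y ord0 i * y ord0 j
      <= L * (\sum_i y ord0 i ^+ 2)}.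
Hypothesis bform_defined : forall xi u v, H10 D u -> H10 D v ->
  leb.-integrable D (EFin \o bform_integrand D b xi u v).
Hypothesis A_bounded : forall xi u, H10 D u ->
  (dual_norm D (A_op D b xi u) <= (L * H10norm D u)%:E)%E.
Implicit Types (u v w h : fct) (xi : Xi).
Local Notation wp := (weak_pderiv D).
Local Notation bf := (bform D b).
Let mD : measurable D := measurable_domain oD.
Let V_si := H10_si oD bD.

(** Ellipticity holds almost everywhere for each rational vector, hence almost
    everywhere for all rational vectors and, by density, for all vectors. *)
Lemma elliptic_ae : {ae leb, forall x, D x -> forall xi (y : 'rV[R]_n.+1),
  gamma * (\sum_i y ord0 i ^+ 2) <= \sum_i \sum_j b i j x xi * y ord0 i * y ord0 j}.
Proof.
pose y_ (k : nat) : 'rV[R]_n.+1 :=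
  if @unpickle ('rV[rat]_n.+1) k is Some q then map_mx ratr q else 0.
have : {ae leb, forall x k, D x -> forall xi,
    gamma * (\sum_i y_ k ord0 i ^+ 2) <= \sum_i \sum_j b i j x xi * y_ k ord0 i * y_ k ord0 j}.
  apply/ae_foralln => k; apply: filterS (b_elliptic (y_ k)) => x + Dx xi.
  by move=> /(_ Dx xi) /andP[].
apply: filterS => x H Dx xi y.
pose q (y : 'rV[R]_n.+1) := (\sum_i \sum_j b i j x xi * y ord0 i * y ord0 j)
  + \sum_i (- gamma) * y ord0 i * y ord0 i.
have cq : continuous q.
  have c (i : 'I_n.+1) : continuous (fun y : 'rV[R]_n.+1 => y ord0 i).
    exact: coord_continuous.
  have c1 : continuous (fun y : 'rV[R]_n.+1 => \sum_i \sum_j b i j x xi * y ord0 i * y ord0 j).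
    apply: continuous_sum => i; apply: continuous_sum => j z.
    exact: (cvgM (cvgM (cvg_cst (b i j x xi)) (c i z)) (c j z)).
  have c2 : continuous (fun y : 'rV[R]_n.+1 => \sum_i (- gamma) * y ord0 i * y ord0 i).
    apply: continuous_sum => i z.
    exact: (cvgM (cvgM (cvg_cst (- gamma)) (c i z)) (c i z)).
  by move=> z; exact: (cvgD (c1 z) (c2 z)).
have qE z : (0 <= q z) = (gamma * (\sum_i z ord0 i ^+ 2) <= \sum_i \sum_j b i j x xi * z ord0 i * z ord0 j).
  rewrite -[RHS]subr_ge0 /q.
  have -> : \sum_i (- gamma) * z ord0 i * z ord0 i = - (gamma * \sum_i z ord0 i ^+ 2).
    rewrite mulr_sumr -sumrN; apply: eq_bigr => i _.
    by rewrite -mulrA mulNr expr2.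
  by [].
have : [set z | 0 <= q z] = setT.
  apply: rational_dense_closed.
    by apply: (@preimage_closed _ _ q [set t | 0 <= t]) => [z _|]; [exact: cq|exact: closed_ge].
  by move=> p; have := H (pickle p) Dx xi; rewrite /= qE /y_ pickleK.
by move=> /seteqP[_ /(_ y I)] /=; rewrite qE.
Qed.

(** Ellipticity is integrated after being applied at almost every [x] to the gradient
    at [x], a vector which depends on [x]. *)
Lemma bform_coercive xi u : H10 D u -> gamma * H10dot D u u <= bf u u xi.
Proof.
move=> Vu; have Hu := H10_H1 Vu.
have iu : leb.-integrable D (EFin \o (fun x => \sum_i wp i u x * wp i u x)).
  by apply: (intg_sum mD) => i; apply: (L2_intgM oD); exact: weak_pderiv_L2.
rewrite /H10dot -RintegralZl//; apply: (ae_le_Rintegral mD).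
- exact: (intgZ mD gamma iu).
- exact: bform_defined.
apply: filterS elliptic_ae => x + Dx => /(_ Dx xi (\row_i wp i u x)).
rewrite /bform_integrand.
under eq_bigr do rewrite mxE expr2.
by under [X in _ <= X -> _]eq_bigr do under eq_bigr do rewrite !mxE.
Qed.

Lemma H10norm_ge0 u : 0 <= H10norm D u. Proof. exact: sqrtr_ge0. Qed.

Lemma bform_linear_r xi u : H10 D u -> linear_on (H10 D : set fct) (fun v => bf u v xi).
Proof.
move=> Vu a v w Vv Vw; have Hv := H10_H1 Vv; have Hw := H10_H1 Vw.
have i1 := bform_defined xi Vu Vv; have i2 := bform_defined xi Vu Vw.
have i12 := bform_defined xi Vu (siP V_si a Vv Vw).
rewrite /bform -RintegralZl// -RintegralD//; last exact: (intgZ mD a i2).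
apply: (ae_eq_Rintegral mD).
- exact: intg_measurable i12.
- exact: (intg_measurable (intgD mD i1 (intgZ mD a i2))).
have : {ae leb, forall x, forall j, D x -> wp j (v + a *: w) x = wp j v x + a * wp j w x}.
  by apply: filter_forall => j; exact: weak_pderivD_ae.
apply: filterS => x H Dx; rewrite /bform_integrand mulr_sumr -big_split; apply: eq_bigr => i _.
rewrite mulr_sumr -big_split; apply: eq_bigr => j _ /=.
rewrite (H j Dx); move: (b i j x xi) (wp i u x) (wp j v x) (wp j w x) => p q r s; ring.
Qed.

Lemma bform_linear_l xi v : H10 D v -> linear_on (H10 D : set fct) (fun u => bf u v xi).
Proof.
move=> Vv a u w Vu Vw; have Hu := H10_H1 Vu; have Hw := H10_H1 Vw.
have i1 := bform_defined xi Vu Vv; have i2 := bform_defined xi Vw Vv.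
have i12 := bform_defined xi (siP V_si a Vu Vw) Vv.
rewrite /bform -RintegralZl// -RintegralD//; last exact: (intgZ mD a i2).
apply: (ae_eq_Rintegral mD).
- exact: intg_measurable i12.
- exact: (intg_measurable (intgD mD i1 (intgZ mD a i2))).
have : {ae leb, forall x, forall j, D x -> wp j (u + a *: w) x = wp j u x + a * wp j w x}.
  by apply: filter_forall => j; exact: weak_pderivD_ae.
apply: filterS => x H Dx; rewrite /bform_integrand mulr_sumr -big_split; apply: eq_bigr => i _.
rewrite mulr_sumr -big_split; apply: eq_bigr => j _ /=.
rewrite (H i Dx); move: (b i j x xi) (wp i u x) (wp j v x) (wp i w x) => p q r s; ring.
Qed.

Lemma bform_bounded xi u v : H10 D u -> H10 D v ->
  `|bf u v xi| <= L * H10norm D u * H10norm D v.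
Proof.
move=> Vu Vv; have l := bform_linear_r xi Vu.
have Lu0 : 0 <= L * H10norm D u by apply: mulr_ge0; [exact: ltW|exact: H10norm_ge0].
have H t : 0 < t -> t * H10norm D v <= 1 -> t * `|bf u v xi| <= L * H10norm D u.
  move=> t0 tv; have Vtv : H10 D (t *: v) by exact: (siZ V_si).
  have -> : t * `|bf u v xi| = `|bf u (t *: v) xi|.
    by rewrite (linear_onZ V_si t l Vv) normrM gtr0_norm.
  rewrite -lee_fin; apply: le_trans (A_bounded xi Vu).
  apply: ereal_sup_ubound; exists (t *: v) => //; split => //.
  have -> : H10norm D (t *: v) = `|t| * H10norm D v := nmZ V_si t Vv.
  by rewrite gtr0_norm.
exact: (le_of_scaled Lu0 (normr_ge0 _) (H10norm_ge0 v) H).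
Qed.

Lemma bform_bounded_sqr xi u v : H10 D u -> H10 D v ->
  bf u v xi ^+ 2 <= L ^+ 2 * H10dot D u u * H10dot D v v.
Proof.
move=> Vu Vv; have h := bform_bounded xi Vu Vv.
have e1 : H10norm D u ^+ 2 = H10dot D u u := nm_sqr V_si Vu.
have e2 : H10norm D v ^+ 2 = H10dot D v v := nm_sqr V_si Vv.
rewrite -e1 -e2 -!exprMn -(real_normK (num_real (bf u v xi))).
exact: (lerXn2r 2 (normr_ge0 _) (le_trans (normr_ge0 _) h) h).
Qed.

(** Lax-Milgram shows that the set from which [A_inv] chooses is nonempty. *)
Lemma A_invP xi (l : fct -> R) C : linear_on (H10 D : set fct) l ->
  (forall v, H10 D v -> l v ^+ 2 <= C * H10dot D v v) ->
  H10 D (A_inv D b xi l) /\ forall v, H10 D v -> bf (A_inv D b xi l) v xi = l v.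
Proof.
move=> ll lC.
have := lax_milgram V_si (H10_complete oD bD) (a := fun u v => bf u v xi)
  (fun v Vv => bform_linear_l xi Vv) (fun u Vu => bform_linear_r xi Vu)
  (fun u v Vu Vv => bform_bounded_sqr xi Vu Vv) gamma_gt0
  (fun u Vu => bform_coercive xi Vu) ll lC.
move=> ex; rewrite /A_inv.
exact: (@xgetPex _ (fun=> 0)
  [set u | H10 D u /\ forall v, H10 D v -> A_op D b xi u v = l v] ex).
Qed.

End solution_operator.

Lemma le_div_of_quadratic (R : realType) (g t c : R) : 0 < g -> 0 <= t -> 0 <= c ->
  g * t ^+ 2 <= c * t -> t <= c / g.
Proof.
move=> g0 t0 c0; move: t0; rewrite le_eqVlt => /predU1P[<- _|t0].
  by rewrite divr_ge0// ltW.
by rewrite expr2 mulrA ler_pM2r// ler_pdivlMr// mulrC.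
Qed.

(** The error bound involves the norms of the approximations [a] and [b] only, which
    are constants when the approximations are taken from a fixed sequence. *)
Lemma dot_perturbation (R : realType) (E : lmodType R) (V : set E) (dot : E -> E -> R)
    (a b a' b' : E) (e : R) :
  semi_inner V dot -> V a -> V b -> V a' -> V b' ->
  Num.sqrt (dot (a - a') (a - a')) <= e -> Num.sqrt (dot (b - b') (b - b')) <= e ->
  `|dot a' b' - dot a b| <= e * (Num.sqrt (dot a a) + Num.sqrt (dot b b) + e).
Proof.
move=> si Va Vb Va' Vb' ae be.
have e0 : 0 <= e by exact: le_trans (sqrtr_ge0 _) ae.
have Vda := siB si Va Va'; have Vdb := siB si Vb Vb'.
have -> : dot a' b' - dot a b =
    dot (a - a') (b - b') - dot (a - a') b - dot a (b - b').
  rewrite !(siBl si)// !(siBr si)//; move: (dot a b) (dot a b') (dot a' b) (dot a' b').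
  by move=> p q r s; ring.
have h1 := siCSn si Vda Vdb; have h2 := siCSn si Vda Vb; have h3 := siCSn si Va Vdb.
have := sqrtr_ge0 (dot a a); have := sqrtr_ge0 (dot b b).
have := sqrtr_ge0 (dot (a - a') (a - a')); have := sqrtr_ge0 (dot (b - b') (b - b')).
move: h1 h2 h3 ae be; move: (Num.sqrt (dot a a)) (Num.sqrt (dot b b)).
move: (Num.sqrt (dot (a - a') (a - a'))) (Num.sqrt (dot (b - b') (b - b'))).
move: (dot (a - a') (b - b')) (dot (a - a') b) (dot a (b - b')).
move=> x y z p q A B h1 h2 h3 pe qe q0 p0 B0 A0.
have k1 : p * q <= e * e by apply: ler_pM.
have k2 : p * B <= e * B by apply: ler_wpM2r.
have k3 : A * q <= A * e by apply: ler_wpM2l.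
have := ler_normB (x - y) z; have := ler_normB x y; lra.
Qed.

(** The error bound of [dot_perturbation] for approximations at distance
    [B / k.+1] becomes small with [1 / k.+1]; the term with the factor 3 accounts for
    measuring [N] on the exact vectors instead of the approximating ones. *)
Lemma small_error (R : realType) (B N eps : R) : 0 <= B -> 0 <= N -> 0 < eps ->
  exists k : nat, B * k.+1%:R^-1 * (N + 3 * (B * k.+1%:R^-1)) < eps.
Proof.
move=> B0 N0 eps0; pose S := B * (N + 3 * B).
have S0 : 0 <= S by rewrite mulr_ge0// addr_ge0// mulr_ge0.
have d0 : 0 < eps / (S + 1) by rewrite divr_gt0// ltr_wpDl.
exists (Num.truncn (eps / (S + 1))^-1).
set k := Num.truncn _; pose r : R := k.+1%:R^-1.
have r0 : 0 < r by rewrite invr_gt0.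
have r1 : r <= 1 by rewrite invf_le1// ler1n.
have : r < eps / (S + 1) by rewrite invf_plt ?posrE//; exact: truncnS_gt.
rewrite ltr_pdivlMr ?ltr_wpDl// -/r => rS.
have h1 : 3 * (B * r) <= 3 * B by rewrite ler_wpM2l// ler_piMr.
have h2 : B * r * (N + 3 * (B * r)) <= B * r * (N + 3 * B).
  by rewrite ler_wpM2l ?mulr_ge0 ?(ltW r0)// lerD2l.
by apply: le_lt_trans h2 _; rewrite /S in rS; lra.
Qed.

Section solution_measurable.
Context {R : realType} {n : nat} {Xi : pmetricType R}.
Local Notation fct := ('rV[R]_n.+1 -> R^o).
Variables (D : set 'rV[R]_n.+1).
Hypothesis oD : open D.
Hypothesis bD : bounded_set D.
Variables (bf : fct -> fct -> Xi -> R) (gamma L : R).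
Hypothesis gamma_gt0 : 0 < gamma.
Hypothesis L_gt0 : 0 < L.
Hypothesis bf_linear_l : forall xi v, H10 D v -> linear_on (H10 D : set fct) (fun u => bf u v xi).
Hypothesis bf_linear_r : forall xi u, H10 D u -> linear_on (H10 D : set fct) (fun v => bf u v xi).
Hypothesis bf_bounded : forall xi u v, H10 D u -> H10 D v ->
  `|bf u v xi| <= L * H10norm D u * H10norm D v.
Hypothesis bf_coercive : forall xi u, H10 D u -> gamma * H10dot D u u <= bf u u xi.
Hypothesis bf_measurable : forall u v, H10 D u -> H10 D v ->
  measurable_fun setT (fun xi : borel Xi => bf u v xi).
Variable T : Xi -> fct -> fct.
Hypothesis TP : forall xi h, L2 D h ->
  H10 D (T xi h) /\ forall v, H10 D v -> bf (T xi h) v xi = L2dot D h v.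
Implicit Types (u v w : fct) (xi : Xi).
Let V_si := H10_si oD bD.
Let L_si := L2_si oD.

Lemma solution_H10 xi h : L2 D h -> H10 D (T xi h).
Proof. by move=> /(TP xi)[]. Qed.

Lemma solution_L2 xi h : L2 D h -> L2 D (T xi h).
Proof. by move=> /(solution_H10 xi) /H10_L2. Qed.

(** Testing the equation with the error [u - T xi h] itself, approximated by the
    [v_ m], turns a bound on the residual into a bound on the error. *)
Lemma solution_error (v_ : nat -> fct) xi h u (e : R) : L2 D h -> H10 D u -> 0 <= e ->
  (forall m, H10 D (v_ m)) ->
  (forall w, H10 D w -> forall e, 0 < e -> exists m, H10norm D (w - v_ m) < e) ->
  (forall m, `|bf u (v_ m) xi - L2dot D h (v_ m)| <= e * H10norm D (v_ m)) ->
  H10norm D (u - T xi h) <= e / gamma.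
Proof.
move=> Lh Vu e0 Vv dv res; have [VT bT] := TP xi Lh.
pose d : fct := u - T xi h.
have Vd : H10 D d by exact: (siB V_si Vu VT).
have d0 : 0 <= H10norm D d := H10norm_ge0 D d.
have dm m : `|bf d (v_ m) xi| <= e * H10norm D (v_ m).
  have -> : bf d (v_ m) xi = bf u (v_ m) xi - L2dot D h (v_ m).
    rewrite -(bT _ (Vv m)); exact: (linear_onB (bf_linear_l xi (Vv m)) Vu VT).
  exact: res.
apply: (le_div_of_quadratic gamma_gt0 d0 e0).
have -> : H10norm D d ^+ 2 = H10dot D d d := nm_sqr V_si Vd.
apply: le_trans (bf_coercive xi Vd) _.
apply/ler_addgt0Pr => eta eta0.
pose c := e + L * H10norm D d + 1.
have c0 : 0 < c.
  by apply: ltr_wpDl => //; apply: addr_ge0 => //; apply: mulr_ge0 => //; exact: ltW.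
have [m dvm] := dv _ Vd (eta / c) (divr_gt0 eta0 c0).
have Vr : H10 D (d - v_ m) by exact: (siB V_si Vd (Vv m)).
have e1 : bf d d xi = bf d (v_ m) xi + bf d (d - v_ m) xi.
  have := linear_onB (bf_linear_r xi Vd) Vd (Vv m); rewrite /= => ->.
  by rewrite addrC subrK.
have h1 := dm m; have h2 := bf_bounded xi Vd Vr.
have h3 : H10norm D (v_ m) <= H10norm D d + H10norm D (d - v_ m).
  have e2 : H10norm D (d - v_ m) = H10norm D (v_ m - d) := nmB V_si Vd (Vv m).
  rewrite e2 -lerBlDl; exact: (nm_ge_sub V_si (Vv m) Vd).
have dvc : H10norm D (d - v_ m) * c < eta by rewrite -ltr_pdivlMr.
rewrite e1; move: h1 h2 h3 (H10norm_ge0 D (d - v_ m)) dvc d0 c0; rewrite /c.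
move: (bf d (v_ m) xi) (bf d (d - v_ m) xi) (H10norm D (v_ m)) (H10norm D d) (H10norm D (d - v_ m)).
move=> p q r s t h1 h2 h3 t0 h4 s0 c0.
have k1 := ler_wpM2l e0 h3.
have := ler_norm p; have := ler_norm q; lra.
Qed.

Variable Cp : R.
Hypothesis Cp_ge0 : 0 <= Cp.
Hypothesis CpP : forall u, H10 D u -> L2norm D u <= Cp * H10norm D u.

(** The solution tested against itself, with the Poincare inequality used twice. *)
Lemma solution_bound xi h : L2 D h -> L2norm D (T xi h) <= Cp ^+ 2 / gamma * L2norm D h.
Proof.
move=> Lh; have [VT bT] := TP xi Lh; have LT := H10_L2 VT.
have t0 := H10norm_ge0 D (T xi h); have h0 : 0 <= L2norm D h by exact: sqrtr_ge0.
have c0 : 0 <= L2norm D h * Cp by exact: mulr_ge0.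
have key : gamma * H10norm D (T xi h) ^+ 2 <= L2norm D h * Cp * H10norm D (T xi h).
  have -> : H10norm D (T xi h) ^+ 2 = H10dot D (T xi h) (T xi h) := nm_sqr V_si VT.
  apply: le_trans (bf_coercive xi VT) _; rewrite (bT _ VT).
  apply: le_trans (ler_norm _) _; apply: le_trans (siCSn L_si Lh LT) _.
  by rewrite -mulrA; apply: ler_wpM2l => //; exact: CpP.
have := le_div_of_quadratic gamma_gt0 t0 c0 key => H.
apply: le_trans (CpP VT) _; apply: le_trans (ler_wpM2l Cp_ge0 H) _.
by rewrite le_eqVlt; apply/orP; left; apply/eqP; field; rewrite gt_eqF.
Qed.

(** The solution is linear in its data only up to vectors of norm zero, so linearity
    is stated for its inner products. *)
Lemma L2dot_solutionDl xi a h (k : fct) w : L2 D h -> L2 D k -> L2 D w ->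
  L2dot D (T xi (h + a *: k)) w = L2dot D (T xi h) w + a * L2dot D (T xi k) w.
Proof.
move=> Lh Lk Lw; have Lhk := siP L_si a Lh Lk.
have [V1 b1] := TP xi Lh; have [V2 b2] := TP xi Lk; have [V3 b3] := TP xi Lhk.
have V12 := siP V_si a V1 V2.
pose d : fct := T xi (h + a *: k) - (T xi h + a *: T xi k).
have Vd : H10 D d by exact: (siB V_si V3 V12).
have bd : bf d d xi = 0.
  have e1 := linear_onB (bf_linear_l xi Vd) V3 V12.
  have e2 := bf_linear_l xi Vd a V1 V2.
  rewrite /= in e1 e2; rewrite e1 e2 (b1 _ Vd) (b2 _ Vd) (b3 _ Vd).
  by rewrite (siDl L_si a Lh Lk (H10_L2 Vd)) subrr.
have d0 : H10dot D d d = 0.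
  apply/eqP; rewrite eq_le (si_ge0 V_si Vd) andbT.
  by have := bf_coercive xi Vd; rewrite bd pmulr_rle0.
have Ld := H10_L2 Vd.
have dw : L2dot D d w = 0.
  have n0 : L2norm D d <= 0 by have := CpP Vd; rewrite /H10norm d0 sqrtr0 mulr0.
  have := siCSn L_si Ld Lw => h1; apply/eqP; rewrite -normr_le0.
  apply: le_trans h1 _; apply: mulr_le0_ge0 => //; exact: sqrtr_ge0.
apply/eqP; rewrite -subr_eq0 -(siDl L_si a (H10_L2 V1) (H10_L2 V2) Lw).
by rewrite -(siBl L_si (H10_L2 V3) (H10_L2 V12) Lw) -/d dw.
Qed.

(** The form of measurability of the data that the equation sees: it is only tested
    against [H10 D]. *)
Definition weakly_measurable (h : Xi -> fct) :=
  (forall xi, L2 D (h xi)) /\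
  forall v, H10 D v -> measurable_fun setT (fun xi : borel Xi => L2dot D (h xi) v).

(** The sets on which a given element of a dense sequence solves the equation up
    to a small residual are measurable, since the residual need only be tested
    against the sequence; they approximate the solution uniformly. *)
Lemma measurable_solution_dot (h1 h2 : Xi -> fct) w1 w2 :
  weakly_measurable h1 -> weakly_measurable h2 -> L2 D w1 -> L2 D w2 ->
  measurable_fun setT
    (fun xi : borel Xi => L2dot D (T xi (h1 xi) - w1) (T xi (h2 xi) - w2)).
Proof.
move=> [Lh1 mh1] [Lh2 mh2] Lw1 Lw2.
have [v_ [Vv dv]] := H10_separable oD bD.
pose r (k : nat) : R := k.+1%:R^-1.
have r0 k : 0 < r k by rewrite invr_gt0.
(* The parameters for which [v_ j] solves the equation with data [h] up to [r k]. *)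
pose Eset (h : Xi -> fct) (k j : nat) : set (borel Xi) :=
  \bigcap_m [set xi | `|bf (v_ j) (v_ m) xi - L2dot D (h xi) (v_ m)| <= r k * H10norm D (v_ m)].
have mE (h : Xi -> fct) k j : weakly_measurable h -> measurable (Eset h k j).
  move=> [_ mh]; apply: bigcapT_measurable => m.
  have mf : measurable_fun setT (fun xi : borel Xi => `|bf (v_ j) (v_ m) xi - L2dot D (h xi) (v_ m)|).
    apply: measurableT_comp => //; apply: measurable_funB; [exact: bf_measurable|exact: mh].
  have := mf measurableT `]-oo, r k * H10norm D (v_ m)]%classic (measurable_itv _).
  by rewrite setTI; congr measurable; apply/seteqP; split => xi /=; rewrite in_itv.
pose ep k := Cp * (r k / gamma).
have errE (h : Xi -> fct) k j xi : L2 D (h xi) -> Eset h k j xi -> L2norm D (v_ j - T xi (h xi)) <= ep k.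
  move=> Lh Exi; have [VT _] := TP xi Lh.
  apply: le_trans (CpP (siB V_si (Vv j) VT)) _; apply: ler_wpM2l; first exact: Cp_ge0.
  exact: (solution_error Lh (Vv j) (ltW (r0 k)) Vv dv (fun m => Exi m I)).
have covE (h : Xi -> fct) k xi : L2 D (h xi) -> exists j, Eset h k j xi.
  move=> Lh; have [VT bT] := TP xi Lh.
  have [j hj] := dv _ VT (r k / L) (divr_gt0 (r0 k) L_gt0).
  exists j => m _ /=; have Vd := siB V_si (Vv j) VT.
  rewrite -(bT _ (Vv m)).
  have e1 := linear_onB (bf_linear_l xi (Vv m)) (Vv j) VT.
  rewrite /= in e1; rewrite -e1.
  apply: le_trans (bf_bounded xi Vd (Vv m)) _; apply: ler_wpM2r; first exact: H10norm_ge0.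
  have e2 : H10norm D (v_ j - T xi (h xi)) = H10norm D (T xi (h xi) - v_ j) := nmB V_si (Vv j) VT.
  rewrite e2 -(ler_pdivlMl _ _ L_gt0) [L^-1 * _]mulrC; exact: ltW hj.
pose nw j w := L2norm D (v_ j - w).
apply: (@measurable_of_approx _ (borel Xi) R (nat * nat * nat)%type _
  (fun i => Eset h1 i.1.1 i.1.2 `&` Eset h2 i.1.1 i.2)
  (fun i => L2dot D (v_ i.1.2 - w1) (v_ i.2 - w2))
  (fun i => ep i.1.1 * (nw i.1.2 w1 + nw i.2 w2 + ep i.1.1))).
- by move=> i; apply: measurableI; exact: mE.
- move=> [[k j1] j2] xi /= [E1 E2].
  have Lv1 := H10_L2 (Vv j1); have Lv2 := H10_L2 (Vv j2).
  have LT1 := solution_L2 xi (Lh1 xi); have LT2 := solution_L2 xi (Lh2 xi).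
  have sub (a b c : fct) : (a - c) - (b - c) = a - b by rewrite opprB addrA subrK.
  apply: (dot_perturbation L_si (siB L_si Lv1 Lw1) (siB L_si Lv2 Lw2)
    (siB L_si LT1 Lw1) (siB L_si LT2 Lw2)); rewrite sub; exact: errE.
move=> xi eps eps0.
pose N := L2norm D (T xi (h1 xi) - w1) + L2norm D (T xi (h2 xi) - w2).
have N0 : 0 <= N by apply: addr_ge0; exact: sqrtr_ge0.
have B0 : 0 <= Cp / gamma by apply: divr_ge0 => //; exact: ltW.
have [k kP] := small_error B0 N0 eps0.
have epE : ep k = Cp / gamma * k.+1%:R^-1 by rewrite /ep mulrA mulrAC.
rewrite -epE in kP.
have ep0 : 0 <= ep k.
  by rewrite epE; apply: mulr_ge0; [exact: B0|exact: (ltW (r0 k))].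
have [j1 E1] := covE h1 k xi (Lh1 xi); have [j2 E2] := covE h2 k xi (Lh2 xi).
exists (k, j1, j2); split => //=; apply: le_lt_trans kP; apply: ler_wpM2l; first exact: ep0.
have nwP (h : Xi -> fct) w j : L2 D (h xi) -> L2 D w -> Eset h k j xi ->
    nw j w <= L2norm D (T xi (h xi) - w) + ep k.
  move=> Lh Lw Exi; have LT := solution_L2 xi Lh; have Lv := H10_L2 (Vv j).
  have -> : nw j w = L2norm D ((T xi (h xi) - w) + (v_ j - T xi (h xi))).
    by rewrite addrC addrA subrK.
  apply: le_trans (nmD L_si (siB L_si LT Lw) (siB L_si Lv LT)) _.
  by apply: lerD; [exact: lexx|exact: (errE h)].
have n1 := nwP _ _ _ (Lh1 xi) Lw1 E1; have n2 := nwP _ _ _ (Lh2 xi) Lw2 E2.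
rewrite /N; move: n1 n2 ep0; move: (nw j1 w1) (nw j2 w2) (ep k) (L2norm D (T xi (h1 xi) - w1)) (L2norm D (T xi (h2 xi) - w2)).
by move=> a b c d e *; lra.
Qed.

End solution_measurable.

(** * First-order conditions and stability *)

Lemma slope_ge0 (R : realType) (a I J : R) :
  (forall t, 0 < t -> t <= 1 -> a <= a + t * I + t ^+ 2 / 2 * J) -> 0 <= I.
Proof.
move=> H; rewrite -oppr_le0; apply: (@le0_of_le_geometric _ _ (J / 2)) => k.
have t0 : 0 < (2^-1 : R) ^+ k by rewrite exprn_gt0.
have t1 : (2^-1 : R) ^+ k <= 1 by apply: exprn_ile1; lra.
move: t0 (H _ t0 t1); move: (2^-1 ^+ k) => t t0 h.
have : 0 <= t * (I + t / 2 * J) by lra.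
rewrite pmulr_rge0//; lra.
Qed.

Lemma le_of_EFin (R : realType) (x y : \bar R) (a b : R) :
  x = a%:E -> y = b%:E -> (x <= y)%E -> a <= b.
Proof. by move=> -> ->; rewrite lee_fin. Qed.

Section stability.
Context {R : realType} {n : nat} {Xi : pmetricType R}.
Local Notation fct := ('rV[R]_n.+1 -> R^o).
Variables (D : set 'rV[R]_n.+1).
Hypothesis oD : open D.
Hypothesis bD : bounded_set D.
Variables (T : Xi -> fct -> fct) (K : R).
Hypothesis K_ge0 : 0 <= K.
Hypothesis T_L2 : forall xi h, L2 D h -> L2 D (T xi h).
Hypothesis T_bound : forall xi h, L2 D h -> L2norm D (T xi h) <= K * L2norm D h.
Hypothesis T_linear : forall xi a (h k w : fct), L2 D h -> L2 D k -> L2 D w ->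
  L2dot D (T xi (h + a *: k)) w = L2dot D (T xi h) w + a * L2dot D (T xi k) w.
Hypothesis T_measurable : forall (h1 h2 : Xi -> fct) (w1 w2 : fct),
  weakly_measurable D h1 -> weakly_measurable D h2 -> L2 D w1 -> L2 D w2 ->
  measurable_fun setT
    (fun xi : borel Xi => L2dot D (T xi (h1 xi) - w1) (T xi (h2 xi) - w2)).
Variables (g : Xi -> fct) (ut : fct) (alpha : R).
Hypothesis g_L2 : forall xi, L2 D (g xi).
Hypothesis g_wm : weakly_measurable D g.
Hypothesis g_norm_measurable : measurable_fun setT (fun xi : borel Xi => L2norm D (g xi) ^+ 2).
Hypothesis ut_L2 : L2 D ut.
Let si := L2_si oD.
Implicit Types (z h w : fct) (xi : Xi).

Let S z xi : fct := T xi (z + g xi).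

(** The derivative of [cost] at [z] in the direction [h], see [cost_expansion]. *)
Definition gradient z h xi : R :=
  L2dot D (S z xi - ut) (T xi h) + alpha * L2dot D z h.

(** The second derivative of [cost] in the direction [h]; it does not depend on the
    point since [cost] is quadratic. *)
Definition curvature h xi : R := L2dot D (T xi h) (T xi h) + alpha * L2dot D h h.

Definition cost z xi : R :=
  2^-1 * L2norm D (S z xi - ut) ^+ 2 + alpha / 2 * L2norm D z ^+ 2.

Lemma L2_zg z xi : L2 D z -> L2 D (z + g xi).
Proof. by move=> Lz; exact: (siD si). Qed.

Lemma L2_S z xi : L2 D z -> L2 D (S z xi).
Proof. by move=> Lz; apply: T_L2; exact: L2_zg. Qed.

Lemma L2_Sut z xi : L2 D z -> L2 D (S z xi - ut).
Proof. by move=> Lz; apply: (siB si); [exact: L2_S|]. Qed.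

Lemma state_dotD z h t xi w : L2 D z -> L2 D h -> L2 D w ->
  L2dot D (S (z + t *: h) xi - ut) w =
  L2dot D (S z xi - ut) w + t * L2dot D (T xi h) w.
Proof.
move=> Lz Lh Lw; have Lzth := siP si t Lz Lh.
rewrite (siBl si (L2_S xi Lzth) ut_L2 Lw) (siBl si (L2_S xi Lz) ut_L2 Lw).
have e : z + t *: h + g xi = (z + g xi) + t *: h by rewrite addrAC.
by rewrite /S e (T_linear xi t (L2_zg xi Lz) Lh Lw) addrAC.
Qed.

Lemma gradientD z h t xi : L2 D z -> L2 D h ->
  gradient (z + t *: h) h xi = gradient z h xi + t * curvature h xi.
Proof.
move=> Lz Lh; rewrite /gradient /curvature (state_dotD t xi Lz Lh (T_L2 xi Lh)).
rewrite (siDl si t Lz Lh Lh).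
move: (L2dot D (S z xi - ut) (T xi h)) (L2dot D (T xi h) (T xi h)) (L2dot D z h) (L2dot D h h).
by move=> p q r s; ring.
Qed.

(** Taking [a = 1] and zero data in [T_linear] shows that [T xi 0] has zero inner
    products, although it may be a nonzero function. *)
Lemma gradientZ z h c xi : L2 D z -> L2 D h ->
  gradient z (c *: h) xi = c * gradient z h xi.
Proof.
move=> Lz Lh; have L0 := si0 si; have Lch := siZ si c Lh.
have LX := L2_Sut xi Lz.
have T0 (w : fct) : L2 D w -> L2dot D (T xi 0) w = 0.
  move=> Lw; have := T_linear xi 1 L0 L0 Lw; rewrite scaler0 addr0 mul1r.
  by move: (L2dot _ _ _) => p; lra.
have e : L2dot D (T xi (c *: h)) (S z xi - ut) = c * L2dot D (T xi h) (S z xi - ut).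
  have := T_linear xi c L0 Lh LX; rewrite add0r => ->.
  by rewrite (T0 _ LX) add0r.
rewrite /gradient (siC si LX (T_L2 xi Lch)) e (siC si (T_L2 xi Lh) LX) (siZr si c Lh Lz).
by rewrite mulrDr mulrCA.
Qed.

Lemma cost_expansion z h t xi : L2 D z -> L2 D h ->
  cost (z + t *: h) xi = cost z xi + t * gradient z h xi + t ^+ 2 / 2 * curvature h xi.
Proof.
move=> Lz Lh; have Lzth := siP si t Lz Lh.
have LX := L2_Sut xi Lz; have LY := L2_Sut xi Lzth; have LT := T_L2 xi Lh.
rewrite /cost.
have e1 : L2norm D (S (z + t *: h) xi - ut) ^+ 2 = L2dot D (S (z + t *: h) xi - ut) (S (z + t *: h) xi - ut) := nm_sqr si LY.
have e2 : L2norm D (S z xi - ut) ^+ 2 = L2dot D (S z xi - ut) (S z xi - ut) := nm_sqr si LX.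
have e3 : L2norm D z ^+ 2 = L2dot D z z := nm_sqr si Lz.
have e4 : L2norm D (z + t *: h) ^+ 2 = L2dot D (z + t *: h) (z + t *: h) := nm_sqr si Lzth.
rewrite e1 e2 e3 e4 (sqP si t Lz Lh) (state_dotD t xi Lz Lh LY).
rewrite (siC si LX LY) (siC si LT LY) !(state_dotD t xi Lz Lh) // (siC si LT LX).
rewrite /gradient /curvature.
move: (L2dot D (S z xi - ut) (S z xi - ut)) (L2dot D (S z xi - ut) (T xi h)).
move: (L2dot D (T xi h) (T xi h)) (L2dot D z h) (L2dot D h h) (L2dot D z z) => a b c d p q.
by field.
Qed.

Lemma curvature_ge z xi : L2 D z -> alpha * L2norm D z ^+ 2 <= curvature z xi.
Proof.
move=> Lz; have e3 : L2norm D z ^+ 2 = L2dot D z z := nm_sqr si Lz.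
by rewrite e3 /curvature lerDr; exact: (si_ge0 si (T_L2 xi Lz)).
Qed.

Lemma wm_cst h : L2 D h -> weakly_measurable D (fun _ : Xi => h).
Proof. by move=> Lh; split => // v _; exact: measurable_cst. Qed.

Lemma wm_zg z : L2 D z -> weakly_measurable D (fun xi : Xi => z + g xi).
Proof.
move=> Lz; split => [xi|v Vv]; first exact: L2_zg.
have Lv := H10_L2 Vv.
rewrite (_ : (fun xi : borel Xi => _) = (fun xi : borel Xi => L2dot D z v + L2dot D (g xi) v)).
  by apply: measurable_funD => //; exact: g_wm.2.
apply/funext => xi; have := siDl si 1 Lz (g_L2 xi) Lv.
by rewrite scale1r mul1r.
Qed.

Lemma measurable_gradient z h : L2 D z -> L2 D h ->
  measurable_fun setT (gradient z h : borel Xi -> R).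
Proof.
move=> Lz Lh; apply: measurable_funD => //.
have := T_measurable (wm_zg Lz) (wm_cst Lh) ut_L2 (si0 si).
by apply: eq_measurable_fun => xi _; rewrite subr0.
Qed.

Lemma measurable_curvature h : L2 D h -> measurable_fun setT (curvature h : borel Xi -> R).
Proof.
move=> Lh; apply: measurable_funD => //.
have := T_measurable (wm_cst Lh) (wm_cst Lh) (si0 si) (si0 si).
by apply: eq_measurable_fun => xi _; rewrite !subr0.
Qed.

Lemma measurable_cost z : L2 D z -> measurable_fun setT (cost z : borel Xi -> R).
Proof.
move=> Lz; apply: measurable_funD => //; apply: measurable_funM => //.
have := T_measurable (wm_zg Lz) (wm_zg Lz) ut_L2 ut_L2.
apply: eq_measurable_fun => xi _; have LX := L2_Sut xi Lz.
by apply/esym; exact: (nm_sqr si LX).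
Qed.

Lemma state_norm_le z xi : L2 D z ->
  L2norm D (S z xi - ut) <= (K * L2norm D z + L2norm D ut) + K * L2norm D (g xi).
Proof.
move=> Lz; have LS := L2_S xi Lz.
have h1 := nmD si LS (siN si ut_L2).
have h2 : L2norm D (- ut) = L2norm D ut.
  have := nmZ si (-1) ut_L2; rewrite scaleN1r normrN normr1 mul1r; exact.
have h3 := T_bound xi (L2_zg xi Lz).
have h4 := ler_wpM2l K_ge0 (nmD si Lz (g_L2 xi)).
apply: le_trans h1 _; rewrite -/(L2norm D (- ut)) h2.
apply: le_trans (lerD (le_trans h3 h4) (lexx _)) _.
by rewrite mulrDr addrAC.
Qed.

Section one_measure.
Variable P : probability (borel Xi) R.
Hypothesis g_P : (\int[P]_xi (L2norm D (g xi) ^+ 2)%:E < +oo)%E.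
Local Notation intP f := (P.-integrable setT (EFin \o f)).

(** The only integrability assumption is that the squared norm of [g] is integrable,
    so the functions of [xi] considered are bounded by affine functions of it. *)
Lemma integrable_of_growth (f : borel Xi -> R) c0 c1 : measurable_fun setT f ->
  (forall xi, `|f xi| <= c0 + c1 * L2norm D (g xi) ^+ 2) -> intP f.
Proof.
move=> mf fc.
have ig : intP (fun xi => L2norm D (g xi) ^+ 2).
  apply/integrableP; split; first exact/measurable_EFinP.
  by under eq_integral do rewrite /= ger0_norm ?sqr_ge0//.
have i0 : intP (fun _ : borel Xi => c0) by apply: finite_measure_integrable_cst.
exact: (dominated_integrable measurableT mf (intgD measurableT i0 (intgZ measurableT c1 ig))
  (fun xi _ => fc xi)).
Qed.

Lemma le_growth (p q x : R) : 0 <= q -> 0 <= x -> p + q * x <= (p + q) + q * x ^+ 2.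
Proof.
move=> q0 x0; have : 0 <= q * ((x - 1) ^+ 2 + x) by rewrite mulr_ge0// addr_ge0// sqr_ge0.
by lra.
Qed.

Lemma integrable_gradient z h : L2 D z -> L2 D h -> intP (gradient z h).
Proof.
move=> Lz Lh.
pose A := K * L2norm D z + L2norm D ut; pose H := K * L2norm D h.
have H0 : 0 <= H by apply: mulr_ge0; [exact: K_ge0|exact: sqrtr_ge0].
apply: (@integrable_of_growth _ (A * H + `|alpha * L2dot D z h| + K * H) (K * H)).
  exact: measurable_gradient.
move=> xi; apply: le_trans (ler_normD _ _) _.
have h1 := siCSn si (L2_Sut xi Lz) (T_L2 xi Lh).
have h2 := state_norm_le xi Lz; have h3 := T_bound xi Lh.
have g0 : 0 <= L2norm D (g xi) by exact: sqrtr_ge0.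
have h4 : `|L2dot D (S z xi - ut) (T xi h)| <= (A + K * L2norm D (g xi)) * H.
  by apply: le_trans h1 _; apply: ler_pM; [exact: sqrtr_ge0|exact: sqrtr_ge0|exact: h2|exact: h3].
have h5 := le_growth (A * H) (mulr_ge0 K_ge0 H0) g0.
move: h4 h5; move: (L2norm D (g xi)) `|L2dot D _ _| `|alpha * _| => x y w h4 h5; lra.
Qed.

Lemma integrable_curvature h : L2 D h -> intP (curvature h).
Proof.
move=> Lh; pose H := K * L2norm D h.
apply: (@integrable_of_growth _ (H ^+ 2 + `|alpha * L2dot D h h|) 0).
  exact: measurable_curvature.
move=> xi; rewrite mul0r addr0; apply: le_trans (ler_normD _ _) _; rewrite lerD2r.
apply: le_trans (siCSn si (T_L2 xi Lh) (T_L2 xi Lh)) _; rewrite expr2.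
by apply: ler_pM; [exact: sqrtr_ge0|exact: sqrtr_ge0|exact: T_bound|exact: T_bound].
Qed.

Lemma integrable_cost z : L2 D z -> intP (cost z).
Proof.
move=> Lz; pose A := K * L2norm D z + L2norm D ut.
apply: (@integrable_of_growth _ (A ^+ 2 + `|alpha / 2 * L2norm D z ^+ 2|) (K ^+ 2)).
  exact: measurable_cost.
move=> xi; apply: le_trans (ler_normD _ _) _; rewrite addrAC lerD2r.
have h2 := state_norm_le xi Lz; have x0 : 0 <= L2norm D (S z xi - ut) by exact: sqrtr_ge0.
rewrite ger0_norm; last by rewrite mulr_ge0// sqr_ge0.
move: h2 x0; rewrite -/A; move: (L2norm D (S z xi - ut)) (L2norm D (g xi)) => x y h2 x0.
have := sqr_ge0 (A - K * y); have := lerXn2r 2 x0 (le_trans x0 h2) h2; lra.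
Qed.

(** The expected cost along the segment from [z] to [z + h] is a quadratic
    polynomial in the parameter [t], whose linear coefficient must be nonnegative
    at a minimizer. *)
Lemma variational_inequality (Z : set fct) z z' : Z `<=` L2 D -> convex_subset Z ->
  is_minimizer (fun w => \int[P]_xi (cost w xi)%:E)%E Z z -> Z z' ->
  0 <= \int[P]_xi gradient z (z' - z) xi.
Proof.
move=> ZL Zc [Zz zmin] Zz'; have Lz := ZL _ Zz; have Lz' := ZL _ Zz'.
pose h : fct := z' - z; have Lh : L2 D h by exact: (siB si Lz' Lz).
have ic := integrable_cost Lz; have ig := integrable_gradient Lz Lh.
have ik := integrable_curvature Lh.
have [I IE] : exists I, I = \int[P]_xi gradient z h xi by eexists.
have [J JE] : exists J, J = \int[P]_xi curvature h xi by eexists.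
have E t : \int[P]_xi cost (z + t *: h) xi = \int[P]_xi cost z xi + t * I + t ^+ 2 / 2 * J.
  have i1 := intgZ measurableT t ig; have i2 := intgZ measurableT (t ^+ 2 / 2) ik.
  have i3 := intgD measurableT ic i1.
  rewrite IE JE -(RintegralZl t measurableT ig) -(RintegralZl (t ^+ 2 / 2) measurableT ik).
  rewrite -(RintegralD measurableT ic i1) -(RintegralD measurableT i3 i2).
  by apply: eq_Rintegral => xi _; exact: cost_expansion.
have fE w : L2 D w -> (\int[P]_xi (cost w xi)%:E = (\int[P]_xi cost w xi)%:E)%E.
  move=> Lw; rewrite /Rintegral fineK//.
  by apply: integrable_fin_num => //; exact: integrable_cost.
rewrite -IE; apply: (@slope_ge0 _ (\int[P]_xi cost z xi) I J) => t t0 t1.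
have Lzt := siP si t Lz Lh.
have Zt : Z (z + t *: h).
  have -> : z + t *: h = (fun x => t * z' x + (1 - t) * z x).
    apply/funext => x; rewrite -[LHS]/(z x + t * (z' x - z x)); ring.
  by apply: Zc => //; rewrite (ltW t0).
by rewrite -(E t); exact: (le_of_EFin (fE _ Lz) (fE _ Lzt) (zmin _ Zt)).
Qed.

End one_measure.

(** Adding the variational inequalities of the two minimizers in the directions
    [h] and [- h], where [h = zQ - zP], and using that the gradient increases
    along [h] by at least [alpha] times the square of the norm of [h], isolates
    the difference of the expectations of one and the same gradient. *)
Lemma minimizers_dist (P Q : probability (borel Xi) R) (Z : set fct) zP zQ :
  (\int[P]_xi (L2norm D (g xi) ^+ 2)%:E < +oo)%E ->
  (\int[Q]_xi (L2norm D (g xi) ^+ 2)%:E < +oo)%E ->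
  Z `<=` L2 D -> convex_subset Z ->
  is_minimizer (fun w => \int[P]_xi (cost w xi)%:E)%E Z zP ->
  is_minimizer (fun w => \int[Q]_xi (cost w xi)%:E)%E Z zQ ->
  exists h, [/\ L2 D h, L2norm D h <= 1 &
    alpha * L2norm D (zQ - zP) <=
      `|\int[P]_xi gradient zQ h xi - \int[Q]_xi gradient zQ h xi|].
Proof.
move=> gP gQ ZL Zc minP minQ.
have [ZP ZQ] := (minP.1, minQ.1); have [LP LQ] := (ZL _ ZP, ZL _ ZQ).
have vP := variational_inequality gP ZL Zc minP ZQ.
have vQ := variational_inequality gQ ZL Zc minQ ZP.
have Lh : L2 D (zQ - zP) by exact: (siB si LQ LP).
have hN : zP - zQ = -1 *: (zQ - zP) by rewrite scaleN1r opprB.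
have hD : zQ = zP + 1 *: (zQ - zP) by rewrite scale1r addrC subrK.
move: (zQ - zP) Lh hN hD vP vQ => h Lh hN hD vP vQ.
have igP := integrable_gradient gP LQ Lh; have igQ := integrable_gradient gQ LQ Lh.
have igP' := integrable_gradient gP LP Lh.
have EQ : \int[Q]_xi gradient zQ (zP - zQ) xi = - \int[Q]_xi gradient zQ h xi.
  rewrite hN -[RHS]mulN1r -(RintegralZl (-1) measurableT igQ).
  by apply: eq_Rintegral => xi _; exact: gradientZ.
have ic : P.-integrable setT (EFin \o (fun _ : borel Xi => alpha * L2norm D h ^+ 2)).
  exact: finite_measure_integrable_cst.
have EP : \int[P]_xi gradient zP h xi + alpha * L2norm D h ^+ 2 <= \int[P]_xi gradient zQ h xi.
  have -> : alpha * L2norm D h ^+ 2 = \int[P]_xi (alpha * L2norm D h ^+ 2).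
    have := Rintegral_cst P measurableT (alpha * L2norm D h ^+ 2).
    have e : fine (P setT) = 1 := congr1 fine (probability_setT P).
    by move=> E; rewrite -[LHS]mulr1 -e; exact: (esym E).
  rewrite -(RintegralD measurableT igP' ic).
  apply: (le_Rintegral measurableT (intgD measurableT igP' ic) igP) => xi _.
  rewrite hD (gradientD 1 xi LP Lh) mul1r lerD2l; exact: curvature_ge.
have N0 : 0 <= L2norm D h by exact: sqrtr_ge0.
have key : alpha * L2norm D h ^+ 2 <=
    \int[P]_xi gradient zQ h xi - \int[Q]_xi gradient zQ h xi.
  move: vP vQ EP; rewrite EQ.
  move: (\int[P]_xi gradient zP h xi) (\int[P]_xi gradient zQ h xi).
  move: (\int[Q]_xi gradient zQ h xi) (alpha * L2norm D h ^+ 2) => p q r s; lra.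
move: N0; rewrite le_eqVlt => /predU1P[N0|N0].
  exists h; split=> //; first by rewrite -N0 ler01.
  by rewrite -N0 mulr0.
have EZ (M : probability (borel Xi) R) : M.-integrable setT (EFin \o gradient zQ h) ->
    \int[M]_xi gradient zQ ((L2norm D h)^-1 *: h) xi
      = (L2norm D h)^-1 * \int[M]_xi gradient zQ h xi.
  move=> ig; rewrite -(RintegralZl _ measurableT ig).
  by apply: eq_Rintegral => xi _; exact: gradientZ.
exists ((L2norm D h)^-1 *: h); split; first exact: (siZ si).
  have -> : L2norm D ((L2norm D h)^-1 *: h) = `|(L2norm D h)^-1| * L2norm D h := nmZ si _ Lh.
  by rewrite gtr0_norm ?invr_gt0// mulVf// gt_eqF.
rewrite (EZ P igP) (EZ Q igQ) -mulrBr normrM gtr0_norm ?invr_gt0//.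
rewrite ler_pdivlMl//; apply: le_trans (ler_norm _); apply: le_trans key.
by rewrite mulrCA expr2.
Qed.

End stability.

(** * Measurability of the data of the equation *)

Section data.
Context {R : realType} {n : nat} {Xi : pmetricType R}.
Local Notation fct := ('rV[R]_n.+1 -> R^o).
Variables (D : set 'rV[R]_n.+1).
Hypothesis oD : open D.
Let mD : measurable D := measurable_domain oD.

Lemma bform_measurable (b : 'I_n.+1 -> 'I_n.+1 -> 'rV[R]_n.+1 -> Xi -> R) (u v : fct) :
  (forall i j, measurable_fun (D `*` setT)
    (fun p : 'rV[R]_n.+1 * borel Xi => b i j p.1 p.2)) ->
  H10 D u -> H10 D v -> measurable_fun setT (fun xi : borel Xi => bform D b u v xi).
Proof.
move=> mb Vu Vv; have Hu := H10_H1 Vu; have Hv := H10_H1 Vv.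
apply: (@measurable_Rintegral_param _ _ _ (borel Xi) D mD
  (fun p : 'rV[R]_n.+1 * borel Xi => bform_integrand D b p.2 u v p.1)).
apply: measurable_sum => i; apply: measurable_sum => j.
apply: measurable_funM; first apply: measurable_funM.
- exact: mb.
- by apply: (measurable_fun_fst mD); exact: (weak_pderiv_L2 i Hu).1.
- by apply: (measurable_fun_fst mD); exact: (weak_pderiv_L2 j Hv).1.
Qed.

Variable g : 'rV[R]_n.+1 -> Xi -> R.
Hypothesis g_measurable : measurable_fun (D `*` setT)
  (fun p : 'rV[R]_n.+1 * borel Xi => g p.1 p.2).
Hypothesis g_L2 : forall xi, L2 D (g^~ xi).

Lemma data_weakly_measurable : weakly_measurable D (fun xi : Xi => g^~ xi : fct).
Proof.
split => // v Vv; have Lv := H10_L2 Vv.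
apply: (@measurable_Rintegral_param _ _ _ (borel Xi) D mD
  (fun p : 'rV[R]_n.+1 * borel Xi => g p.1 p.2 * v p.1)).
apply: measurable_funM; first exact: g_measurable.
by apply: (measurable_fun_fst mD); exact: Lv.1.
Qed.

Lemma data_norm_measurable :
  measurable_fun setT (fun xi : borel Xi => L2norm D (g^~ xi) ^+ 2).
Proof.
have := @measurable_Rintegral_param _ _ _ (borel Xi) D mD
  (fun p : 'rV[R]_n.+1 * borel Xi => g p.1 p.2 * g p.1 p.2)
  (measurable_funM g_measurable g_measurable).
apply: eq_measurable_fun => xi _.
by apply/esym; exact: (nm_sqr (L2_si oD) (g_L2 xi)).
Qed.

End data.

Theorem theorem5 (R : realType) (n : nat) (Xi : pmetricType R)
  (D : set 'rV[R]_n.+1)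
  (alpha gamma L : R)
  (utilde : 'rV[R]_n.+1 -> R) (Zad : set ('rV[R]_n.+1 -> R))
  (b : 'I_n.+1 -> 'I_n.+1 -> 'rV[R]_n.+1 -> Xi -> R)
  (g : 'rV[R]_n.+1 -> Xi -> R)
  (D_domain : bounded_domain D)
  (D_lipschitz : lipschitz_boundary D)
  (alpha_gt0 : 0 < alpha)
  (utilde_L2 : L2 D utilde)
  (Zad_sub : Zad `<=` L2 D)
  (Zad_neq0 : Zad !=set0)
  (Zad_closed : L2_closed D Zad)
  (Zad_convex : convex_subset Zad)
  (Zad_bounded : L2_bounded D Zad)
  (gamma_gt0 : 0 < gamma)
  (gamma_ltL : gamma < L)
  (b_measurable : forall i j, measurable_fun (D `*` setT)
     (fun p : 'rV[R]_n.+1 * borel Xi => b i j p.1 p.2))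
  (b_elliptic : forall y : 'rV[R]_n.+1,
     {ae lebesgue_rV n.+1, forall x, D x -> forall xi,
        gamma * (\sum_i y ord0 i ^+ 2)
          <= \sum_i \sum_j b i j x xi * y ord0 i * y ord0 j
          <= L * (\sum_i y ord0 i ^+ 2)})
  (bform_defined : forall xi u v, H10 D u -> H10 D v ->
     (lebesgue_rV n.+1).-integrable D (EFin \o bform_integrand D b xi u v))
  (A_bounded : forall xi u, H10 D u ->
     (dual_norm D (A_op D b xi u) <= (L * H10norm D u)%:E)%E)
  (g_measurable : measurable_fun (D `*` setT)
     (fun p : 'rV[R]_n.+1 * borel Xi => g p.1 p.2))
  (g_L2 : forall xi, L2 D (g^~ xi))
  (P Q : probability (borel Xi) R)
  (g_P : L2_bochner D P (fun xi => g^~ xi))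
  (g_Q : L2_bochner D Q (fun xi => g^~ xi))
  (zP zQ : 'rV[R]_n.+1 -> R)
  (zP_min : is_minimizer (expected_objective D b g utilde alpha P) Zad zP)
  (zQ_min : is_minimizer (expected_objective D b g utilde alpha Q) Zad zQ) :
  ((L2norm D (zQ - zP))%:E
     <= (8 / alpha)%:E * sup_dist (Fdi D b g utilde alpha Zad) P Q)%E.
Proof.
have [oD _ _ bD] := D_domain; have si := L2_si oD.
have L_gt0 : 0 < L by exact: lt_trans gamma_gt0 gamma_ltL.
have [Cp Cp0 CpP] := poincare oD bD.
(* [T] is bounded on [L2 D] since, by the Poincare inequality, the functional
   [v |-> <h, v>] is bounded on [H10 D] with constant [L2norm D h * Cp]. *)
pose T (xi : Xi) (h : 'rV[R]_n.+1 -> R^o) : 'rV[R]_n.+1 -> R^o := A_inv D b xi (L2_to_dual D h).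
have TP xi h : L2 D h ->
    H10 D (T xi h) /\ forall v, H10 D v -> bform D b (T xi h) v xi = L2dot D h v.
  move=> Lh; apply: (A_invP oD bD gamma_gt0 L_gt0 b_elliptic bform_defined A_bounded xi
    (C := (L2norm D h * Cp) ^+ 2)).
    by move=> a u v Vu Vv; exact: (siDr si a (H10_L2 Vu) (H10_L2 Vv) Lh).
  move=> v Vv; have e : H10norm D v ^+ 2 = H10dot D v v := nm_sqr (H10_si oD bD) Vv.
  rewrite -e -exprMn -[X in X <= _](real_normK (num_real _)).
  have h1 := siCSn si Lh (H10_L2 Vv).
  have h2 := ler_wpM2l (sqrtr_ge0 (L2dot D h h)) (CpP v Vv).
  rewrite mulrA in h2; have h3 := le_trans h1 h2.
  exact: (lerXn2r 2 (normr_ge0 _) (le_trans (normr_ge0 _) h3) h3).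
have lin_l xi v (Vv : H10 D v) := bform_linear_l oD bD bform_defined xi Vv.
have lin_r xi u (Vu : H10 D u) := bform_linear_r oD bD bform_defined xi Vu.
have bdd xi u v (Vu : H10 D u) (Vv : H10 D v) :=
  bform_bounded oD bD L_gt0 bform_defined A_bounded xi Vu Vv.
have coe xi u (Vu : H10 D u) := bform_coercive oD b_elliptic bform_defined xi Vu.
have mbf u v (Vu : H10 D u) (Vv : H10 D v) := bform_measurable oD b_measurable Vu Vv.
have K0 : 0 <= Cp ^+ 2 / gamma by rewrite divr_ge0 ?sqr_ge0// ltW.
have [gP gQ] : (\int[P]_xi (L2norm D (g^~ xi) ^+ 2)%:E < +oo)%E /\
  (\int[Q]_xi (L2norm D (g^~ xi) ^+ 2)%:E < +oo)%E by case: g_P; case: g_Q.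
have := minimizers_dist oD K0
  (fun xi h Lh => solution_L2 TP xi Lh)
  (fun xi h Lh => solution_bound oD bD gamma_gt0 coe TP Cp0 CpP xi Lh)
  (fun xi a h k w Lh Lk Lw => L2dot_solutionDl oD bD gamma_gt0 lin_l coe TP CpP xi a Lh Lk Lw)
  (fun h1 h2 w1 w2 => @measurable_solution_dot _ _ _ D oD bD (bform D b) gamma L gamma_gt0 L_gt0 lin_l lin_r bdd coe mbf T TP Cp Cp0 CpP h1 h2 w1 w2)
  g_L2 (data_weakly_measurable oD g_measurable g_L2)
  (data_norm_measurable oD g_measurable g_L2) utilde_L2
  gP gQ Zad_sub Zad_convex zP_min zQ_min.
move=> [h [Lh h1 hE]].
set d := sup_dist _ _ _.
have dE : ((alpha * L2norm D (zQ - zP))%:E <= d)%E.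
  apply: le_trans (_ : (_ <= (`|\int[P]_xi _ xi - \int[Q]_xi _ xi|)%:E)%E) _; last first.
    apply: ereal_sup_ubound; eexists; last reflexivity.
    by exists zQ, h; split => //; exact: zQ_min.1.
  rewrite lee_fin; exact: hE.
have N0 : 0 <= L2norm D (zQ - zP) by exact: sqrtr_ge0.
move: dE N0; move: (L2norm D (zQ - zP)) => N dE N0.
have a8 : 0 < 8 / alpha by rewrite divr_gt0.
have : ((8 / alpha)%:E * (alpha * N)%:E <= (8 / alpha)%:E * d)%E.
  by apply: lee_wpmul2l => //; rewrite lee_fin ltW.
apply: le_trans; rewrite -EFinM lee_fin mulrA divfK ?gt_eqF//.
by rewrite ler_peMl// ler1n.
Qed.
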